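(* Let $r \in \mathbb{N}$, let $\tau$ be a partition with $r$-quotient ${\boldsymbol\tau} = (\tau(0),\ldots,\tau(r-1))$, and let $\lambda/\mu$ be a skew partition of $n$. Then \[ s_\tau\,(s_{\lambda/\mu} \circ p_r) \;=\; \sum_{{\boldsymbol\nu}} \operatorname{sgn}_r\!\bigl(({\boldsymbol\nu}/{\boldsymbol\tau},\tau)^\star \big/ \tau\bigr)\; c^{\lambda}_{{\boldsymbol\nu}/{\boldsymbol\tau}\,:\,\mu}\; s_{({\boldsymbol\nu}/{\boldsymbol\tau},\tau)^\star}, \] where the sum is over all $r$-multipartitions ${\boldsymbol\nu}=(\nu(0),\ldots,\nu(r-1))$ such that ${\boldsymbol\nu}/{\boldsymbol\tau}$ is a skew $r$-multipartition of $n$, and ${\boldsymbol\nu}/{\boldsymbol\tau}:\mu$ denotes the skew $(r+1)$-multipartition $(\nu(0)/\tau(0),\ldots,\nu(r-1)/\tau(r-1),\mu/\varnothing)$.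
   Context: $s_\alpha$ and $s_{\lambda/\mu}$ are Schur and skew Schur functions, $p_r=\sum_i x_i^r$ is the power sum symmetric function, and for a symmetric function $f$ the plethysm $f\circ p_r$ is obtained by writing $f$ as a formal power series in $x_1,x_2,\ldots$ and substituting $x_i^r$ for each $x_i$. Abacus and $r$-quotients: for a partition $\alpha$ and an integer $N$ that is a multiple of $r$ with $N$ at least the number of parts of $\alpha$, the $\beta$-set of $\alpha$ is $X=\{\alpha_i+N-i: 1\le i\le N\}$ (with $\alpha_i=0$ for $i$ beyond the length); positions $p\ge 0$ are placed on runner $p \bmod r$, and $X$ is the set of positions holding beads. For runner $j$ let $\{m\ge 0: j+rm\in X\}=\{b_1>\cdots>b_{c_j}\}$; then $\alpha(j)$ is the partition with parts $b_i-(c_j-i)$. The $r$-quotient of $\alpha$ is $(\alpha(0),\ldots,\alpha(r-1))$ (independent of the choice of $N$ subject to $N$ a multiple of $r$). A skew $r$-multipartition ${\boldsymbol\nu}/{\boldsymbol\tau}$ of $n$ is a pair of $r$-tuples of partitions with $\tau(i)\subseteq\nu(i)$ for all $i$ and $\sum_i(|\nu(i)|-|\tau(i)|)=n$. The partition $({\boldsymbol\nu}/{\boldsymbol\tau},\tau)^\star$: choose $N$ a multiple of $r$ so large that, in the abacus of $\tau$ with $N$ beads, runner $j$ has $c_j$ beads with $c_j\ge$ the number of parts of $\nu(j)$ for every $j$. Then $({\boldsymbol\nu}/{\boldsymbol\tau},\tau)^\star$ is the partition whose $\beta$-set (with $N$ beads) is $\bigcup_j\{j+r(\nu(j)_i+c_j-i):1\le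 i\le c_j\}$; equivalently it is the unique partition $\nu\supseteq\tau$ with $|\nu/\tau|=rn$ obtained from the abacus of $\tau$ by moving beads down their runners so that runner $j$ represents $\nu(j)$. Sign: a border strip is a connected skew shape containing no $2\times 2$ square; an $r$-border strip is one with $r$ boxes; its height is one less than the number of rows it meets. A skew partition $\nu/\tau$ of $rn$ is $r$-decomposable if there are partitions $\tau=\sigma^{(0)}\subset\cdots\subset\sigma^{(n)}=\nu$ with each $\sigma^{(j)}/\sigma^{(j-1)}$ an $r$-border strip; then $\operatorname{sgn}_r(\nu/\tau)=\prod_j(-1)^{\mathrm{height}(\sigma^{(j)}/\sigma^{(j-1)})}$, which is independent of the choice of the $\sigma^{(j)}$; otherwise $\operatorname{sgn}_r(\nu/\tau)=0$. Generalized Littlewood--Richardson coefficients: the word of a semistandard skew tableau is obtained by reading its rows left to right, starting with the highest-numbered (lowest) row and ending with row 1; the word of an $m$-tuple of skew tableaux is the concatenation of their words in order. A word $w$ with entries in $\mathbb{N}$ is latticed if for every $k\ge1$ and every suffix of $w$, the suffix contains at least as many entries $k$ as entries $k+1$. For a skew $m$-multipartition ${\boldsymbol\sigma}/{\boldsymbol\rho}=(\sigma(1)/\rho(1),\ldots,\sigma(m)/\rho(m))$ of $n$ and a partition $\lambda$ of $n$, $c^\lambda_{{\boldsymbol\sigma}/{\boldsymbol\rho}}$ is the number of $m$-tuples $(t(1),\ldots,t(m))$ of semistandard skew tableaux with $t(i)$ of shape $\sigma(i)/\rho(i)$, total content $\sum_i\mathrm{cont}(t(i))=\lambda$, and latticed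 word. *)

(* Defs.v *)
From HB Require Import structures.
From mathcomp Require Import all_boot all_order all_algebra.
From mathcomp Require Import finmap.
From mathcomp Require Import boolp classical_sets functions cardinality fsbigop.
From mathcomp Require Import monalg.
Set Implicit Arguments.
Unset Strict Implicit.
Unset Printing Implicit Defensive.
Import GRing.Theory Num.Theory.
Local Open Scope classical_set_scope.
Local Open Scope ring_scope.

(* Rows, columns, parts, tableau entries and variables are indexed from 0: an
   entry k : nat of a tableau stands for the letter k + 1 of {1, 2, ...}, and
   the variables are x_0, x_1, ...
   The cardinality #|` fset_set A | and the sum over i \in A are the usual ones
   only for finite A, which is the case throughout (except in plethysm_p 0). *)

Definition is_part (p : seq nat) : bool := sorted geq p && (0%N \notin p).

Definition part (p : seq nat) (i : nat) : nat := nth 0%N p i.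

Definition part_included (mu lam : seq nat) : bool :=
  [forall i : 'I_(size mu), (part mu i <= part lam i)%N].

Definition in_skew (lam mu : seq nat) (b : nat * nat) : bool :=
  (part mu b.1 <= b.2 < part lam b.1)%N.

(* A tableau of shape lam / mu is the list of its rows; row i lists the entries
   in the columns part mu i, ..., part lam i - 1. *)
Definition tableau : Type := seq (seq nat).

Definition tab_entry (mu : seq nat) (t : tableau) (b : nat * nat) : nat :=
  nth 0%N (nth [::] t b.1) (b.2 - part mu b.1).

Definition ssyt (lam mu : seq nat) (t : tableau) : bool :=
  [&& size t == size lam,
      [forall i : 'I_(size lam),
         size (nth [::] t i) == (part lam i - part mu i)%N],
      all (sorted leq) t
    & [forall i : 'I_(size lam), [forall c : 'I_(head 0%N lam),
         in_skew lam mu (i : nat, c : nat) &&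
         in_skew lam mu (i.+1, c : nat) ==>
         (tab_entry mu t (i : nat, c : nat) <
          tab_entry mu t (i.+1, c : nat))%N]]].

Definition tab_word (t : tableau) : seq nat := flatten (rev t).

Definition tabs_word (ts : seq tableau) : seq nat :=
  flatten [seq tab_word t | t <- ts].

Definition has_content (w : seq nat) (a : nat -> nat) : Prop :=
  forall k, count_mem k w = a k.

Definition latticed (w : seq nat) : Prop :=
  forall (k : nat) (v : seq nat),
    suffix v w -> (count_mem k.+1 v <= count_mem k v)%N.

(* Formal power series in x_0, x_1, ... with integer coefficients: the function
   sending each monomial to its coefficient. *)
Definition powser : Type := {cmonom nat} -> int.

Definition powser_mul (f g : powser) : powser := fun m =>
  \sum_(ab \in [set ab : {cmonom nat} * {cmonom nat} | mmul ab.1 ab.2 = m])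
     f ab.1 * g ab.2.

(* Substituting x_i ^ r for x_i turns the monomial a into the monomial with
   exponents r * a i. *)
Definition plethysm_p (r : nat) (f : powser) : powser := fun m =>
  \sum_(a \in [set a : {cmonom nat} | forall i, m i = (r * a i)%N]) f a.

Definition skew_schur (lam mu : seq nat) : powser := fun m =>
  Posz #|` fset_set [set t : tableau |
             ssyt lam mu t /\ has_content (tab_word t) m]|.

Definition schur (lam : seq nat) : powser := skew_schur lam [::].

(* A skew multipartition is a list of pairs (sigma(i), rho(i)). *)
Definition lr_coef (lam : seq nat) (shapes : seq (seq nat * seq nat)) : nat :=
  #|` fset_set [set ts : seq tableau |
        [/\ all2 (fun sh t => ssyt sh.1 sh.2 t) shapes ts,
            has_content (tabs_word ts) (part lam)
          & latticed (tabs_word ts)]]|.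

Definition beta_set (N : nat) (al : seq nat) : seq nat :=
  [seq (part al i + N - i.+1)%N | i <- iota 0 N].

(* The partition whose beta-set is the decreasing list X; the same formula
   recovers the partition represented by a runner. *)
Definition part_of_beta (X : seq nat) : seq nat :=
  [seq p <- [seq (nth 0%N X i - (size X - i.+1))%N | i <- iota 0 (size X)]
       | p != 0%N].

(* The bead positions on runner j, in decreasing order when X is. *)
Definition runner (r j : nat) (X : seq nat) : seq nat :=
  [seq (x %/ r)%N | x <- X & (x %% r == j)%N].

Definition quotient_at (r N : nat) (al : seq nat) : r.-tuple (seq nat) :=
  [tuple part_of_beta (runner r j (beta_set N al)) | j < r].

(* The partition (nu / tau, tau)^* computed with N beads. *)
Definition star_at (r N : nat) (nu : r.-tuple (seq nat)) (tau : seq nat) :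
    seq nat :=
  let c j := size (runner r j (beta_set N tau)) in
  part_of_beta (sort geq
    (flatten [seq [seq (j + r * b)%N | b <- beta_set (c (j : nat)) (tnth nu j)]
             | j : 'I_r])).

(* Both are independent of N, among the admissible multiples of r; we fix
   admissible ones.  In the abacus of tau with r * (size tau + M) beads each
   runner has at least M beads. *)
Definition quotient (r : nat) (al : seq nat) : r.-tuple (seq nat) :=
  quotient_at r (r * size al) al.

Definition star (r : nat) (nu : r.-tuple (seq nat)) (tau : seq nat) : seq nat :=
  star_at (r * (size tau + \max_(j < r) size (tnth nu j))) nu tau.

Definition skew_boxes (lam mu : seq nat) : seq (nat * nat) :=
  [seq b <- [seq (i, c) | i <- iota 0 (size lam), c <- iota 0 (head 0%N lam)]
     | in_skew lam mu b].

Definition adjacent (b b' : nat * nat) : bool :=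
  (b.1 == b'.1) && ((b.2 == b'.2.+1) || (b'.2 == b.2.+1)) ||
  (b.2 == b'.2) && ((b.1 == b'.1.+1) || (b'.1 == b.1.+1)).

Definition skew_connected (lam mu : seq nat) : bool :=
  [forall b : seq_sub (skew_boxes lam mu),
   forall b' : seq_sub (skew_boxes lam mu),
     connect (fun x y => adjacent (val x) (val y)) b b'].

Definition no_square (lam mu : seq nat) : bool :=
  all (fun b => ~~ [&& in_skew lam mu (b.1.+1, b.2),
                       in_skew lam mu (b.1, b.2.+1)
                     & in_skew lam mu (b.1.+1, b.2.+1)])
      (skew_boxes lam mu).

Definition border_strip (r : nat) (mu lam : seq nat) : bool :=
  [&& is_part mu, is_part lam, part_included mu lam,
      skew_connected lam mu, no_square lam mu
    & size (skew_boxes lam mu) == r].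

Definition height (mu lam : seq nat) : nat :=
  (count (fun i => part mu i < part lam i)%N (iota 0 (size lam))).-1.

(* s = [:: sigma^(1); ...; sigma^(n)] is a chain of r-border strips from
   tau = sigma^(0) to nu = sigma^(n). *)
Definition strip_chain (r : nat) (tau nu : seq nat) (s : seq (seq nat)) : Prop :=
  path (border_strip r) tau s /\ last tau s = nu.

Definition chain_sign (tau : seq nat) (s : seq (seq nat)) : int :=
  \prod_(h <- pairmap height tau s) (-1) ^+ h.

(* sgn_r (nu / tau): the sign of an arbitrarily chosen chain, if there is one. *)
Definition sgn_strip (r : nat) (nu tau : seq nat) : int :=
  if `[< exists s, strip_chain r tau nu s >]
  then chain_sign tau (xget [::] [set s | strip_chain r tau nu s])
  else 0.

Definition skew_multipartition (r n : nat) (nu tau : r.-tuple (seq nat)) : Prop :=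
  [/\ forall j : 'I_r, is_part (tnth nu j) /\ is_part (tnth tau j),
      forall j : 'I_r, part_included (tnth tau j) (tnth nu j)
    & (\sum_(j < r) (sumn (tnth nu j) - sumn (tnth tau j)))%N = n].

(* Main.v *)
(** The idea, in N variables x_0, ..., x_(N-1) with N a large multiple of r: an
    alternating function of the exponents annihilates the part of a tableau sum
    that violates a lattice condition, by Stembridge's toggling involution.
    Applied to the tableaux of shape tau this gives a_delta s_tau = a_(tau+delta).
    Let the exponents tau + delta be the beads of an abacus, listed runner by
    runner; then a_(tau+delta) times s_(lam/mu)(x^r) is the sum over tableaux U
    of shape lam/mu of a_(pos + r content(U)), where only the U survive whose
    content keeps, at every stage of the reading, the beads of each runner in
    decreasing order.  Encoding U by the matrix of multiplicities
    (row, letter) |-> number of occurrences, column strictness of U and the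
    lattice condition on U are the same condition on the matrix and on its
    transpose.  So the transposes of the surviving matrices are the tuples of
    tableaux of shapes nu(j)/tau(j) counted by the Littlewood-Richardson
    coefficient.  The signs of the permutations that sort the beads before and
    after account for sgn_r, since moving a bead b to b + r past h beads is
    adding an r-border strip of height h.  Finally a_delta is cancelled. *)

(* Adding multiples of r can make two exponents equal only if they are congruent modulo r. This is
   why the lattice condition concerns beads of one runner only, and why the beads are listed runner
   by runner: beads to be compared then have adjacent indices k and k+1, as toggling requires. The
   listing may be chosen freely because the tableau sum is symmetric, at the price of one sign. The
   component mu / [::] acts through the reading order: its word is read first, the lattice condition
   forces its tableau, and its content mu becomes the inner shape of the tableaux U. Three features
   of the formal statement shape the bookkeeping. The number of beads in [star] varies with the
   multipartition, whereas one abacus must serve them all, so adding r beads has to be shown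
   harmless. [sgn_strip] evaluates an unspecified chain, so the sign of every chain is read off from
   its end points. Power series have infinitely many variables, so the identity is proved
   coefficient by coefficient, with an N depending on the monomial; cancelling a_delta then involves
   all coefficients in N variables at once. *)
Require Import Defs.
From HB Require Import structures.
From mathcomp Require Import all_boot all_order all_algebra.
From mathcomp Require Import fingroup perm finmap.
From mathcomp Require Import boolp classical_sets functions cardinality fsbigop.
From mathcomp Require Import monalg.
From mathcomp Require Import zify.
Set Implicit Arguments.
Unset Strict Implicit.
Unset Printing Implicit Defensive.
Import GRing.Theory Num.Theory.
Local Open Scope nat_scope.

(** * Toggling in a matrix of multiplicities *)

(* A tableau with base mu is encoded by x, where x p k is the number of entries k
   in row p; prow is then the length of row p of the subtableau of entries < e. *)
Definition prow (mu : nat -> nat) (x : nat -> nat -> nat) (e p : nat) : nat :=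
  mu p + \sum_(k < e) x p k.

(** Interlacing form of column strictness: the shapes [prow mu x e] and [prow mu x e.+1] differ by a
    horizontal strip. Stated through row lengths alone, it applies equally to a transposed
    matrix. *)
Definition colstrict (mu : nat -> nat) (x : nat -> nat -> nat) : Prop :=
  forall p e, prow mu x e.+1 p.+1 <= prow mu x e p.

Lemma prowS mu x e p : prow mu x e.+1 p = prow mu x e p + x p e.
Proof. by rewrite /prow big_ord_recr addnA. Qed.

Lemma prow0 mu x p : prow mu x 0 p = mu p.
Proof. by rewrite /prow big_ord0 addn0. Qed.

(* The Bender-Knuth involution on the entries k and k+1 of the rows q >= p, with
   the X rightmost entries k+1 of row p frozen.  In terms of the middle shape
   b = prow (k+1) between prow k and prow (k+2), it reflects each b q in the
   interval [lo, hi] allowed by the neighbouring shapes. *)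
Section Toggle.

Variables (mu : nat -> nat) (k p X : nat).
Implicit Types x : nat -> nat -> nat.

Definition toggle_lo x q := maxn (prow mu x k q) (prow mu x k.+2 q.+1).
(** Row [p] is bounded by its frozen cells instead of by row [p.-1], which toggling leaves alone;
    [toggleable] makes this the sharper bound. *)
Definition toggle_hi x q :=
  if q == p then prow mu x k.+2 q - X
  else minn (prow mu x k.+2 q) (prow mu x k q.-1).
Definition toggle_mid x q :=
  if q < p then prow mu x k.+1 q
  else toggle_lo x q + toggle_hi x q - prow mu x k.+1 q.
Definition toggle x : nat -> nat -> nat := fun q e =>
  if e == k then toggle_mid x q - prow mu x k q
  else if e == k.+1 then prow mu x k.+2 q - toggle_mid x q
  else x q e.

Definition toggleable x := [/\ colstrict mu x, X <= x p k.+1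
  & 0 < p -> prow mu x k.+2 p <= prow mu x k p.-1 + X].

Variable x : nat -> nat -> nat.
Hypothesis xT : toggleable x.

Let xC : colstrict mu x. Proof. by case: xT. Qed.

(** The reflected middle shape interlaces with both neighbours. Row [p] owes this to the last
    condition of [toggleable], the other rows to column strictness. *)
Lemma toggle_midP q :
  [/\ prow mu x k q <= toggle_mid x q <= prow mu x k.+2 q,
      toggle_mid x q.+1 <= prow mu x k q,
      prow mu x k.+2 q.+1 <= toggle_mid x q
    & p <= q -> toggle_mid x q + prow mu x k.+1 q = toggle_lo x q + toggle_hi x q /\
               toggle_mid x q <= toggle_hi x q].
Proof.
have H q' : [/\ prow mu x k q' <= toggle_mid x q',
   toggle_mid x q' <= prow mu x k.+2 q',
   prow mu x k.+2 q'.+1 <= toggle_mid x q',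
   (0 < q' -> toggle_mid x q' <= prow mu x k q'.-1) &
   (p <= q' -> toggle_mid x q' + prow mu x k.+1 q' = toggle_lo x q' + toggle_hi x q' /\
               toggle_mid x q' <= toggle_hi x q')].
  case: xT => _ Xle Xp.
  have := xC q' k.+1; have := xC q' k.
  have := xC q'.-1 k; have := xC q'.-1 k.+1.
  rewrite /toggle_mid /toggle_lo /toggle_hi !prowS.
  have [ltqp|lepq] := ltnP q' p.
    by case: q' ltqp => [|q'] /= ltqp; rewrite ?prowS; split; lia.
  have [eqp|neqp] := eqVneq q' p.
    subst q'; case: (p) Xle Xp => [|p'] /= Xle Xp; rewrite ?prowS in Xp *;
      split; rewrite ?prowS; lia.
  by case: q' lepq neqp => [|q'] /=; rewrite ?prowS; split; lia.
by case: (H q) => h1 h2 h3 h4 h5; case: (H q.+1) => g1 g2 g3 g4 g5; split => //;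
  [rewrite h1 h2 | apply: g4].
Qed.

Lemma prow_toggle e q : prow mu (toggle x) e q =
  if e == k.+1 then toggle_mid x q else prow mu x e q.
Proof.
have [/andP[h1 h2] _ _ _] := toggle_midP q.
elim: e => [|e IHe]; first by rewrite !prow0.
rewrite prowS IHe eqSS /toggle.
have [->|nek] := eqVneq e k.
  by rewrite ifN ?subnKC // neq_ltn ltnSn.
have [->|nek1] := eqVneq e k.+1; last by rewrite prowS.
by rewrite subnKC.
Qed.

Lemma toggle_colstrict : colstrict mu (toggle x).
Proof.
move=> q e; have [_ h2 h3 _] := toggle_midP q.
rewrite !prow_toggle eqSS.
have [->|nek] := eqVneq e k; first by rewrite ifN // neq_ltn ltnSn.
by have [->|nek1] := eqVneq e k.+1.
Qed.

Lemma toggle_row_lt q e : q < p -> toggle x q e = x q e.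
Proof.
move=> ltqp; rewrite /toggle /toggle_mid ltqp !prowS.
by have [->|nek] := eqVneq e k; [|have [->|nek1] := eqVneq e k.+1]; lia.
Qed.

Lemma toggle_other q e : e != k -> e != k.+1 -> toggle x q e = x q e.
Proof. by rewrite /toggle => /negPf-> /negPf->. Qed.

Lemma toggle_frozen : X <= toggle x p k.+1.
Proof.
have [_ _ _ /(_ (leqnn p))[_ h]] := toggle_midP p.
case: xT => _ + _; rewrite /toggle /toggle_hi eqxx in h * => Xle.
rewrite ifN ?ifT //; last by rewrite neq_ltn ltnSn orbT.
by move: h; rewrite !prowS; lia.
Qed.

(** The interval of the reflection depends only on the shapes [prow k] and [prow k.+2], which
    toggling preserves. *)
Lemma toggleK : toggle (toggle x) =2 x.
Proof.
move=> q e; rewrite {1}/toggle.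
have k1 : (k == k.+1) = false by rewrite ltn_eqF.
have k2 : (k.+2 == k.+1) = false by rewrite gtn_eqF.
have mid : toggle_mid (toggle x) q = prow mu x k.+1 q.
  have [_ _ _ h] := toggle_midP q.
  rewrite /toggle_mid /toggle_lo /toggle_hi !prow_toggle k1 k2 eqxx.
  have [ltqp|lepq] := ltnP q p; first by rewrite /toggle_mid ltqp.
  by have [] := h lepq; rewrite /toggle_lo /toggle_hi; lia.
rewrite !prow_toggle k1 k2 mid.
have [->|nek] := eqVneq e k; first by rewrite prowS addKn.
have [->|nek1] := eqVneq e k.+1; first by rewrite (prowS mu x k.+1) addKn.
exact: toggle_other.
Qed.

Variable R : nat.
Hypothesis pR : p < R.
Hypothesis xR : forall q e, R <= q -> mu q = 0 /\ x q e = 0.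

Let prowR q e : R <= q -> prow mu x e q = 0.
Proof.
by move=> Rq; rewrite /prow (xR 0 Rq).1 big1 // => i _; rewrite (xR i Rq).2.
Qed.

(** The maximum in [toggle_lo] at row [q] and the minimum in [toggle_hi] at row [q.+1] are taken
    over the same two numbers, so they add up to the sum of these. Row [p] accounts for [X], and
    below the last row everything is empty. *)
Lemma toggle_sum_tail :
  \sum_(p <= q < R) toggle_lo x q + \sum_(p <= q < R) toggle_hi x q + X =
  \sum_(p <= q < R) prow mu x k q + \sum_(p <= q < R) prow mu x k.+2 q.
Proof.
have Xc : X <= prow mu x k.+2 p by case: xT => _ + _; rewrite !prowS; lia.
have H n : p <= n -> \sum_(p <= q < n.+1) toggle_lo x q +
    \sum_(p <= q < n.+1) toggle_hi x q + X =
  \sum_(p <= q < n.+1) prow mu x k q + \sum_(p <= q < n.+1) prow mu x k.+2 q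
  + (toggle_lo x n - prow mu x k n).
  elim: n => [|n IHn] lepn.
    have p0 : p = 0 by lia.
    by move: Xc; rewrite /toggle_hi /toggle_lo p0 !big_nat1 eqxx; lia.
  have [ltnp|lepn'] := ltnP n p.
    have <- : p = n.+1 by lia.
    by rewrite !big_nat1 /toggle_hi /toggle_lo eqxx; lia.
  have hiE : toggle_hi x n.+1 = minn (prow mu x k.+2 n.+1) (prow mu x k n).
    by rewrite /toggle_hi ifN //; lia.
  move: (IHn lepn') (xC n k) (xC n k.+1).
  rewrite !(big_nat_recr n.+1) //= hiE.
  set A := \sum_(_ <= _ < _) _; set B := \sum_(_ <= _ < _) _.
  set A' := \sum_(_ <= _ < _) _; set B' := \sum_(_ <= _ < _) _.
  by rewrite /toggle_lo !prowS; lia.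
case: R pR prowR => // n lepn prn; rewrite H // /toggle_lo (prn n.+1) //.
by rewrite maxn0 subnn addn0.
Qed.

(** Summing the reflection over the rows from [p] on: their new entries [k] are as many as their old
    unfrozen entries [k.+1]. *)
Lemma toggle_col_k :
  \sum_(q < R) toggle x q k + X =
  \sum_(q < p) x q k + \sum_(p <= q < R) x q k.+1.
Proof.
rewrite -(big_mkord xpredT (fun q => toggle x q k)) (big_cat_nat (n := p)) //=; last exact: ltnW.
rewrite big_mkord.
have -> : \sum_(q < p) toggle x q k = \sum_(q < p) x q k.
  by apply: eq_bigr => i _; rewrite toggle_row_lt.
rewrite -addnA; congr (_ + _).
have E : \sum_(p <= i < R) toggle x i k + \sum_(p <= i < R) prow mu x k i +
   \sum_(p <= i < R) prow mu x k.+1 i =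
   \sum_(p <= q < R) toggle_lo x q + \sum_(p <= q < R) toggle_hi x q.
  rewrite -!big_split /=; apply: eq_big_nat => q /andP[lepq _].
  have [/andP[h1 _] _ _ /(_ lepq)[h2 _]] := toggle_midP q.
  by rewrite /toggle eqxx subnK.
have := toggle_sum_tail; rewrite -E.
have -> : \sum_(p <= i < R) prow mu x k.+2 i =
  \sum_(p <= i < R) prow mu x k.+1 i + \sum_(p <= i < R) x i k.+1.
  by rewrite -big_split /=; apply: eq_bigr => q _; rewrite prowS.
lia.
Qed.

Lemma toggle_col_k1 :
  \sum_(q < R) toggle x q k.+1 =
  \sum_(q < p) x q k.+1 + \sum_(p <= q < R) x q k + X.
Proof.
have := toggle_col_k.
have E : \sum_(q < R) toggle x q k + \sum_(q < R) toggle x q k.+1 =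
  \sum_(q < R) x q k + \sum_(q < R) x q k.+1.
  rewrite -!big_split /=; apply: eq_bigr => q _.
  have := prow_toggle k.+2 q; rewrite gtn_eqF // !prowS.
  by rewrite (prow_toggle k) ltn_eqF //; lia.
have S e : \sum_(q < R) x q e = \sum_(q < p) x q e + \sum_(p <= q < R) x q e.
  by rewrite -!(big_mkord xpredT (fun q => x q e)) (@big_cat_nat _ _ _ p) //= ltnW.
by move: E; rewrite !S; lia.
Qed.

End Toggle.

Lemma sum_ordS (g : nat -> nat) n : \sum_(i < n.+1) g i = \sum_(i < n) g i + g n.
Proof. by rewrite big_ord_recr. Qed.

Lemma sum_ord_split (g : nat -> nat) p n : p <= n ->
  \sum_(i < n) g i = \sum_(i < p) g i + \sum_(p <= i < n) g i.
Proof. by move=> lepn; rewrite -!(big_mkord xpredT) (@big_cat_nat _ _ _ p). Qed.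

(** * Cancellation of the tableaux violating the lattice condition *)

Section Lattice.

Variables (same : pred nat) (beta : nat -> nat).
Implicit Types x : nat -> nat -> nat.

(* beta is strict where prow is weak: up to this shift, lattice is colstrict of
   the transposed matrix, required only between the letters k and k+1 with
   same k. *)
Definition violation x p k :=
  same k && (beta k + \sum_(q < p) x q k <= beta k.+1 + \sum_(q < p.+1) x q k.+1).

Definition lattice x : Prop := forall p k, ~~ violation x p k.

(** Rows are read from the top, each from its right end, that is from its largest letter down. Hence
    [p] is minimal and then [k] maximal. *)
Definition first_violation x p k := [/\ violation x p k,
  forall p' k', p' < p -> ~~ violation x p' k'
  & forall k', k < k' -> ~~ violation x p k'].

Lemma first_violation_uniq x p k p' k' :
  first_violation x p k -> first_violation x p' k' -> p = p' /\ k = k'.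
Proof.
move=> [v m n] [v' m' n'].
have pp : p = p'.
  case: (ltngtP p p') => // lt.
    by have := m' _ k lt; rewrite v.
  by have := m _ k' lt; rewrite v'.
subst p'; split=> //.
case: (ltngtP k k') => // lt.
  by have := n _ lt; rewrite v'.
by have := n' _ lt; rewrite v.
Qed.

Variable N : nat.
Hypothesis sameN : forall k, same k -> k.+1 < N.

Lemma ex_first_violation x : ~ lattice x -> exists p k, first_violation x p k.
Proof.
move=> nl.
have [p0 [k0 v0]] : exists p k, violation x p k.
  apply: contrapT => H; apply: nl => p k; apply/negP => v.
  by apply: H; exists p, k.
have exP : exists p, [exists k : 'I_N, violation x p k].
  have k0N : k0 < N by move: v0 => /andP[/sameN/ltnW].
  by exists p0; apply/existsP; exists (Ordinal k0N).
case: (ex_minnP exP) => p /existsP[k1 v1] pmin.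
have exK : exists k, violation x p k by exists k1.
have ubK k : violation x p k -> k <= N by move=> /andP[/sameN/ltnW/ltnW].
case: (ex_maxnP exK ubK) => k vk kmax.
exists p, k; split => // [p' k' lt|k' lt]; apply/negP => v.
  have k'N : k' < N by move: v => /andP[/sameN/ltnW].
  have /pmin : [exists k : 'I_N, violation x p' k].
    by apply/existsP; exists (Ordinal k'N).
  by rewrite leqNgt lt.
by have := kmax _ v; rewrite leqNgt lt.
Qed.

Hypothesis betaS : forall k, same k -> beta k.+1 < beta k.

(** At a first violation, the number of entries [k.+1] of row [p] that are read until the two
    exponents agree; these are the entries to freeze. *)
Definition excess x p k :=
  beta k + \sum_(q < p) x q k - (beta k.+1 + \sum_(q < p) x q k.+1).

Variables (mu : nat -> nat) (R : nat) (x : nat -> nat -> nat) (p k : nat).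
Hypothesis xC : colstrict mu x.
Hypothesis xR : forall q e, R <= q -> mu q = 0 /\ x q e = 0.
Hypothesis xV : first_violation x p k.

Let X := excess x p k.

(** The truncated subtraction is exact because the row before [p] has no violation; for [p = 0] this
    is [betaS]. *)
Lemma excessE : X + (beta k.+1 + \sum_(q < p) x q k.+1) =
  beta k + \sum_(q < p) x q k.
Proof.
case: xV => /andP[sk _] m _; rewrite /X /excess subnK //.
move: m; case: (p) => [_|p' m]; first by rewrite !big_ord0 !addn0; exact/ltnW/betaS.
have := m p' k (ltnSn _); rewrite /violation sk /= -ltnNge.
rewrite (sum_ordS (x ^~ k)) /=.
lia.
Qed.

(** The violation itself gives [X <= x p k.+1]. Its absence in row [p.-1] gives [x p.-1 k < X], and
    the bound on row [p] then follows from column strictness against row [p.-1]. *)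
Lemma violation_toggleable : toggleable mu k p X x.
Proof.
split=> //.
  move: excessE; case: xV => /andP[_] + _ _.
  by rewrite big_ord_recr /=; lia.
move: excessE; case: xV => /andP[sk _] m _; move: m.
case: (p) => [//|p' m] XE _ /=.
have := m p' k (ltnSn _); rewrite /violation sk /= -ltnNge => lt.
have := xC p' k.+1; rewrite (prowS mu x k p').
move: XE; rewrite (sum_ordS (x ^~ k)) /=.
lia.
Qed.

Lemma violation_row : p < R.
Proof.
case: xV => /andP[sk v] m _; rewrite ltnNge; apply/negP => Rp.
move: v m Rp; rewrite big_ord_recr /=.
case: (p) => [|p'] v m Rp.
  by move: v; rewrite !big_ord0 /= (xR _ Rp).2 !addn0 leqNgt betaS.
have := m p' k (ltnSn _); rewrite /violation sk /= -ltnNge.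
move: v; rewrite (xR _ Rp).2 (sum_ordS (x ^~ k)) /=.
lia.
Qed.

Let x' := toggle mu k p X x.

Lemma first_violation_toggle : first_violation x' p k.
Proof.
have T := violation_toggleable.
have rows e p' : p' <= p -> \sum_(q < p') x' q e = \sum_(q < p') x q e.
  move=> lep; apply: eq_bigr => q _; rewrite /x' toggle_row_lt //.
  exact: leq_trans (ltn_ord q) lep.
case: xV => /andP[sk v] m n; split.
- rewrite /violation sk /= big_ord_recr /= !rows //.
  by have := toggle_frozen T; rewrite -/x' -excessE; lia.
- by move=> p' k' lt; rewrite /violation !rows //; [exact: m | exact: ltnW].
- move=> k' lt; have := n k' lt; rewrite /violation.
  rewrite !big_ord_recr /= !rows //.
  by rewrite {1}/x' (toggle_other _ _ _ _ _ (e := k'.+1)) //; lia.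
Qed.

Lemma excess_toggle : excess x' p k = X.
Proof.
have T := violation_toggleable.
have rows e : \sum_(q < p) x' q e = \sum_(q < p) x q e.
  by apply: eq_bigr => q _; rewrite /x' toggle_row_lt.
by rewrite /excess !rows.
Qed.

Lemma col_toggle_k : beta k + \sum_(q < R) x' q k = beta k.+1 + \sum_(q < R) x q k.+1.
Proof.
have := toggle_col_k violation_toggleable violation_row xR.
have := excessE; rewrite -/x'.
rewrite (sum_ord_split (x ^~ k.+1) (ltnW violation_row)) /=.
lia.
Qed.

Lemma col_toggle_k1 : beta k.+1 + \sum_(q < R) x' q k.+1 = beta k + \sum_(q < R) x q k.
Proof.
have := toggle_col_k1 violation_toggleable violation_row xR.
have := excessE; rewrite -/x'.
rewrite (sum_ord_split (x ^~ k) (ltnW violation_row)) /=.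
lia.
Qed.

End Lattice.

(** Bounded entries give a finite type, so sums over tableaux are finite sums. [ent] leads back to
    functions on all of [nat], zero outside the matrix, on which toggling is defined. *)
Definition mat R N B := {ffun 'I_R * 'I_N -> 'I_B.+1}.

Definition ent R N B (M : mat R N B) (p k : nat) : nat :=
  if insub p is Some i then if insub k is Some j then M (i, j) else 0 else 0.

Definition mkmat R N B (x : nat -> nat -> nat) : mat R N B :=
  [ffun ij : 'I_R * 'I_N => inord (x ij.1 ij.2)].

Lemma ent_ord R N B (M : mat R N B) (i : 'I_R) (j : 'I_N) : ent M i j = M (i, j).
Proof. by rewrite /ent !valK. Qed.

Lemma ent_out R N B (M : mat R N B) p k : (R <= p) || (N <= k) -> ent M p k = 0.
Proof.
rewrite /ent; case: insubP => [i ltp _|//].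
case: insubP => [j ltk _|//].
by rewrite leqNgt ltp leqNgt ltk.
Qed.

Lemma mkmatK R N B (M : mat R N B) : mkmat R N B (ent M) = M.
Proof. by apply/ffunP => -[i j]; rewrite ffunE ent_ord inord_val. Qed.

Lemma entK R N B (x : nat -> nat -> nat) :
  (forall p k, x p k <= B) -> (forall p k, (R <= p) || (N <= k) -> x p k = 0) ->
  ent (mkmat R N B x) = x.
Proof.
move=> xB x0; apply/funext => p; apply/funext => k.
have [ltp|lep] := ltnP p R; last by rewrite ent_out ?x0 ?lep.
have [ltk|lek] := ltnP k N; last by rewrite ent_out ?x0 ?lek ?orbT.
by rewrite -[p]/(val (Ordinal ltp)) -[k]/(val (Ordinal ltk)) ent_ord ffunE inordK //= ltnS.
Qed.

Definition vec N := {ffun 'I_N -> nat}.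
Definition vadd N (u v : vec N) : vec N := [ffun k => u k + v k].
Definition vscale N r (u : vec N) : vec N := [ffun k => r * u k].
Definition vperm N (s : 'S_N) (v : vec N) : vec N := [ffun k => v (s k)].
Definition vecof N (b : nat -> nat) : vec N := [ffun k : 'I_N => b k].

Definition colv R N B (M : mat R N B) : vec N := [ffun k : 'I_N => \sum_(p < R) ent M p k].

Definition tabmat R N B (mu lam : nat -> nat) (M : mat R N B) : bool :=
  `[< colstrict mu (ent M) /\ forall p, prow mu (ent M) N p = lam p >].

Section TabSums.

Variables (R N B : nat) (mu lam : nat -> nat).
Hypothesis lamB : forall p, lam p <= B.
Hypothesis lamR : forall p, R <= p -> lam p = 0.
Let mat := mat R N B.
Local Notation tab := (@tabmat R N B mu lam).

Lemma tabmat_supp (M : mat) : tab M -> forall q e, R <= q -> mu q = 0 /\ ent M q e = 0.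
Proof.
move=> /asboolP[_ h] q e Rq; rewrite ent_out ?Rq //; split=> //.
by have := h q; rewrite lamR // /prow; lia.
Qed.

(** Toggling preserves row sums, so each new entry is at most [lam q] and the [inord] in [mkmat]
    loses nothing. *)
Lemma toggle_ent (M : mat) k p X : tab M -> toggleable mu k p X (ent M) ->
  k.+1 < N -> ent (mkmat R N B (toggle mu k p X (ent M))) = toggle mu k p X (ent M).
Proof.
move=> /asboolP[C h] T kN.
have rowN q : prow mu (toggle mu k p X (ent M)) N q = lam q.
  by rewrite prow_toggle // ifN ?h //; lia.
have le0 q e : N <= e -> toggle mu k p X (ent M) q e = 0.
  by move=> Ne; rewrite toggle_other ?ent_out ?Ne ?orbT //; lia.
have leB q e : toggle mu k p X (ent M) q e <= lam q.
  have [eN|Ne] := ltnP e N; last by rewrite le0.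
  rewrite -rowN /prow (bigD1 (Ordinal eN)) //=; lia.
apply: entK => [q e|q e /orP[Rq|]]; [|have := leB q e; rewrite lamR //; lia | exact: le0].
exact: leq_trans (leB q e) _.
Qed.

Lemma toggle_tabmat (M : mat) k p X : tab M -> toggleable mu k p X (ent M) ->
  k.+1 < N -> tab (mkmat R N B (toggle mu k p X (ent M))).
Proof.
move=> tM T kN; apply/asboolP; rewrite toggle_ent //; split.
  exact: toggle_colstrict.
by move: tM => /asboolP[C h] q; rewrite prow_toggle // ifN ?h //; lia.
Qed.

Lemma col_swap (M M' : mat) (b b' : vec N) (i j : 'I_N) : j = i.+1 :> nat ->
  (forall q (e : 'I_N), e != i -> e != j -> ent M' q e = ent M q e) ->
  b i + \sum_(q < R) ent M' q i = b j + \sum_(q < R) ent M q j ->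
  b j + \sum_(q < R) ent M' q j = b i + \sum_(q < R) ent M q i ->
  vadd b (colv M') = vperm (tperm i j) (vadd b (colv M)).
Proof.
move=> ji Ho Hi Hj; apply/ffunP => e; rewrite !ffunE.
case: tpermP => [->|->|/eqP ni /eqP nj]; rewrite ?Hi ?Hj //.
by congr (_ + _); apply: eq_bigr => q _; rewrite Ho.
Qed.

(** With [p = X = 0] every row is toggled and nothing is frozen: the classical Bender-Knuth
    involution, which exchanges two adjacent exponents. *)
Lemma tab_sym_step (F : vec N -> int) (i j : 'I_N) : j = i.+1 :> nat ->
  (\sum_(M : mat | tab M) F (colv M) =
   \sum_(M : mat | tab M) F (vperm (tperm i j) (colv M)))%R.
Proof.
move=> ji.
have kN : i.+1 < N by rewrite -ji.
pose h (M : mat) := mkmat R N B (toggle mu i 0 0 (ent M)).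
have T (M : mat) : tab M -> toggleable mu i 0 0 (ent M).
  by move=> /asboolP[C _]; split.
have hK (M : mat) : tab M -> h (h M) = M.
  move=> tM; rewrite /h toggle_ent //; last exact: T.
  rewrite -[RHS]mkmatK; congr mkmat.
  by apply/funext => q; apply/funext => e; rewrite toggleK //; exact: T.
have hT (M : mat) : tab M -> tab (h M).
  by move=> tM; apply: toggle_tabmat => //; apply: T.
rewrite (reindex_onto h h) => [|M tM]; last exact: hK.
apply: eq_big => [M|M /andP[tM /eqP hh]].
  apply/andP/idP => [[tM /eqP <-]|tM]; first exact: hT.
  by rewrite hT // hK.
have {}tM : tab M by rewrite -hh; apply: hT.
congr F.
have := @col_swap M (h M) [ffun=> 0] [ffun=> 0] i j ji.
have v0 v : vadd [ffun=> 0] v = v by apply/ffunP => e; rewrite !ffunE.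
rewrite !v0; apply.
- move=> q e ni nj; have ej : val e != i.+1 by rewrite -ji.
  by rewrite toggle_ent ?toggle_other //; exact: T.
- rewrite !ffunE !add0n toggle_ent //; last exact: T.
  have [R0|R0] := posnP R; first by rewrite !big1 // => q; have := ltn_ord q; rewrite {2}R0.
  have := toggle_col_k (T _ tM) R0 (tabmat_supp tM).
  by rewrite big_ord0 addn0 add0n big_mkord ji.
- rewrite !ffunE !add0n toggle_ent //; last exact: T.
  have [R0|R0] := posnP R; first by rewrite !big1 // => q; have := ltn_ord q; rewrite {2}R0.
  have := toggle_col_k1 (T _ tM) R0 (tabmat_supp tM).
  by rewrite big_ord0 addn0 add0n big_mkord ji.
Qed.

Lemma vpermM n (s t : 'S_n) v : vperm s (vperm t v) = vperm (s * t)%g v.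
Proof. by apply/ffunP => k; rewrite !ffunE permM. Qed.

(** Symmetry of skew Schur polynomials. [F] is arbitrary, so that the claim for a product of
    permutations follows by applying the claim for one factor to a composed function. *)
Lemma tab_sym (F : vec N -> int) (s : 'S_N) :
  (\sum_(M : mat | tab M) F (colv M) =
   \sum_(M : mat | tab M) F (vperm s (colv M)))%R.
Proof.
pose P s := forall F : vec N -> int, (\sum_(M : mat | tab M) F (colv M) =
   \sum_(M : mat | tab M) F (vperm s (colv M)))%R.
have PM t u : P t -> P u -> P (t * u)%g.
  move=> Pt Pu {}F; rewrite (Pt F) (Pu (fun v => F (vperm t v))).
  by apply: eq_bigr => M _; rewrite vpermM.
have P1 : P 1%g.
  move=> {}F; apply: eq_bigr => M _; congr F.
  by apply/ffunP => k; rewrite !ffunE perm1.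
have Pstep (i j : 'I_N) : j = i.+1 :> nat -> P (tperm i j).
  by move=> ji {}F; exact: tab_sym_step.
(* Conjugation by the transposition of [j.-1] and [j] shortens the distance by one. *)
have Plt d (i j : 'I_N) : j = i + d.+1 :> nat -> P (tperm i j).
  elim: d j => [|d IHd] j jE; first by apply: Pstep; lia.
  have lt : i + d.+1 < N by have := ltn_ord j; lia.
  pose j' := Ordinal lt.
  have -> : tperm i j = (tperm j' j * tperm i j' * tperm j' j)%g.
    have -> : tperm i j = (tperm i j' ^ tperm j' j)%g.
      rewrite tpermJ tpermL tpermD //; apply/eqP => /(congr1 val) /=; lia.
    by rewrite /conjg tpermV mulgA.
  by apply: (PM _ _); [apply: (PM _ _)|]; [apply: Pstep|apply: IHd|apply: Pstep] => /=; lia.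
have Pt (i j : 'I_N) : P (tperm i j).
  case: (ltngtP i j) => [lt|lt|/val_inj->]; last by rewrite tperm1.
    by apply: (Plt (j - i).-1); lia.
  by rewrite tpermC; apply: (Plt (i - j).-1); lia.
have [ts sE _] := prod_tpermP s.
suff : P s by apply.
rewrite {}sE; elim: ts => [|t ts IH]; first by rewrite big_nil.
by rewrite big_cons; apply: PM.
Qed.

Section Cancel.

Variables (same : pred nat) (b : nat -> nat) (f : vec N -> int).
Hypothesis sameN : forall k, same k -> k.+1 < N.
Hypothesis bS : forall k, same k -> b k.+1 < b k.
Hypothesis fA : forall (i j : 'I_N) v, j = i.+1 :> nat -> same i ->
  (f (vperm (tperm i j) v) = - f v)%R.

(* At the first violation in reading order the exponents of x_k and x_(k+1) agree,
   so toggling what remains to be read transposes the two exponents. *)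
Lemma lattice_cancel :
  (\sum_(M : mat | tab M) f (vadd (vecof N b) (colv M)) =
   \sum_(M : mat | tab M && `[< lattice same b (ent M) >]) f (vadd (vecof N b) (colv M)))%R.
Proof.
rewrite (bigID (fun M : mat => `[< lattice same b (ent M) >])) /=.
rewrite -[RHS]addr0; congr (_ + _)%R.
set S := (\sum_(M | _) _)%R.
suff SN : S = (- S)%R.
  by clearbody S; lia.
(* The first violation is unique and remains the first violation of [h M], so [xget] returns the
   same pair for both and [h] is an involution on the bad matrices. *)
pose pk (M : mat) := xget (0, 0) [set pk | first_violation same b (ent M) pk.1 pk.2].
pose h (M : mat) := mkmat R N B
  (toggle mu (pk M).2 (pk M).1 (excess b (ent M) (pk M).1 (pk M).2) (ent M)).
pose bad (M : mat) := tab M && ~~ `[< lattice same b (ent M) >].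
have pkP M : bad M -> first_violation same b (ent M) (pk M).1 (pk M).2.
  move=> /andP[_ /asboolPn /(ex_first_violation sameN)[p [k fv]]].
  exact: (@xgetPex _ (0, 0) [set pk | first_violation same b (ent M) pk.1 pk.2]
    (ex_intro _ (p, k) fv)).
have badC M : bad M -> colstrict mu (ent M) by move=> /andP[/asboolP[]].
have badT M : bad M -> toggleable mu (pk M).2 (pk M).1
  (excess b (ent M) (pk M).1 (pk M).2) (ent M).
  by move=> bM; apply: (violation_toggleable bS (badC _ bM) (pkP _ bM)).
have kN M : bad M -> (pk M).2.+1 < N.
  by move=> /pkP[/andP[/sameN]].
have hE M : bad M -> ent (h M) =
  toggle mu (pk M).2 (pk M).1 (excess b (ent M) (pk M).1 (pk M).2) (ent M).
  move=> bM; rewrite /h toggle_ent //; [by case/andP: bM|exact: badT|exact: kN].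
have hfv M : bad M -> first_violation same b (ent (h M)) (pk M).1 (pk M).2.
  move=> bM; rewrite hE //; apply: first_violation_toggle (pkP _ bM) => //; exact: badC.
have hbad M : bad M -> bad (h M).
  move=> bM; apply/andP; split.
    by apply: toggle_tabmat; [case/andP: bM|exact: badT|exact: kN].
  apply/asboolPn => L; have [v _ _] := hfv _ bM.
  by have := L (pk M).1 (pk M).2; rewrite v.
have hpk M : bad M -> pk (h M) = pk M.
  move=> bM; have [] := first_violation_uniq (pkP _ (hbad _ bM)) (hfv _ bM).
  by case: (pk (h M)) (pk M) => [? ?] [? ?] /= -> ->.
have hK M : bad M -> h (h M) = M.
  move=> bM; rewrite {1}/h hpk // hE // (excess_toggle bS (badC _ bM) (pkP _ bM)).
  rewrite -[RHS]mkmatK; congr mkmat.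
  by apply/funext => q; apply/funext => e; rewrite toggleK //; exact: badT.
rewrite {1}/S -sumrN (reindex_onto h h) => [|M bM]; last exact: hK.
apply: eq_big => [M|M /andP[bM /eqP hh]].
  rewrite -/(bad _) -/(bad _); apply/andP/idP => [[bM /eqP <-]|bM]; first exact: hbad.
  by rewrite hbad // hK.
have {}bM : bad M by rewrite -hh; apply: hbad.
have kN' := kN _ bM.
have k0N : (pk M).2 < N by exact: ltnW.
have sk : same (pk M).2 by case: (pkP _ bM) => /andP[].
rewrite -(fA (i := Ordinal k0N) (j := Ordinal kN')) //; congr f.
have tM : tab M by case/andP: bM.
apply: (col_swap (vecof N b)) => //.
- by move=> q e ni nj; rewrite hE // toggle_other //; exact: badT.
- rewrite !ffunE /= hE //.
  exact: (col_toggle_k bS (badC _ bM) (tabmat_supp tM) (pkP _ bM)).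
- rewrite !ffunE /= hE //.
  exact: (col_toggle_k1 bS (badC _ bM) (tabmat_supp tM) (pkP _ bM)).
Qed.

End Cancel.

End TabSums.

(** * Semistandard tableaux as matrices *)

Lemma part_anti lam i j : is_part lam -> i <= j -> part lam j <= part lam i.
Proof.
move=> /andP[s _] lij; rewrite /part.
have [lj|] := ltnP j (size lam); last by move=> ?; rewrite nth_default.
have tr : transitive geq by move=> a b c; rewrite /geq; lia.
have re : reflexive geq by move=> a; rewrite /geq /=.
exact: (sorted_leq_nth tr re 0 s i j (leq_ltn_trans lij lj) lj lij).
Qed.

Lemma part_out lam i : size lam <= i -> part lam i = 0.
Proof. exact: nth_default. Qed.

Lemma part_gt0 lam i : is_part lam -> i < size lam -> 0 < part lam i.
Proof.
move=> /andP[_ n0] li; rewrite lt0n; apply: contraNN n0 => /eqP <-.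
exact: mem_nth.
Qed.

Lemma part_inj lam mu : is_part lam -> is_part mu -> part lam =1 part mu -> lam = mu.
Proof.
move=> lP mP e; have sz : size lam = size mu.
  case: (ltngtP (size lam) (size mu)) => // lt.
    by have := part_gt0 mP lt; rewrite -e part_out.
  by have := part_gt0 lP lt; rewrite e part_out.
by apply: (eq_from_nth (x0 := 0) sz) => i _; apply: e.
Qed.

Lemma part_includedP mu lam : part_included mu lam -> forall i, part mu i <= part lam i.
Proof.
move=> /forallP h i; have [li|] := ltnP i (size mu); last by move/part_out->.
exact: (h (Ordinal li)).
Qed.

Lemma part_includedI mu lam : (forall i, part mu i <= part lam i) -> part_included mu lam.
Proof. by move=> h; apply/forallP => i. Qed.

Lemma part_size_le mu lam : is_part mu -> (forall i, part mu i <= part lam i) ->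
  size mu <= size lam.
Proof.
move=> mP h; rewrite leqNgt; apply/negP => lt.
by have := part_gt0 mP lt; have := h (size lam); rewrite (part_out (leqnn _)); lia.
Qed.

Lemma part_sum lam n : size lam <= n -> sumn lam = \sum_(i < n) part lam i.
Proof.
move=> le; rewrite (sum_ord_split (part lam) le) sumnE (big_nth 0) big_mkord.
rewrite [X in _ = _ + X]big1_seq ?addn0 // => i; rewrite mem_index_iota => /andP[_ /andP[? _]].
exact: part_out.
Qed.

Definition row_word (g : nat -> nat) n : seq nat :=
  flatten [seq nseq (g e) e | e <- iota 0 n].

Lemma row_wordS g n : row_word g n.+1 = row_word g n ++ nseq (g n) n.
Proof. by rewrite /row_word -addn1 iotaD map_cat flatten_cat /= cats0. Qed.

Lemma count_row_word g n k : count_mem k (row_word g n) = if k < n then g k else 0.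
Proof.
elim: n => [|n IHn]; first by [].
rewrite row_wordS count_cat IHn count_nseq /= ltnS.
have [->|nek] := eqVneq n k; first by rewrite ltnn leqnn mul1n.
by rewrite mul0n addn0; have -> : (k <= n) = (k < n) by lia.
Qed.

Lemma row_word_lt g n : all (fun e => e < n) (row_word g n).
Proof.
apply/allP => e; rewrite -has_pred1 has_count count_row_word.
by case: (ltnP e n).
Qed.

Lemma sorted_row_word g n : sorted leq (row_word g n).
Proof.
elim: n => [|n IHn] //; rewrite row_wordS.
rewrite sorted_pairwise; last exact: leq_trans.
rewrite pairwise_cat -!sorted_pairwise; try exact: leq_trans.
rewrite IHn /=; apply/andP; split.
  apply/allrelP => a b /(allP (row_word_lt g n)) /= la.
  by rewrite mem_nseq => /andP[_ /eqP->]; exact: ltnW.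
by elim: (g n) => [|[|m] IH] //=; rewrite leqnn.
Qed.

Lemma row_word_count s n : sorted leq s -> all (fun e => e < n) s ->
  s = row_word (fun k => count_mem k s) n.
Proof.
move=> ss sn; apply: (sorted_eq leq_trans anti_leq ss (sorted_row_word _ _)).
apply/allP => k; rewrite mem_cat => kin /=; rewrite count_row_word.
suff -> : k < n by [].
by case/orP: kin; [move/(allP sn) | move/(allP (row_word_lt _ _))].
Qed.

Lemma eq_row_word g g' n : (forall k, k < n -> g k = g' k) -> row_word g n = row_word g' n.
Proof.
move=> e; rewrite /row_word; congr flatten; apply/eq_in_map => k.
by rewrite mem_iota => /e ->.
Qed.

Lemma count_lt (s : seq nat) e : count (fun y => y < e) s = \sum_(k < e) count_mem (k : nat) s.
Proof.
elim: e => [|e IHe]; first by rewrite big_ord0; elim: s.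
rewrite big_ord_recr /= -IHe; elim: s {IHe} => //= y s ->.
by have [lt|gt|->] := ltngtP y e; lia.
Qed.

Lemma size_count s n : all (fun e => e < n) s -> size s = \sum_(k < n) count_mem (k : nat) s.
Proof. by move=> a; rewrite -count_lt; apply/esym/eqP; rewrite -all_count. Qed.

Lemma size_row_word g n : size (row_word g n) = \sum_(k < n) g k.
Proof.
rewrite (size_count (row_word_lt g n)); apply: eq_bigr => k _.
by rewrite count_row_word ltn_ord.
Qed.

(** In a sorted list the entries below [e] form an initial segment. *)
Lemma nth_sorted_lt s i e : sorted leq s -> i < size s ->
  (nth 0 s i < e) = (i < count (fun y => y < e) s).
Proof.
elim: s i => //= y s IH i ss; have sst := path_sorted ss.
have ya : all (leq y) s by rewrite order_path_min //; exact: leq_trans.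
have c0 : e <= y -> count (fun z => z < e) s = 0.
  move=> le; apply/eqP; rewrite -leqn0 leqNgt -has_count; apply/hasPn => z /(allP ya).
  by rewrite -leqNgt; apply: leq_trans.
case: i => [|i] /=.
  by move=> _; case: (ltnP y e) => // /c0 ->.
rewrite ltnS => li; rewrite (IH i) //.
by case: (ltnP y e) => // /c0 ->.
Qed.

Definition cnt (t : seq (seq nat)) p k := count_mem k (nth [::] t p).

Lemma prow_cnt mu t e p :
  prow mu (cnt t) e p = mu p + count (fun y => y < e) (nth [::] t p).
Proof. by rewrite count_lt. Qed.

(** The cells of row [q] with entries below [e] are those left of column [prow e q], so comparing
    adjacent rows column by column amounts to comparing the lengths [prow]. *)
Lemma ssytP lam mu t : is_part lam -> is_part mu -> part_included mu lam ->
  ssyt lam mu t <-> [/\ size t = size lam, forall p, sorted leq (nth [::] t p),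
    forall p, size (nth [::] t p) = part lam p - part mu p & colstrict (part mu) (cnt t)].
Proof.
move=> lP mP /part_includedP inc.
have lemma p : size t = size lam -> (forall p, size (nth [::] t p) = part lam p - part mu p) ->
   (forall p, sorted leq (nth [::] t p)) -> p < size lam ->
   (forall e, prow (part mu) (cnt t) e.+1 p.+1 <= prow (part mu) (cnt t) e p) <->
   [forall c : 'I_(head 0%N lam),
         in_skew lam mu (p, c : nat) &&
         in_skew lam mu (p.+1, c : nat) ==>
         (tab_entry mu t (p, c : nat) <
          tab_entry mu t (p.+1, c : nat))%N].
  move=> szt szr srt plt.
  have entry q c e : in_skew lam mu (q, c) ->
      (tab_entry mu t (q, c) < e) = (c < prow (part mu) (cnt t) e q).
    move=> /andP[/= h1 h2]; rewrite /tab_entry /= prow_cnt nth_sorted_lt //; last by rewrite szr; lia.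
    by set n := count _ _; lia.
  split=> [h|/forallP h e].
    apply/forallP => c; apply/implyP => /andP[i1 i2]; rewrite ltnNge -ltnS entry //.
    rewrite -leqNgt; set e := tab_entry mu t (p, _).
    by apply: leq_trans (h e) _; rewrite leqNgt -entry // -leqNgt.
  (* [c] is the first column of row [p] past the entries below [e]; an entry at most [e] under it,
     in row [p.+1], contradicts column strictness. *)
  rewrite leqNgt; apply/negP => lt; pose c := prow (part mu) (cnt t) e p.
  have c1 : part mu p <= c by rewrite leq_addr.
  have c2 : c < part lam p.+1.
    apply: leq_trans lt _; rewrite prow_cnt.
    have := count_size (fun y => y < e.+1) (nth [::] t p.+1).
    by have := inc p.+1; rewrite szr; lia.
  have c3 := part_anti lP (leqnSn p); have c4 := part_anti mP (leqnSn p).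
  have ch : c < head 0 lam.
    by apply: leq_trans c2 _; rewrite -nth0; exact: part_anti.
  have i1 : in_skew lam mu (p, c) by rewrite /in_skew /=; apply/andP; split; lia.
  have i2 : in_skew lam mu (p.+1, c).
    by apply/andP; split; [exact: leq_trans c4 c1 | exact: c2].
  have := entry _ _ e.+1 i2; rewrite lt ltnS => le2.
  have := entry _ _ e i1; rewrite {2}/c ltnn => /negbT; rewrite -leqNgt => le1.
  have := implyP (h (Ordinal ch)); rewrite i1 i2 => /(_ isT).
  by rewrite ltnNge (leq_trans le2 le1).
split.
  move=> /and4P[/eqP szt /forallP szr /allP srt /forallP col].
  have szr' p : size (nth [::] t p) = part lam p - part mu p.
    have [lp|lp] := ltnP p (size lam); first exact/eqP/(szr (Ordinal lp)).
    by rewrite nth_default ?szt // part_out.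
  have srt' p : sorted leq (nth [::] t p).
    have [lp|lp] := ltnP p (size t); first exact/srt/mem_nth.
    by rewrite nth_default.
  split=> // p e.
  have [lp|lp] := ltnP p (size lam).
    exact: (iffRL (lemma p szt szr' srt' lp) (col (Ordinal lp))).
  have z : part mu p.+1 = 0 by have := inc p.+1; rewrite (part_out (leqW lp)); lia.
  by rewrite prow_cnt z nth_default ?szt ?leqW.
move=> [szt srt szr col]; apply/and4P; split.
- exact/eqP.
- by apply/forallP => i; apply/eqP.
- by apply/allP => s /(nthP [::])[p _ <-].
- by apply/forallP => i; apply/(iffLR (lemma i szt szr srt (ltn_ord i))).
Qed.

Lemma cnt_mkseq (x : nat -> nat -> nat) R N :
  (forall p k, (R <= p) || (N <= k) -> x p k = 0) ->
  cnt (mkseq (fun p => row_word (x p) N) R) = x.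
Proof.
move=> x0; apply/funext => p; apply/funext => k; rewrite /cnt.
have [lp|lp] := ltnP p R.
  by rewrite nth_mkseq // count_row_word; case: (ltnP k N) => // lk; rewrite x0 ?lk ?orbT.
by rewrite nth_default ?size_mkseq // x0 ?lp.
Qed.

Definition tab_of R N B (M : mat R N B) : tableau :=
  mkseq (fun p => row_word (ent M p) N) R.

Lemma cnt_tab_of R N B (M : mat R N B) : cnt (tab_of M) = ent M.
Proof. by apply: cnt_mkseq => p k; apply: ent_out. Qed.

Lemma tab_of_inj R N B : injective (@tab_of R N B).
Proof. by move=> M M' /(congr1 cnt); rewrite !cnt_tab_of -{2}(mkmatK M) => ->; rewrite mkmatK. Qed.

Lemma sorted_tab_of R N B (M : mat R N B) p : sorted leq (nth [::] (tab_of M) p).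
Proof.
have [lp|lp] := ltnP p R; last by rewrite nth_default ?size_mkseq.
by rewrite nth_mkseq // sorted_row_word.
Qed.

Lemma size_nth_tab_of R N B (M : mat R N B) p :
  size (nth [::] (tab_of M) p) = \sum_(k < N) ent M p k.
Proof.
have [lp|lp] := ltnP p R; first by rewrite nth_mkseq // size_row_word.
by rewrite nth_default ?size_mkseq // big1 // => k _; rewrite ent_out ?lp.
Qed.

Lemma ssyt_tab_of lam mu N B (M : mat (size lam) N B) :
  is_part lam -> is_part mu -> part_included mu lam ->
  ssyt lam mu (tab_of M) = tabmat (part mu) (part lam) M.
Proof.
move=> lP mP inc; apply/idP/asboolP.
  move=> /(ssytP _ lP mP inc)[_ _ szr]; rewrite cnt_tab_of => C; split=> // p.
  by have := szr p; rewrite size_nth_tab_of /prow; have := part_includedP inc p; lia.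
move=> [C h]; apply/(ssytP _ lP mP inc); split.
- by rewrite size_mkseq.
- exact: sorted_tab_of.
- by move=> p; rewrite size_nth_tab_of -h /prow addKn.
- by rewrite cnt_tab_of.
Qed.

Lemma ssyt_mkmat lam mu N B t :
  is_part lam -> is_part mu -> part_included mu lam -> (forall p, part lam p <= B) ->
  ssyt lam mu t -> (forall p, all (fun e => e < N) (nth [::] t p)) ->
  tab_of (mkmat (size lam) N B (cnt t)) = t.
Proof.
move=> lP mP inc lB /(ssytP _ lP mP inc)[szt srt szr _] tN.
have E : ent (mkmat (size lam) N B (cnt t)) = cnt t.
  apply: entK => p k.
    apply: leq_trans (count_size _ _) _; rewrite szr; have := lB p; lia.
  case/orP=> [lp|lk]; first by rewrite /cnt nth_default ?szt.
  apply/eqP; rewrite -leqn0 leqNgt -has_count; apply/hasPn => y /(allP (tN p)) /=.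
  by move=> lt; apply/eqP; lia.
apply: (eq_from_nth (x0 := [::])); rewrite size_mkseq ?szt // => p lp.
by rewrite nth_mkseq // E [RHS](row_word_count (srt p) (tN p)).
Qed.

Lemma count_flatten_nth (s : seq (seq nat)) (a : pred nat) n : size s <= n ->
  count a (flatten s) = \sum_(p < n) count a (nth [::] s p).
Proof.
move=> le; rewrite count_flatten sumnE big_map (big_nth [::]) big_mkord.
rewrite (sum_ord_split (fun p => count a (nth [::] s p)) le).
rewrite [X in _ = _ + X]big1_seq ?addn0 // => i; rewrite mem_index_iota => /andP[_ /andP[? _]].
by rewrite nth_default.
Qed.

Lemma count_tab_word t k n : size t <= n -> count_mem k (tab_word t) = \sum_(p < n) cnt t p k.
Proof.
move=> le; rewrite /tab_word -(count_flatten_nth _ le); apply/seq.permP.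
by apply: perm_flatten; rewrite perm_rev.
Qed.

(** Converts the [fset_set] cardinalities of the definitions into cardinalities of predicates on
    matrices; finiteness of [A] is part of what the bijection provides. *)
Lemma card_fset_set_image (T : finType) (U : choiceType) (f : T -> U) (P : pred T)
    (A : set U) : {in P &, injective f} -> (forall y, A y <-> exists2 x, P x & f x = y) ->
  #|` fset_set A| = #|P|.
Proof.
move=> fI AP; pose X := [fset y in [seq f x | x <- enum P]]%fset.
have -> : A = [set` X]%classic.
  apply/seteqP; split=> y /=.
    by move=> /AP[x Px <-]; rewrite /X inE map_f // mem_enum.
  rewrite /X inE => /mapP[x]; rewrite mem_enum => Px ->; apply/AP; by exists x.
rewrite set_fsetK /X card_fseq undup_id ?size_map ?cardE //.
by rewrite map_inj_in_uniq ?enum_uniq // => x y; rewrite !mem_enum; apply: fI.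
Qed.

Lemma has_content_tab_of R N B (M : mat R N B) (m : nat -> nat) :
  (forall k, N <= k -> m k = 0) ->
  has_content (tab_word (tab_of M)) m <-> colv M = vecof N m.
Proof.
move=> mN; have E k : count_mem k (tab_word (tab_of M)) = \sum_(p < R) ent M p k.
  by rewrite (count_tab_word _ (n := R)) ?size_mkseq // cnt_tab_of.
split=> [h|/ffunP h k].
  by apply/ffunP => k; rewrite !ffunE -E.
rewrite E; have [lk|lk] := ltnP k N.
  by have := h (Ordinal lk); rewrite !ffunE.
by rewrite mN // big1 // => p _; rewrite ent_out ?lk ?orbT.
Qed.

Lemma has_content_lt N (m : nat -> nat) t p : (forall k, N <= k -> m k = 0) ->
  has_content (tab_word t) m -> all (fun e => e < N) (nth [::] t p).
Proof.
move=> mN h; have [lp|lp] := ltnP p (size t); last by rewrite nth_default.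
apply/allP => e ein; rewrite ltnNge; apply/negP => /mN; rewrite -h => /eqP.
rewrite -leqn0 leqNgt -has_count has_pred1 => /negP; apply.
by apply/flattenP; exists (nth [::] t p); rewrite // mem_rev mem_nth.
Qed.

(** A monomial in the first [N] variables forces every letter to be below [N], so matrices with [N]
    columns encode all tableaux concerned. *)
Lemma skew_schurE lam mu N B (m : {cmonom nat}) :
  is_part lam -> is_part mu -> part_included mu lam -> (forall p, part lam p <= B) ->
  (forall k, N <= k -> m k = 0) ->
  skew_schur lam mu m =
  (\sum_(M : mat (size lam) N B | tabmat (part mu) (part lam) M) (colv M == vecof N m)%:R)%R.
Proof.
move=> lP mP inc lB mN; rewrite -natr_sum -big_mkcondr /= sum1_card.
rewrite /skew_schur natz; congr Posz.
apply: card_fset_set_image => [? ? _ _|]; first exact: tab_of_inj.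
move=> t; split=> [[st ct]|[M /andP[tM /eqP cM] <-]].
  have ltN p := has_content_lt p mN ct.
  have E := ssyt_mkmat lP mP inc lB st ltN.
  exists (mkmat (size lam) N B (cnt t)) => //; apply/andP; split.
    by rewrite -ssyt_tab_of // E.
  by apply/eqP/has_content_tab_of => //; rewrite E.
by split; [rewrite ssyt_tab_of | apply/has_content_tab_of].
Qed.

(** * Alternants *)

Lemma colstrict0_lower x p k : colstrict (fun=> 0) x -> k < p -> x p k = 0.
Proof.
move=> C; elim: p k => [//|p IHp] k; rewrite ltnS => lekp.
have := C p p; rewrite /prow !add0n big_ord_recr /=.
rewrite [X in _ <= X]big1 => [|i _]; last exact: IHp.
rewrite leqn0 addn_eq0 sum_nat_eq0 => /andP[/forallP h /eqP xp].
have [->//|nk] := eqVneq k p.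
have lkp : k < p by lia.
by have := h (Ordinal lkp) => /eqP.
Qed.

(** Row [p] of a straight tableau has no letter below [p]; applied to the matrix and to its
    transpose, this leaves only the diagonal. *)
Lemma colstrict0_diag x p k : colstrict (fun=> 0) x ->
  colstrict (fun=> 0) (fun q e => x e q) -> p != k -> x p k = 0.
Proof.
move=> C C'; rewrite neq_ltn => /orP[lt|lt]; last exact: colstrict0_lower.
exact: (colstrict0_lower C' lt).
Qed.

Section Alternant.

Local Open Scope ring_scope.

Variable N : nat.
Implicit Types (F g : vec N -> int) (v m : vec N) (s t : 'S_N).

(** [F] stands for a linear functional on monomials; for the indicator of [m] this is the
    coefficient of x^m in the alternant with exponents [v]. *)
Definition alt F v : int := \sum_(s : 'S_N) (-1) ^+ s * F (vperm s v).

Lemma alt_perm F t v : alt F (vperm t v) = (-1) ^+ t * alt F v.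
Proof.
rewrite /alt mulr_sumr [RHS](reindex_inj (mulIg t)) /=; apply: eq_bigr => s _.
by rewrite vpermM odd_permM addbC signr_addb !mulrA -signr_addb addbb mul1r.
Qed.

Lemma alt_transp F v (i j : 'I_N) : i != j -> alt F (vperm (tperm i j) v) = - alt F v.
Proof. by move=> ij; rewrite alt_perm odd_tperm ij expr1 mulN1r. Qed.

Lemma vperm_add s u v : vperm s (vadd u v) = vadd (vperm s u) (vperm s v).
Proof. by apply/ffunP => k; rewrite !ffunE. Qed.

Lemma vperm_scale s r v : vperm s (vscale r v) = vscale r (vperm s v).
Proof. by apply/ffunP => k; rewrite !ffunE. Qed.

Definition vdelta : vec N := vecof N (fun k => N - k.+1)%N.

Section TabAlt.

Variables (R B : nat) (mu lam : nat -> nat).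
Hypothesis lamB : forall p, (lam p <= B)%N.
Hypothesis lamR : forall p, (R <= p)%N -> lam p = 0%N.
Local Notation tab := (@tabmat R N B mu lam).

(** By symmetry of the tableau sum, the permutation acting on [v] may act on the content as well: an
    alternant times a symmetric function is a sum of alternants. *)
Lemma tab_alt F r v :
  \sum_(M | tab M) \sum_(s : 'S_N) (-1) ^+ s * F (vadd (vperm s v) (vscale r (colv M))) =
  \sum_(M | tab M) alt F (vadd v (vscale r (colv M))).
Proof.
rewrite exchange_big /alt [RHS]exchange_big /=; apply: eq_bigr => s _.
have := tab_sym mu lamB lamR
  (fun u => (-1) ^+ s * F (vadd (vperm s v) (vscale r u))) s => /= ->.
by apply: eq_bigr => M _; rewrite vperm_add vperm_scale.
Qed.

(** The letters [k] and [k.+1] share the residue [res], so exchanging their values of [b] plus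
    content exchanges the full exponents, and the alternant changes sign. *)
Lemma tab_lattice_cancel F r (same : pred nat) (res b : nat -> nat) :
  (forall k, same k -> (k.+1 < N)%N /\ res k.+1 = res k) ->
  (forall k, same k -> (b k.+1 < b k)%N) ->
  let pos := vecof N (fun k => res k + r * b k)%N in
  \sum_(M | tab M) alt F (vadd pos (vscale r (colv M))) =
  \sum_(M | tab M && `[< lattice same b (ent M) >]) alt F (vadd pos (vscale r (colv M))).
Proof.
move=> sameN bS pos.
pose f v := alt F [ffun k : 'I_N => res k + r * v k]%N.
have fE (M : mat R N B) : alt F (vadd pos (vscale r (colv M))) = f (vadd (vecof N b) (colv M)).
  by congr (alt F _); apply/ffunP => k; rewrite !ffunE mulnDr addnA.
rewrite (eq_bigr _ (fun M _ => fE M)) [RHS](eq_bigr _ (fun M _ => fE M)).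
apply: lattice_cancel => // [k /sameN[]//|i j v ji si].
rewrite /f -(@alt_transp F _ i j); last by apply/eqP => ij; move: ji; rewrite ij; lia.
congr (alt F _); apply/ffunP => k; rewrite !ffunE.
have [_ rE] := sameN _ si.
by case: tpermP => [->|->|//]; rewrite ji rE.
Qed.

End TabAlt.

Section Straight.

Variables (R B : nat) (tau : nat -> nat).
Hypothesis tauB : forall p, (tau p <= B)%N.
Hypothesis tauR : forall p, (R <= p)%N -> tau p = 0%N.
Hypothesis tauS : forall p, (tau p.+1 <= tau p)%N.
Hypothesis RN : (R <= N)%N.
Local Notation tab := (@tabmat R N B (fun=> 0%N) tau).

(** As delta drops by one at each step, the strict inequality of [lattice] becomes the weak one of
    [colstrict] for the transpose. Both conditions together leave the tableau whose row [p] is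
    filled with [p]. *)
Lemma straight_lattice_uniq (M : mat R N B) :
  (tab M && `[< lattice (fun k => k.+1 < N)%N (fun k => N - k.+1)%N (ent M) >]) =
  (M == mkmat R N B (fun p k => if p == k then tau p else 0%N)).
Proof.
pose x p k := if p == k then tau p else 0%N.
rewrite -/x.
have entx : ent (mkmat R N B x) = x.
  apply: entK => [p k|p k]; rewrite /x; case: eqP => [->|//]; first exact: tauB.
  by move=> h; apply: tauR; lia.
have xsum e p : (\sum_(k < e) x p k = if p < e then tau p else 0)%N.
  elim: e => [|e IHe]; first by rewrite big_ord0.
  by rewrite big_ord_recr /= IHe /x ltnS; case: (ltngtP p e) => [lt|lt|->]; rewrite ?addn0.
have xsumT e p : (\sum_(k < e) x k p = if p < e then tau p else 0)%N.
  rewrite -xsum; apply: eq_bigr => k _; rewrite /x eq_sym.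
  by case: eqP => // ->.
apply/andP/eqP => [[/asboolP[C h] /asboolP L]|->].
  have C' : colstrict (fun=> 0%N) (fun q e => ent M e q).
    move=> k p; have [lt|ge] := ltnP k.+1 N.
      have := L p k; rewrite /violation lt /= -ltnNge /prow.
      have -> : (N - k.+1 = (N - k.+2).+1)%N by lia.
      by rewrite addSn ltnS leq_add2l !add0n.
    by rewrite /prow big1 // => i _; rewrite ent_out ?ge ?orbT.
  rewrite -[LHS]mkmatK; congr mkmat; apply/funext => p; apply/funext => k.
  rewrite /x; case: eqP => [<-|/eqP ne]; last exact: colstrict0_diag.
  have [ltp|lep] := ltnP p N; last by rewrite ent_out ?lep ?orbT // tauR //; lia.
  rewrite -h /prow add0n (bigD1 (Ordinal ltp)) //= big1 ?addn0 // => i ne.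
  apply: colstrict0_diag => //; apply: contraNneq ne => pi; exact/eqP/val_inj.
split; apply/asboolP; rewrite entx.
  split=> [p e|p]; rewrite /prow !add0n !xsum.
    by rewrite ltnS; case: (p < e)%N.
  by case: ltnP => // Np; rewrite tauR //; lia.
move=> p k; apply/negP => /andP[lt]; rewrite !xsumT ltnS.
by have := tauS k; case: (k < p)%N; lia.
Qed.

(** The cancellation with [r = 1], where all beads lie on a single runner. *)
Lemma straight_alt F :
  \sum_(M | tab M) \sum_(s : 'S_N) (-1) ^+ s * F (vadd (vperm s vdelta) (colv M)) =
  alt F (vadd vdelta (vecof N tau)).
Proof.
have sc1 (v : vec N) : vscale 1 v = v by apply/ffunP => k; rewrite !ffunE mul1n.
rewrite (eq_bigr (fun M : mat R N B =>
    \sum_(s : 'S_N) (-1) ^+ s * F (vadd (vperm s vdelta) (vscale 1 (colv M))))); last first.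
  by move=> M _; rewrite sc1.
rewrite tab_alt //.
have := @tab_lattice_cancel R B _ _ tauB tauR F 1 (fun k => k.+1 < N)%N (fun=> 0%N)
  (fun k => N - k.+1)%N.
rewrite (_ : vecof N _ = vdelta); last by apply/ffunP => k; rewrite !ffunE mul1n.
move=> -> //; last by move=> k; lia.
rewrite (eq_bigl _ _ straight_lattice_uniq) big_pred1_eq sc1; congr (alt F (vadd _ _)).
apply/ffunP => k; rewrite !ffunE entK.
- have [lt|ge] := ltnP k R.
    rewrite (bigD1 (Ordinal lt)) //= eqxx big1 ?addn0 // => i ne.
    by rewrite ifN //; apply: contraNneq ne => ik; apply/eqP/val_inj.
  rewrite tauR // big1 // => i _; rewrite ifN //; have := ltn_ord i; lia.
- by move=> p j; case: eqP.
- by move=> p j; case: eqP => [->|//] h; apply: tauR; lia.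
Qed.

End Straight.

(* The coefficient of x^m in a_delta g. *)
Definition conv g m : int := \sum_(s : 'S_N) (-1) ^+ s *
  (if [forall k, vperm s vdelta k <= m k]%N
   then g [ffun k => m k - vperm s vdelta k]%N else 0).

(** Rearrangement inequality: it follows from 2ac <= a^2 + c^2, which is strict at an index moved by
    [s] because the entries of delta are distinct. *)
Lemma vdelta_perm_weight s : s != 1%g ->
  (\sum_(k < N) vperm s vdelta k * vdelta k < \sum_(k < N) vdelta k * vdelta k)%N.
Proof.
move=> s1; set d := (fun k => vdelta k : nat).
have E : (\sum_(k < N) vperm s vdelta k * vperm s vdelta k =
  \sum_(k < N) vdelta k * vdelta k)%N.
  rewrite [RHS](reindex_inj (@perm_inj _ s)) /=.
  by apply: eq_bigr => k _; rewrite !ffunE.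
suff lt : (2 * (\sum_(k < N) vperm s vdelta k * vdelta k) <
    \sum_(k < N) vperm s vdelta k * vperm s vdelta k + \sum_(k < N) vdelta k * vdelta k)%N.
  by rewrite E in lt; lia.
have [k0 k0P] : exists k, s k != k.
  apply/existsP; apply: contraNT s1 => /existsPn h; apply/eqP/permP => k.
  by rewrite perm1; apply/eqP; move: (h k); rewrite negbK.
have le (a c : nat) : (2 * (a * c) <= a * a + c * c)%N.
  by have [+ _] := nat_Cauchy a c; rewrite !expnS !expn0 !muln1.
have lts (a c : nat) : a <> c -> (2 * (a * c) < a * a + c * c)%N.
  by move=> /eqP ne; have := ltn_leqif (nat_Cauchy a c); rewrite ne !expnS !expn0 !muln1.
rewrite -big_split big_distrr /= (bigD1 k0) //= [X in (_ < X)%N](bigD1 k0) //=.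
rewrite -addSn; apply: leq_add; last by apply: leq_sum => k _; exact: le.
apply: lts; rewrite !ffunE => e; case/eqP: k0P; apply: ord_inj.
by have := ltn_ord k0; have := ltn_ord (s k0); move: e; rewrite /=; lia.
Qed.

(* Since x^delta is the dominant monomial of a_delta for the weight
   m |-> sum_k m_k delta_k, the coefficients of g vanish by descending induction. *)
Lemma conv_eq0 g : (forall m, conv g m = 0) -> forall m, g m = 0.
Proof.
(* [N] times the degree bounds the weight, and the degree is the same for [m] and for [m'] below, so
   [w] decreases as the weight grows. *)
move=> g0; pose w (m : vec N) := (\sum_(k < N) m k * N - \sum_(k < N) m k * vdelta k)%N.
have wle (m : vec N) : (\sum_(k < N) m k * vdelta k <= \sum_(k < N) m k * N)%N.
  by apply: leq_sum => k _; rewrite leq_mul2l ffunE leq_subr orbT.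
have H n m : (w m < n)%N -> g m = 0.
  elim: n m => [//|n IHn] m wm.
  have := g0 (vadd m vdelta); rewrite /conv (bigD1 1%g) //= odd_perm1 expr0 mul1r.
  rewrite ifT; last by apply/forallP => k; rewrite !ffunE perm1 leq_addl.
  rewrite big1 ?addr0 => [|s s1].
    by move=> <-; congr g; apply/ffunP => k; rewrite !ffunE perm1 addnK.
  case: ifP => [/forallP h|_]; last by rewrite mulr0.
  rewrite IHn ?mulr0 //.
  pose m' : vec N := [ffun k => vadd m vdelta k - vperm s vdelta k]%N.
  rewrite -/m'.
  have m'E k : (m' k + vperm s vdelta k = m k + vdelta k)%N.
    by rewrite /m' ffunE subnK ?h // ffunE.
  have E1 : (\sum_(k < N) m' k * vdelta k + \sum_(k < N) vperm s vdelta k * vdelta k =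
       \sum_(k < N) m k * vdelta k + \sum_(k < N) vdelta k * vdelta k)%N.
    by rewrite -!big_split; apply: eq_bigr => k _; rewrite /= -!mulnDl m'E.
  have E2 : (\sum_(k < N) m' k * N + \sum_(k < N) vperm s vdelta k * N =
       \sum_(k < N) m k * N + \sum_(k < N) vdelta k * N)%N.
    by rewrite -!big_split; apply: eq_bigr => k _; rewrite /= -!mulnDl m'E.
  have E3 : (\sum_(k < N) vperm s vdelta k * N = \sum_(k < N) vdelta k * N)%N.
    rewrite [RHS](reindex_inj (@perm_inj _ s)) /=.
    by apply: eq_bigr => k _; rewrite !ffunE.
  move: (vdelta_perm_weight s1) (wle m) (wle m') wm; rewrite /w.
  by move: E1 E2 E3; clearbody m'; lia.
by move=> m; apply: (H (w m).+1).
Qed.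

Lemma conv_inj g g' : (forall m, conv g m = conv g' m) -> g =1 g'.
Proof.
move=> h m; apply/eqP; rewrite -subr_eq0; apply/eqP.
apply: (@conv_eq0 (fun m => g m - g' m)) => {}m.
rewrite -[RHS](subrr (conv g' m)) -{1}h /conv -sumrB; apply: eq_bigr => s _.
by rewrite -mulrBr; case: ifP; rewrite ?subrr.
Qed.

Lemma conv_sum (I : Type) (l : seq I) (P : pred I) (g : I -> vec N -> int) (c : I -> int) m :
  conv (fun m => \sum_(i <- l | P i) g i m * c i) m = \sum_(i <- l | P i) conv (g i) m * c i.
Proof.
rewrite /conv; under [RHS]eq_bigr do rewrite mulr_suml.
rewrite exchange_big /=; apply: eq_bigr => s _.
case: ifP => _; last by rewrite mulr0 big1 // => i _; rewrite mul0r.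
by rewrite mulr_sumr; apply: eq_bigr => i _; rewrite mulrA.
Qed.

Lemma conv_indic v m : conv (fun u => (v == u)%:R) m =
  \sum_(s : 'S_N) (-1) ^+ s * (vadd (vperm s vdelta) v == m)%:R.
Proof.
apply: eq_bigr => s _; congr (_ * _); case: ifP => [/forallP h|/negbT/forallPn[k nk]].
  congr ((nat_of_bool _)%:R); apply/eqP/eqP => [->|<-].
    by apply/ffunP => k; rewrite ffunE [X in (_ + X)%N]ffunE subnKC.
  by apply/ffunP => k; rewrite ffunE [X in (X - _)%N]ffunE addKn.
by case: eqP => // E; case/negP: nk; rewrite -E [X in (_ <= X)%N]ffunE leq_addr.
Qed.

End Alternant.

(** * Littlewood-Richardson coefficients as numbers of matrices *)

(** [a] is the content already read to the right of [w]; it allows a word to be processed piece by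
    piece from its right end. *)
Definition lat (a : nat -> nat) (w : seq nat) : Prop :=
  forall i k, a k.+1 + count_mem k.+1 (drop i w) <= a k + count_mem k (drop i w).

Lemma latticedP w : latticed w <-> lat (fun=> 0) w.
Proof.
split=> [h i k|h k v]; first exact/h/suffix_drop.
by rewrite suffixE => /eqP <-; apply: h.
Qed.

Lemma lat_cat a u w :
  lat a (u ++ w) <-> lat a w /\ lat (fun k => a k + count_mem k w) u.
Proof.
split=> [h|[hw hu] i k].
  split=> i k.
    by have := h (size u + i) k; rewrite drop_cat ltnNge leq_addr /= addKn.
  have [lt|ge] := ltnP i (size u).
    by have := h i k; rewrite drop_cat lt !count_cat; lia.
  rewrite drop_oversize //= !addn0.
  by have := h (size u) k; rewrite drop_cat ltnn subnn drop0.
rewrite drop_cat; case: ltnP => _; last exact: hw.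
by have := hu i k; rewrite !count_cat; lia.
Qed.

(** Read from the right, a weakly increasing row shows all its [k.+1] before its first [k]; the
    condition is tightest between the two. *)
Lemma lat_row a w : sorted leq w -> (forall k, a k.+1 <= a k) ->
  lat a w <-> forall k, a k.+1 + count_mem k.+1 w <= a k.
Proof.
move=> sw aS; split=> [h k|h i k]; last first.
  have := h k; rewrite -{1}(cat_take_drop i w) count_cat; lia.
have E : forall (b : nat -> nat) s, sorted leq s -> lat b s -> (forall j, b j.+1 <= b j) ->
   b k.+1 + count_mem k.+1 s <= b k.
  move=> b; elim=> [|y s IH] ss hs bS /=; first by have := bS k; lia.
  have hs' : lat b s by move=> i j; have := hs i.+1 j.
  have := IH (path_sorted ss) hs' bS.
  have ya : all (leq y) s by rewrite order_path_min //; exact: leq_trans.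
  have [ek|ne] := eqVneq y k.+1; last by rewrite add0n.
  have c0 : count_mem k s = 0.
    apply/eqP; rewrite -leqn0 leqNgt -has_count; apply/hasPn => z /(allP ya) /=.
    by rewrite ek; move=> lt; apply/eqP; lia.
  have := hs 0 k; rewrite drop0 /= c0 ek eqxx; lia.
exact: E.
Qed.

(* W lists the rows in the order in which lat reads them; reading a weakly
   increasing row from the right adds a horizontal strip to the content. *)
Lemma lat_rows a W : (forall s, s \in W -> sorted leq s) -> (forall k, a k.+1 <= a k) ->
  lat a (flatten (rev W)) <-> colstrict a (fun k p => cnt W p k).
Proof.
elim: W a => [|w W IH] a sW aS.
  split=> [_ k p|_ i k]; last by rewrite /= !addn0.
  by rewrite /prow !big1 ?addn0 => // [i _|i _]; rewrite /cnt nth_nil.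
have sw : sorted leq w by apply: sW; rewrite inE eqxx.
have sW' s : s \in W -> sorted leq s by move=> sW'; apply: sW; rewrite inE sW' orbT.
have cS : colstrict a (fun k p => cnt (w :: W) p k) <->
    (forall k, a k.+1 + count_mem k.+1 w <= a k) /\
    colstrict (fun k => a k + count_mem k w) (fun k p => cnt W p k).
  have E k p : prow a (fun k p => cnt (w :: W) p k) p.+1 k =
      prow (fun k => a k + count_mem k w) (fun k p => cnt W p k) p k.
    by rewrite /prow big_ord_recl addnA.
  split=> [h|[h1 h2] k [|p]].
  - split=> [k|k p]; last by rewrite -!E; apply: h.
    by have := h k 0; rewrite prowS !prow0.
  - by rewrite prowS !prow0; apply: h1.
  - by rewrite !E.
rewrite rev_cons flatten_rcons lat_cat cS (lat_row sw aS).
split=> -[h1 h2]; split=> //.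
  by apply/(IH _ sW') => // k; have := h1 k; lia.
by apply/(IH _ sW') => // k; have := h1 k; lia.
Qed.

Definition std_tab mu : tableau := mkseq (fun p => nseq (part mu p) p) (size mu).

Lemma cnt_std_tab mu p k : cnt (std_tab mu) p k = if p == k then part mu p else 0.
Proof.
rewrite /cnt; have [lt|ge] := ltnP p (size mu); last first.
  by rewrite nth_default ?size_mkseq //= part_out //; case: eqP.
by rewrite nth_mkseq // count_nseq /=; case: eqP; rewrite ?mul1n.
Qed.

Lemma count_std_tab mu k : count_mem k (tab_word (std_tab mu)) = part mu k.
Proof.
rewrite (count_tab_word _ (n := (maxn (size mu) k.+1))) ?size_mkseq ?leq_maxl //.
have lt : k < maxn (size mu) k.+1 by rewrite leq_max leqnn orbT.
rewrite (bigD1 (Ordinal lt)) //= cnt_std_tab eqxx big1 ?addn0 // => i ne.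
by rewrite cnt_std_tab ifN //; apply: contraNneq ne => e; apply/eqP/val_inj.
Qed.

Lemma part_nil i : part [::] i = 0. Proof. exact: nth_nil. Qed.

Lemma included_nil mu : part_included [::] mu.
Proof. by apply: part_includedI => i; rewrite part_nil. Qed.

Lemma sumif_const (c : nat -> nat) (p e : nat) :
  \sum_(k < e) (if p == k :> nat then c p else 0) = if p < e then c p else 0.
Proof.
elim: e => [|e IHe]; first by rewrite big_ord0.
by rewrite big_ord_recr /= IHe ltnS; case: (ltngtP p e) => [lt|lt|->]; rewrite ?addn0.
Qed.

(** Semistandardness makes the matrix of multiplicities upper triangular, and the lattice condition
    does the same for its transpose. As last component of a multipartition, such a tableau is read
    first and only supplies the initial content [mu]. *)
Lemma straight_latticed mu t : is_part mu ->
  ssyt mu [::] t /\ lat (fun=> 0) (tab_word t) <-> t = std_tab mu.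
Proof.
move=> mP; have nP : is_part [::] by [].
have p0 : part [::] = fun=> 0 by apply/funext => i; rewrite part_nil.
split=> [[st lt]|->].
  have [szt srt szr C] := iffLR (ssytP _ mP nP (included_nil mu)) st.
  have C' : colstrict (fun=> 0) (fun k p => cnt t p k).
    by apply/lat_rows => // s /(nthP [::])[p _ <-].
  rewrite p0 in C.
  have D p k : p != k -> cnt t p k = 0 by exact: colstrict0_diag.
  apply: (eq_from_nth (x0 := [::])); rewrite ?size_mkseq // szt => p lp.
  rewrite nth_mkseq //; have := szr p; rewrite part_nil subn0 => <-; apply/all_pred1P.
  apply/allP => y yin; apply/eqP; apply: contraTeq yin => ne.
  by rewrite -has_pred1 has_count -leqNgt leqn0; apply/eqP/D; rewrite eq_sym.
have srt p : sorted leq (nth [::] (std_tab mu) p).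
  have [lp|lp] := ltnP p (size mu); last by rewrite nth_default ?size_mkseq.
  by rewrite nth_mkseq //; elim: (part mu p) => [|[|m] IH] //=; rewrite leqnn.
have S p e : \sum_(k < e) cnt (std_tab mu) p k = if p < e then part mu p else 0.
  by rewrite -(sumif_const (part mu)); apply: eq_bigr => k _; rewrite cnt_std_tab.
have S' p e : \sum_(k < e) cnt (std_tab mu) k p = if p < e then part mu p else 0.
  rewrite -(sumif_const (part mu)); apply: eq_bigr => k _; rewrite cnt_std_tab eq_sym.
  by case: eqP => // ->.
have aS := part_anti mP (leqnSn _).
split.
  apply/ssytP => //; first exact: included_nil.
  split=> [||p|p e]; rewrite ?size_mkseq //.
    rewrite part_nil subn0; have [lp|lp] := ltnP p (size mu).
      by rewrite nth_mkseq // size_nseq.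
    by rewrite nth_default ?size_mkseq // part_out.
  by rewrite /prow !part_nil !add0n !S ltnS; case: (p < e).
apply/lat_rows => // [s /(nthP [::])[p _ <-]//|k p].
by rewrite /prow !add0n !S' ltnS; case: (k < p).
Qed.

(** * The listing of the beads and the rows attached to them *)

Section BeadIndex.

Variables (r : nat) (c : nat -> nat).

(* Beads are listed in the order in which the word of a tuple of tableaux,
   read from right to left, visits the rows: last runner first, and on each
   runner from the largest bead down. *)
Definition beads : seq (nat * nat) :=
  flatten [seq [seq (j, i) | i <- iota 0 (c j)] | j <- rev (iota 0 r)].

Definition bead k := nth (0, 0) beads k.

Lemma mem_beads j i : ((j, i) \in beads) = (j < r) && (i < c j).
Proof.
apply/flatten_mapP/andP => [[j']|[lj li]].
  rewrite mem_rev mem_iota => /andP[_ lj] /mapP[i']; rewrite mem_iota.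
  by move=> /andP[_ li] [-> ->].
by exists j; rewrite ?mem_rev ?mem_iota //; apply: map_f; rewrite mem_iota.
Qed.

Lemma beads_block j : j < r ->
  exists o, forall i, i < c j -> o + i < size beads /\ bead (o + i) = (j, i).
Proof.
move=> lj; have : j \in rev (iota 0 r) by rewrite mem_rev mem_iota.
rewrite /bead /beads => /splitPr[s1 s2].
rewrite map_cat flatten_cat /=; set A := flatten _; set B := flatten _.
exists (size A) => i li.
split; first by rewrite !size_cat size_map size_iota; lia.
rewrite nth_cat ltnNge leq_addr addKn nth_cat size_map size_iota li /=.
by rewrite (nth_map 0) ?size_iota // nth_iota.
Qed.

Lemma beads_uniq : uniq beads.
Proof.
have : uniq (rev (iota 0 r)) by rewrite rev_uniq iota_uniq.
rewrite /beads; elim: (rev _) => //= j s IH /andP[js us].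
rewrite cat_uniq IH // andbT map_inj_uniq ?iota_uniq /=; last by move=> ? ? [].
apply/hasPn => -[j' i] /flatten_mapP[j'' j''s /mapP[i' _ [-> _]]].
by apply/negP => /mapP[i'' _ [e _]]; move: js; rewrite -e j''s.
Qed.

(** The last bead of one runner and the first of the next are not compared, just as tableaux in
    different components share no columns. *)
Definition same_runner k :=
  (k.+1 < size beads) && (bead k.+1 == ((bead k).1, (bead k).2.+1)).

Lemma beadP k : k < size beads -> (bead k).1 < r /\ (bead k).2 < c (bead k).1.
Proof.
move=> lk; have := mem_nth (0, 0) lk; rewrite -/(bead k).
by case: (bead k) => j i; rewrite mem_beads => /andP[].
Qed.

Lemma index_bead k : k < size beads -> index (bead k) beads = k.
Proof. by move=> lk; rewrite index_uniq // beads_uniq. Qed.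

Lemma bead_index j i : j < r -> i < c j ->
  index (j, i) beads < size beads /\ bead (index (j, i) beads) = (j, i).
Proof. by move=> lj li; rewrite index_mem /bead nth_index mem_beads lj. Qed.

Lemma index_beadS j i : j < r -> i.+1 < c j ->
  index (j, i.+1) beads = (index (j, i) beads).+1.
Proof.
move=> lj li; have [o ho] := beads_block lj.
have [l1 e1] := ho _ li; have [l2 e2] := ho _ (ltnW li).
by rewrite -e1 -e2 !index_bead // addnS.
Qed.

Lemma same_runner_index j i : j < r -> i.+1 < c j ->
  same_runner (index (j, i) beads).
Proof.
move=> lj li; rewrite /same_runner -index_beadS //.
have [-> ->] := bead_index lj li; have [_ ->] := bead_index lj (ltnW li).
by rewrite eqxx.
Qed.

Lemma big_beads (F : nat * nat -> nat) :
  \sum_(k < size beads) F (bead k) = \sum_(j < r) \sum_(i < c j) F (j : nat, i : nat).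
Proof.
rewrite -(big_mkord xpredT (F \o bead)) -(big_nth (0, 0) xpredT F) /beads.
rewrite big_flatten big_map -(big_mkord xpredT (fun j => \sum_(i < c j) F (j, i : nat))).
rewrite (perm_big (iota 0 r)) ?perm_rev //= /index_iota subn0.
by apply: eq_bigr => j _; rewrite big_map -(big_mkord xpredT (fun i => F (j, i))) /index_iota subn0.
Qed.

(** A tableau with fewer rows than its runner has beads is padded with empty rows, which leave the
    word unchanged. *)
Definition rows_of (ts : seq tableau) : seq (seq nat) :=
  [seq nth [::] (nth [::] ts ji.1) ji.2 | ji <- beads].

Lemma rows_of_word (ts : seq tableau) : size ts = r ->
  (forall j, j < r -> size (nth [::] ts j) <= c j) ->
  tabs_word ts = flatten (rev (rows_of ts)).
Proof.
move=> sz le; rewrite /tabs_word /rows_of /beads map_flatten rev_flatten -!map_comp.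
rewrite map_rev revK -{1}[ts](mkseq_nth [::]) sz /mkseq -map_comp.
have : {in iota 0 r, forall j, size (nth [::] ts j) <= c j}.
  by move=> j; rewrite mem_iota => /andP[_ /le].
elim: (iota 0 r) => //= j s IH h.
rewrite flatten_cat -IH => [|j' j's]; last by apply: h; rewrite inE j's orbT.
congr (_ ++ _); rewrite -map_comp /tab_word.
rewrite (@eq_map _ _ _ (fun i => nth [::] (nth [::] ts j) i)) //.
have : size (nth [::] ts j) <= c j by apply: h; rewrite inE eqxx.
move: (nth [::] ts j) => t let_.
have -> : [seq nth [::] t i | i <- iota 0 (c j)] = t ++ nseq (c j - size t) [::].
  apply: (eq_from_nth (x0 := [::])); first by rewrite size_map size_iota size_cat size_nseq subnKC.
  move=> i; rewrite size_map size_iota => li; rewrite (nth_map 0) ?size_iota // nth_iota // add0n.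
  rewrite nth_cat; case: ltnP => // ge; rewrite nth_default // nth_nseq.
  by case: ifP.
rewrite rev_cat flatten_cat.
suff -> : flatten (rev (nseq (c j - size t) ([::] : seq nat))) = [::] by [].
by elim: (_ - _) => // m IHm; rewrite /= rev_cons flatten_rcons IHm.
Qed.

End BeadIndex.

Section RunnerLattice.

Variables (r : nat) (c : nat -> nat).
Local Notation bead := (bead r c).

Definition bead_part (shp : seq (seq nat)) (k : nat) : nat :=
  part (nth [::] shp (bead k).1) (bead k).2.

Definition bead_pos (shp : seq (seq nat)) (k : nat) : nat :=
  bead_part shp k + (c (bead k).1 - (bead k).2.+1).

Lemma same_runnerP k : same_runner r c k ->
  [/\ (bead k).1 < r, (bead k).2.+1 < c (bead k).1
    & bead k.+1 = ((bead k).1, (bead k).2.+1)].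
Proof.
move=> /andP[lk /eqP e]; have := beadP lk; rewrite e /= => -[h1 h2].
by split.
Qed.

Lemma bead_posS shp k : same_runner r c k ->
  bead_pos shp k = (bead_part shp k + (c (bead k).1 - (bead k).2.+2)).+1.
Proof. by move=> /same_runnerP[_ h _]; rewrite /bead_pos; lia. Qed.

(** The staircase term of [bead_pos] drops by one between consecutive beads of a runner. This
    absorbs the strictness of [lattice] and leaves column strictness over the inner shapes [shp]. *)
Lemma same_latticeE shp x : lattice (same_runner r c) (bead_pos shp) x <->
  forall k p, same_runner r c k ->
  bead_part shp k.+1 + \sum_(q < p.+1) x q k.+1 <= bead_part shp k + \sum_(q < p) x q k.
Proof.
have E k : same_runner r c k -> bead_pos shp k.+1 =
    bead_part shp k.+1 + (c (bead k).1 - (bead k).2.+2).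
  by move=> /same_runnerP[_ _ e]; rewrite /bead_pos e.
split=> [h k p s|h p k]; rewrite ?/violation.
  have := h p k; rewrite /violation s /= -ltnNge (bead_posS _ s) (E _ s).
  by lia.
apply/negP => /andP[s]; have := h k p s; rewrite (bead_posS _ s) (E _ s); lia.
Qed.

End RunnerLattice.

(** * Transposition of matrices into tuples of tableaux *)

Section LRCoef.

Variables (r B : nat) (c : nat -> nat) (nu quo : r.-tuple (seq nat)) (lam mu : seq nat).
Hypotheses (lamP : is_part lam) (muP : is_part mu) (inc : part_included mu lam).
Hypothesis lamB : forall p, part lam p <= B.
Hypothesis nuP : forall j : 'I_r, is_part (tnth nu j).
Hypothesis quoP : forall j : 'I_r, is_part (tnth quo j).
Hypothesis nu_inc : forall j : 'I_r, part_included (tnth quo j) (tnth nu j).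
Hypothesis nu_size : forall j : 'I_r, size (tnth nu j) <= c j.

Local Notation N := (size (beads r c)).
Local Notation bead := (bead r c).
Local Notation rows_of := (rows_of r c).
Local Notation bead_part := (bead_part r c).
Local Notation bead_pos := (bead_pos r c).

(** The columns of [M] encode the rows of tableaux of shapes nu(j) / quo(j): the second condition is
    their column strictness, the third fixes their row lengths. The first condition makes the rows
    of [M] a tableau of shape [lam / mu]. *)
Definition lr_mat (M : mat (size lam) N B) : bool :=
  [&& tabmat (part mu) (part lam) M,
      `[< lattice (same_runner r c) (bead_pos quo) (ent M) >]
    & vadd (vecof N (bead_part quo)) (colv M) == vecof N (bead_part nu)].

Let nthP (t : r.-tuple (seq nat)) j (lj : j < r) : nth [::] t j = tnth t (Ordinal lj).
Proof. by rewrite (tnth_nth [::]). Qed.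

Lemma size_rows_of ts : size (rows_of ts) = N. Proof. by rewrite size_map. Qed.

Lemma nth_rows_of ts k : k < N ->
  nth [::] (rows_of ts) k = nth [::] (nth [::] ts (bead k).1) (bead k).2.
Proof. by move=> lk; rewrite (nth_map (0, 0)). Qed.

Lemma cnt_rows_of ts j i p : j < r -> i < c j ->
  cnt (rows_of ts) (index (j, i) (beads r c)) p = cnt (nth [::] ts j) i p.
Proof.
by move=> lj li; have [l e] := bead_index lj li; rewrite /cnt nth_rows_of // e.
Qed.

Lemma rows_of_rcons ts t : size ts = r -> rows_of (rcons ts t) = rows_of ts.
Proof.
move=> sz; apply/eq_in_map => -[j i]; rewrite mem_beads => /andP[lj _] /=.
by rewrite nth_rcons sz lj.
Qed.

(** The last component is read first and must be [std_tab mu]. The remaining word starts from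
    content [mu], which thereby becomes the base of the transposed column strictness. *)
Lemma lr_tableauxP (ts : seq tableau) :
  [/\ all2 (fun sh t => ssyt sh.1 sh.2 t) (rcons (zip nu quo) (mu, [::])) ts,
      has_content (tabs_word ts) (part lam) & latticed (tabs_word ts)] <->
  [/\ size ts = r.+1, nth [::] ts r = std_tab mu,
      forall j : 'I_r, ssyt (tnth nu j) (tnth quo j) (nth [::] ts j),
      forall p, part mu p + \sum_(k < N) cnt (rows_of ts) k p = part lam p
    & colstrict (part mu) (fun p k => cnt (rows_of ts) k p)].
Proof.
case/lastP: ts => [|ts t]; first by split; [case; case: (zip _ _) | case].
have allE : all2 (fun sh t => ssyt sh.1 sh.2 t) (rcons (zip nu quo) (mu, [::])) (rcons ts t) =
   [&& size ts == r, ssyt mu [::] t &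
     all2 (fun sh t => ssyt sh.1 sh.2 t) (zip nu quo) ts].
  rewrite !all2E !size_rcons eqSS size_zip !size_tuple minnn eq_sym.
  have [sz|] //= := eqVneq (size ts) r.
  by rewrite zip_rcons ?all_rcons // size_zip !size_tuple minnn.
have all2j : size ts = r -> all2 (fun sh t => ssyt sh.1 sh.2 t) (zip nu quo) ts <->
   forall j : 'I_r, ssyt (tnth nu j) (tnth quo j) (nth [::] ts j).
  move=> sz; rewrite all2E size_zip !size_tuple minnn sz eqxx /=.
  have szz : size (zip (zip nu quo) ts) = r by rewrite !size_zip !size_tuple sz !minnn.
  have nthz j : j < r -> nth ([::], [::], [::]) (zip (zip nu quo) ts) j =
     (nth [::] nu j, nth [::] quo j, nth [::] ts j).
    by move=> lj; rewrite !nth_zip ?size_zip ?size_tuple ?minnn ?sz.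
  split=> [/(all_nthP ([::], [::], [::])) h j|h].
    have := h j; rewrite szz => /(_ (ltn_ord j)); rewrite nthz //=.
    by rewrite !(tnth_nth [::]).
  apply/(all_nthP ([::], [::], [::])) => j; rewrite szz => lj; rewrite nthz //=.
  by have := h (Ordinal lj); rewrite !(tnth_nth [::]).
have szle : size ts = r -> (forall j : 'I_r, ssyt (tnth nu j) (tnth quo j) (nth [::] ts j)) ->
   forall j, j < r -> size (nth [::] ts j) <= c j.
  move=> sz h j lj; have := h (Ordinal lj) => /(ssytP _ (nuP _) (quoP _) (nu_inc _))[-> _ _ _].
  exact: nu_size (Ordinal lj).
have wordE : tabs_word (rcons ts t) = tabs_word ts ++ tab_word t.
  by rewrite /tabs_word map_rcons flatten_rcons.
have srt : size ts = r -> (forall j : 'I_r, ssyt (tnth nu j) (tnth quo j) (nth [::] ts j)) ->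
   forall s, s \in rows_of ts -> sorted leq s.
  move=> sz h s /mapP[[j i]]; rewrite mem_beads => /andP[lj li] -> /=.
  by have := h (Ordinal lj) => /(ssytP _ (nuP _) (quoP _) (nu_inc _))[].
have wE : size ts = r -> (forall j : 'I_r, ssyt (tnth nu j) (tnth quo j) (nth [::] ts j)) ->
   tabs_word ts = flatten (rev (rows_of ts)).
  by move=> sz h; apply: rows_of_word => //; apply: szle.
have cE : size ts = r -> (forall j : 'I_r, ssyt (tnth nu j) (tnth quo j) (nth [::] ts j)) ->
   forall p, count_mem p (tabs_word ts) = \sum_(k < N) cnt (rows_of ts) k p.
  move=> sz h p; rewrite wE // -(count_flatten_nth _ (n := N)) ?size_rows_of //.
  by apply/seq.permP/perm_flatten; rewrite perm_rev.
have aS := part_anti muP (leqnSn _).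
have latE : size ts = r -> (forall j : 'I_r, ssyt (tnth nu j) (tnth quo j) (nth [::] ts j)) ->
    lat (part mu) (tabs_word ts) <-> colstrict (part mu) (fun p k => cnt (rows_of ts) k p).
  by move=> sz h; rewrite (wE sz h); apply: lat_rows => //; apply: srt.
rewrite allE wordE; split.
  move=> [/and3P[/eqP sz st /(all2j sz) h] hc].
  move=> /latticedP /lat_cat [l1 l2].
  have E := iffLR (straight_latticed _ muP) (conj st l1); subst t.
  have cm k : count_mem k (tab_word (std_tab mu)) = part mu k by rewrite count_std_tab.
  rewrite size_rcons sz nth_rcons sz ltnn eqxx rows_of_rcons //; split=> //.
  - by move=> j; rewrite nth_rcons sz ltn_ord.
  - by move=> p; rewrite -hc count_cat cm addnC cE.
  - apply/(latE sz h) => // i k.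
    by have := l2 i k; rewrite !cm.
rewrite size_rcons => -[[sz]]; rewrite nth_rcons sz ltnn eqxx rows_of_rcons // => -> h hc C.
have {}h (j : 'I_r) : ssyt (tnth nu j) (tnth quo j) (nth [::] ts j).
  by have := h j; rewrite nth_rcons sz ltn_ord.
have [st lt] := iffRL (straight_latticed _ muP) (erefl (std_tab mu)).
split.
- by rewrite st; apply/all2j.
- by move=> p; rewrite count_cat count_std_tab addnC cE.
apply/latticedP/lat_cat; split=> // i k; rewrite !count_std_tab !add0n.
by have /(latE sz h) l := C; apply: l.
Qed.

(** Transposition: the row attached to bead [k] contains the letter [p] as often as row [p] of [M]
    contains [k]. *)
Definition lr_tabs (M : mat (size lam) N B) : seq tableau :=
  rcons (mkseq (fun j => mkseq (fun i =>
      row_word (fun p => ent M p (index (j, i) (beads r c))) (size lam))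
    (size (nth [::] nu j))) r) (std_tab mu).

Lemma lr_mat_col M k : lr_mat M -> k < N ->
  bead_part quo k + \sum_(p < size lam) ent M p k = bead_part nu k.
Proof.
move=> /and3P[_ _ /eqP/ffunP h] lk.
by have := h (Ordinal lk); rewrite !ffunE.
Qed.

Lemma rows_of_lr_tabs M k : lr_mat M -> k < N ->
  nth [::] (rows_of (lr_tabs M)) k = row_word (fun p => ent M p k) (size lam).
Proof.
move=> mM lk; rewrite nth_rows_of // /lr_tabs nth_rcons size_mkseq.
have [lj li] := beadP lk; rewrite lj nth_mkseq //.
have [ls|ge] := ltnP (bead k).2 (size (nth [::] nu (bead k).1)).
  rewrite nth_mkseq //; apply: eq_row_word => p _.
  by rewrite -surjective_pairing index_bead.
rewrite [LHS]nth_default ?size_mkseq //; apply/esym/nilP.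
have := lr_mat_col mM lk; rewrite {2}/bead_part part_out // => /eqP.
by rewrite addn_eq0 => /andP[_ /eqP e]; rewrite /nilp size_row_word e.
Qed.

Lemma cnt_rows_of_lr_tabs M k p : lr_mat M -> cnt (rows_of (lr_tabs M)) k p = ent M p k.
Proof.
move=> mM; have [lk|ge] := ltnP k N; last first.
  by rewrite /cnt nth_default ?size_rows_of // ent_out ?ge ?orbT.
rewrite /cnt rows_of_lr_tabs // count_row_word; case: (ltnP p) => // ge.
by rewrite ent_out ?ge.
Qed.

Lemma cnt_lr_tabs M (j : 'I_r) i p : lr_mat M -> i < c j ->
  cnt (nth [::] (lr_tabs M) j) i p = ent M p (index (j : nat, i) (beads r c)).
Proof.
by move=> mM li; rewrite -(cnt_rows_of _ _ (ltn_ord j)) // cnt_rows_of_lr_tabs.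
Qed.

Lemma lr_coefE : lr_coef lam (rcons (zip nu quo) (mu, [::])) = #|lr_mat|.
Proof.
apply: (card_fset_set_image (f := lr_tabs)).
  move=> M M' mM mM' e; rewrite -(mkmatK M) -(mkmatK M'); congr mkmat.
  apply/funext => p; apply/funext => k.
  by rewrite -(cnt_rows_of_lr_tabs _ _ mM) e cnt_rows_of_lr_tabs.
move=> ts; apply: (iff_trans (lr_tableauxP ts)); split; last first.
  move=> [M mM <-]; have /and3P[/asboolP[C hr] /asboolP/same_latticeE L _] := mM.
  have cE : (fun p k => cnt (rows_of (lr_tabs M)) k p) = ent M.
    by apply/funext => p; apply/funext => k; rewrite cnt_rows_of_lr_tabs.
  have szts j : j < r -> nth [::] (lr_tabs M) j =
    mkseq (fun i => row_word (fun p => ent M p (index (j, i) (beads r c))) (size lam))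
    (size (nth [::] nu j)).
    by move=> lj; rewrite /lr_tabs nth_rcons size_mkseq lj nth_mkseq.
  split; last by rewrite cE.
  - by rewrite size_rcons size_mkseq.
  - by rewrite nth_rcons size_mkseq ltnn eqxx.
  - move=> j; apply/(ssytP _ (nuP _) (quoP _) (nu_inc _)).
    have nj : nth [::] nu j = tnth nu j by rewrite (tnth_nth [::]).
    have qj : nth [::] quo j = tnth quo j by rewrite (tnth_nth [::]).
    have T0 i : size (tnth nu j) <= i -> part (tnth quo j) i = 0.
      by move=> ge; have := part_includedP (nu_inc j) i; rewrite (part_out ge); lia.
    split.
    + by rewrite szts // size_mkseq nj.
    + move=> i; rewrite szts // nj; have [li|ge] := ltnP i (size (tnth nu j)).
        by rewrite nth_mkseq // sorted_row_word.
      by rewrite nth_default ?size_mkseq.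
    + move=> i; rewrite szts // nj; have [li|ge] := ltnP i (size (tnth nu j)); last first.
        by rewrite nth_default ?size_mkseq // T0 // part_out.
      have lic := leq_trans li (nu_size j).
      have [lk e] := bead_index (ltn_ord j) lic.
      rewrite nth_mkseq // size_row_word; have := lr_mat_col mM lk.
      by rewrite /bead_part e /= nj qj => <-; rewrite addKn.
    (* Past the last bead of the runner the tableau has no rows, and column strictness is
       trivial. *)
    + move=> i e; have [li|ge] := ltnP i.+1 (c j); last first.
        rewrite /prow T0; last exact: leq_trans (nu_size j) ge.
        rewrite big1 // => p _; rewrite /cnt [X in count_mem _ X]nth_default //.
        by rewrite szts // size_mkseq nj; apply: leq_trans (nu_size j) ge.
      have lic := ltnW li.
      have sk := same_runner_index (ltn_ord j) li.
      have := L _ e sk; rewrite /bead_part -index_beadS //.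
      have [_ ->] := bead_index (ltn_ord j) li; have [_ ->] := bead_index (ltn_ord j) lic.
      rewrite /= qj /prow.
      by under [X in _ <= _ + X -> _]eq_bigr do rewrite -cnt_lr_tabs //;
         under [X in _ + X <= _ -> _]eq_bigr do rewrite -cnt_lr_tabs //.
  - by move=> p; rewrite -hr /prow; congr (_ + _); apply: eq_bigr => k _; rewrite cnt_rows_of_lr_tabs.
move=> [szts tsr h hc C].
pose x p k := cnt (rows_of ts) k p; pose M := mkmat (size lam) N B x.
(* The total content is [lam], so no letter from [size lam] on occurs. *)
have x0 p k : (size lam <= p) || (N <= k) -> x p k = 0.
  case/orP => [ge|ge]; last by rewrite /x /cnt nth_default ?size_rows_of.
  have [lk|ge'] := ltnP k N; last by rewrite /x /cnt nth_default ?size_rows_of.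
  have := hc p; rewrite (part_out ge) => /eqP; rewrite addn_eq0 sum_nat_eq0.
  by move=> /andP[_ /forallP/(_ (Ordinal lk))/eqP].
have xB p k : x p k <= B.
  have [lk|ge] := ltnP k N; last by rewrite x0 ?ge ?orbT.
  apply: leq_trans (lamB p); rewrite -hc (bigD1 (Ordinal lk)) //= -/(x p k); lia.
have entE : ent M = x by apply: entK.
have colE (j : 'I_r) i : i < c j -> part (tnth quo j) i +
    \sum_(p < size lam) x p (index (j : nat, i) (beads r c)) = part (tnth nu j) i.
  move=> li; have [_ srt sz _] := iffLR (ssytP _ (nuP _) (quoP _) (nu_inc _)) (h j).
  have := sz i; have := part_includedP (nu_inc j) i.
  rewrite (size_count (n := size lam)) => [le e|].
    rewrite -(subnKC le) -e; congr (_ + _); apply: eq_bigr => p _.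
    by rewrite /x cnt_rows_of.
  apply/allP => p pin; rewrite ltnNge; apply/negP => ge.
  have := x0 p (index (j : nat, i) (beads r c)); rewrite ge /x cnt_rows_of // => /(_ isT) /eqP.
  by rewrite -leqn0 leqNgt -has_count has_pred1 pin.
have mM : lr_mat M.
  apply/and3P; split.
  - by apply/asboolP; rewrite entE; split=> // p; rewrite /prow hc.
  - apply/asboolP/same_latticeE; rewrite entE => k p sk.
    have [lj li e] := same_runnerP sk.
    have lk : k < N by move/andP: sk => [/ltnW].
    have [_ _ _ Cj] := iffLR (ssytP _ (nuP _) (quoP _) (nu_inc _)) (h (Ordinal lj)).
    have := Cj (bead k).2 p; rewrite /prow /bead_part e /= !(nthP quo lj).
    have E i q : i < c (bead k).1 -> cnt (nth [::] ts (bead k).1) i q =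
        x q (index ((bead k).1, i) (beads r c)) by move=> li'; rewrite /x cnt_rows_of.
    under [X in _ <= _ + X -> _]eq_bigr do rewrite E ?(ltnW li) // -surjective_pairing index_bead //.
    under [X in _ + X <= _ -> _]eq_bigr do rewrite E // -e index_bead ?(proj1 (andP sk)) //.
    by [].
  - apply/eqP/ffunP => k; rewrite !ffunE entE.
    have [lj li] := beadP (ltn_ord k).
    by rewrite /bead_part !(nthP _ lj) -colE // -surjective_pairing index_bead.
exists M => //.
have [ts0 tsE] : exists ts0, ts = rcons ts0 (std_tab mu).
  case/lastP: ts szts tsr {h hc C x M x0 xB entE colE mM} => [//|ts t].
  rewrite size_rcons => -[sz]; rewrite nth_rcons sz ltnn eqxx => ->; by exists ts.
have sz0 : size ts0 = r by move: szts; rewrite tsE size_rcons => -[].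
rewrite /lr_tabs [in RHS]tsE; congr rcons.
apply: (eq_from_nth (x0 := [::])); rewrite size_mkseq ?sz0 // => j lj.
rewrite nth_mkseq //; have [szj srt _ _] := iffLR (ssytP _ (nuP _) (quoP _) (nu_inc _)) (h (Ordinal lj)).
have tsj : nth [::] ts j = nth [::] ts0 j by rewrite tsE nth_rcons sz0 lj.
rewrite /= tsj in szj srt.
apply: (eq_from_nth (x0 := [::])); rewrite size_mkseq (nthP nu lj) ?szj // => i li.
rewrite nth_mkseq // entE; have lic := leq_trans li (nu_size (Ordinal lj)).
rewrite [RHS](row_word_count (n := size lam) (srt i)).
  by apply: eq_row_word => p _; rewrite /x cnt_rows_of // tsj.
apply/allP => p pin; rewrite ltnNge; apply/negP => ge.
have := x0 p (index (j : nat, i) (beads r c)); rewrite ge /x cnt_rows_of // => /(_ isT) /eqP.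
by rewrite -leqn0 leqNgt -has_count has_pred1 tsj pin.
Qed.

End LRCoef.

(** * The abacus *)

Lemma size_beta_set N al : size (beta_set N al) = N.
Proof. by rewrite size_map size_iota. Qed.

Lemma nth_beta_set N al i : i < N -> nth 0 (beta_set N al) i = part al i + (N - i.+1).
Proof. by move=> li; rewrite (nth_map 0) ?size_iota // nth_iota // add0n addnBA. Qed.

Lemma gtn_trans : transitive gtn. Proof. by move=> a b c /=; lia. Qed.

Lemma sorted_gtnP (X : seq nat) :
  reflect (forall i, i.+1 < size X -> nth 0 X i.+1 < nth 0 X i) (sorted gtn X).
Proof. exact: (sortedP 0). Qed.

Lemma beta_set_sorted N al : is_part al -> sorted gtn (beta_set N al).
Proof.
move=> aP; apply/sorted_gtnP => i; rewrite size_beta_set => li.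
by rewrite !nth_beta_set //; have := part_anti aP (leqnSn i); lia.
Qed.

Lemma gtn_sorted_uniq (X : seq nat) : sorted gtn X -> uniq X.
Proof. by apply: sorted_uniq; [exact: gtn_trans | move=> x /=; lia]. Qed.

(** After index [i] there remain [size X - i.+1] smaller numbers. This makes the truncated
    subtraction in [part_of_beta] exact. *)
Lemma gtn_sorted_nth (X : seq nat) i : sorted gtn X -> i < size X ->
  size X - i.+1 <= nth 0 X i.
Proof.
move=> /sorted_gtnP h li; have [d dE] : exists d, size X = i.+1 + d by exists (size X - i.+1); lia.
elim: d i li dE => [|d IH] i li dE; first lia.
by have := IH i.+1; have := h i; lia.
Qed.

(** In a weakly decreasing list the zeros form the tail. *)
Lemma nth_filter_neq0 (s : seq nat) i : sorted geq s ->
  nth 0 [seq p <- s | p != 0] i = nth 0 s i.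
Proof.
have tr : transitive geq by move=> a b c; rewrite /geq /=; lia.
elim: s i => //= y s IH i sg; have ya := order_path_min tr sg.
have [y0|ny] := eqVneq y 0; last by case: i => //= i; apply/IH/(path_sorted sg).
have /all_pred1P sE : all (pred1 0) s.
  by apply: sub_all ya => z; rewrite y0 /geq /=; lia.
rewrite y0 sE /=; move: (size s) => m.
have -> : [seq p <- nseq m 0 | p != 0] = [::] by elim: m.
by rewrite nth_nil; case: i => //= i; rewrite nth_nseq if_same.
Qed.

Definition part_of_fun (g : nat -> nat) m : seq nat := [seq x <- mkseq g m | x != 0].

Lemma part_of_funP g m : (forall i, i.+1 < m -> g i.+1 <= g i) ->
  is_part (part_of_fun g m) /\
  forall i, part (part_of_fun g m) i = if i < m then g i else 0.
Proof.
move=> gS; have sg : sorted geq (mkseq g m).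
  apply/(sortedP 0) => i; rewrite size_mkseq => li.
  by rewrite !nth_mkseq ?(ltnW li) //; exact: gS.
have tr : transitive geq by move=> a b c; rewrite /geq /=; lia.
split; first by rewrite /is_part sorted_filter //= mem_filter eqxx.
move=> i; rewrite /part nth_filter_neq0 //; case: ltnP => li.
  by rewrite nth_mkseq.
by rewrite nth_default ?size_mkseq.
Qed.

Lemma gtn_sorted_part (X : seq nat) :
  sorted gtn X -> is_part (part_of_beta X) /\
  forall i, i < size X -> part (part_of_beta X) i = nth 0 X i - (size X - i.+1).
Proof.
move=> sX; have [|pP pE] := @part_of_funP (fun i => nth 0 X i - (size X - i.+1)) (size X).
  move=> i li; have := gtn_sorted_nth sX li; have /sorted_gtnP/(_ i li) := sX; lia.
by split=> // i li; rewrite [LHS]pE li.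
Qed.

Lemma size_part_of_beta X : size (part_of_beta X) <= size X.
Proof. by rewrite size_filter (leq_trans (count_size _ _)) // size_map size_iota. Qed.

Lemma part_of_betaK X : sorted gtn X -> beta_set (size X) (part_of_beta X) = X.
Proof.
move=> sX; have [_ h] := gtn_sorted_part sX.
apply: (eq_from_nth (x0 := 0)); rewrite size_beta_set // => i li.
by rewrite nth_beta_set // h // subnK // gtn_sorted_nth.
Qed.

Lemma beta_setK N al : is_part al -> size al <= N -> part_of_beta (beta_set N al) = al.
Proof.
move=> aP le; have [pP h] := gtn_sorted_part (beta_set_sorted N aP).
apply: part_inj => // i; rewrite size_beta_set in h.
have [li|ge] := ltnP i N; first by rewrite h // nth_beta_set // addnK.
by rewrite !part_out //; [exact: leq_trans ge | apply: leq_trans (size_part_of_beta _) _; rewrite size_beta_set].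
Qed.

Lemma beta_set_inj N al be : is_part al -> is_part be -> size al <= N -> size be <= N ->
  beta_set N al = beta_set N be -> al = be.
Proof. by move=> aP bP la lb e; rewrite -(beta_setK aP la) e beta_setK. Qed.

Lemma gtn_sorted_eq (X Y : seq nat) : sorted gtn X -> sorted gtn Y -> perm_eq X Y -> X = Y.
Proof.
move=> sX sY p; apply: (irr_sorted_eq gtn_trans _ sX sY); first by move=> x /=; lia.
exact: perm_mem.
Qed.

(** Adding [r] beads pushes every bead one place along its runner and fills the first place of each
    runner. Independence of the number of beads rests on this. *)
Lemma beta_set_shift N r al : size al <= N ->
  beta_set (N + r) al = [seq x + r | x <- beta_set N al] ++ rev (iota 0 r).
Proof.
move=> le; apply: (eq_from_nth (x0 := 0)).
  by rewrite size_cat size_map !size_beta_set size_rev size_iota.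
rewrite size_beta_set => i li; rewrite nth_beta_set // nth_cat size_map size_beta_set.
case: ltnP => li'.
  by rewrite (nth_map 0) ?size_beta_set // nth_beta_set //; lia.
by rewrite part_out ?(leq_trans le) // nth_rev ?size_iota ?nth_iota; lia.
Qed.

Lemma runner_cat r j X Y : runner r j (X ++ Y) = runner r j X ++ runner r j Y.
Proof. by rewrite /runner filter_cat map_cat. Qed.

Lemma runner_shift r j X : 0 < r ->
  runner r j [seq x + r | x <- X] = [seq b.+1 | b <- runner r j X].
Proof.
move=> r0; rewrite /runner; elim: X => //= x X IH.
rewrite modnDr; case: ifP => //= _; congr (_ :: _) => //.
by rewrite divnDr ?dvdnn // divnn r0 addn1.
Qed.

Lemma runner_iota r j : j < r -> runner r j (rev (iota 0 r)) = [:: 0].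
Proof.
move=> lj; rewrite /runner filter_rev map_rev.
suff -> : [seq x <- iota 0 r | x %% r == j] = [:: j] by rewrite /= divn_small.
have -> : [seq x <- iota 0 r | x %% r == j] = [seq x <- iota 0 r | x == j].
  by apply: eq_in_filter => x; rewrite mem_iota => /andP[_ lx]; rewrite modn_small.
apply: (irr_sorted_eq ltn_trans ltnn) => //.
  by apply: sorted_filter; [exact: ltn_trans | exact: iota_ltn_sorted].
by move=> x; rewrite mem_filter mem_iota inE; case: eqP => // ->; rewrite lj.
Qed.

Lemma runner_sorted r j X : 0 < r -> sorted gtn X -> sorted gtn (runner r j X).
Proof.
move=> r0 sX; rewrite /runner.
have: sorted gtn [seq x <- X | x %% r == j] by apply: sorted_filter => //; exact: gtn_trans.
have : all (fun x => x %% r == j) [seq x <- X | x %% r == j] by apply: filter_all.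
elim: [seq x <- X | _] => //= x [|y s] IH //= /and3P[/eqP xj /eqP yj sj] /andP[xy p].
have /= -> : sorted gtn [seq x %/ r | x <- y :: s] by apply: IH => //=; rewrite yj eqxx.
rewrite andbT; move: xy; rewrite /gtn /=.
by rewrite {1}(divn_eq x r) {1}(divn_eq y r) xj yj ltn_add2r ltn_mul2r r0.
Qed.

Section Abacus.

Variables (r : nat) (tau : seq nat).
Hypotheses (r0 : 0 < r) (tauP : is_part tau).

Definition nbeads N j := size (runner r j (beta_set N tau)).

Lemma runner_beta_shift N j : size tau <= N -> j < r ->
  runner r j (beta_set (N + r) tau) =
  rcons [seq b.+1 | b <- runner r j (beta_set N tau)] 0.
Proof.
by move=> le lj; rewrite beta_set_shift // runner_cat runner_shift // runner_iota // cats1.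
Qed.

Lemma nbeads_shift N j : size tau <= N -> j < r -> nbeads (N + r) j = (nbeads N j).+1.
Proof. by move=> le lj; rewrite /nbeads runner_beta_shift // size_rcons size_map. Qed.

(** Once there are at least [size tau] beads, each further group of [r] beads puts one more bead on
    every runner. *)
Lemma nbeads_lower M j : j < r -> M <= nbeads (r * (size tau + M)) j.
Proof.
move=> lj; elim: M => // M IH; rewrite addnS mulnS addnC nbeads_shift //.
by apply: leq_trans (leq_addr M _) _; apply: leq_pmull.
Qed.

Lemma tnth_quotient_at N (j : 'I_r) :
  tnth (quotient_at r N tau) j = part_of_beta (runner r j (beta_set N tau)).
Proof. by rewrite tnth_mktuple. Qed.

Lemma beta_runner N j : beta_set (nbeads N j) (part_of_beta (runner r j (beta_set N tau)))
  = runner r j (beta_set N tau).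
Proof. by rewrite part_of_betaK // runner_sorted // beta_set_sorted. Qed.

Lemma quotient_at_shift N : size tau <= N -> quotient_at r (N + r) tau = quotient_at r N tau.
Proof.
move=> le; apply: eq_from_tnth => j; rewrite !tnth_quotient_at.
set Y := part_of_beta (runner r j (beta_set N tau)).
have [yP _] := gtn_sorted_part (runner_sorted j r0 (beta_set_sorted N tauP)).
have szY : size Y <= nbeads N j by exact: size_part_of_beta.
rewrite runner_beta_shift // -[RHS](beta_setK (N := nbeads N j + 1)) ?(leq_trans szY) ?leq_addr //.
rewrite beta_set_shift // beta_runner /= cats1; congr (part_of_beta (rcons _ _)).
by apply: eq_map => x; rewrite addn1.
Qed.

Lemma quotientE q : size tau <= q -> quotient r tau = quotient_at r (r * q) tau.
Proof.
move=> le; rewrite /quotient -(subnKC le); elim: (q - _) => [|d IH]; first by rewrite addn0.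
rewrite addnS mulnS addnC quotient_at_shift //.
by apply: leq_trans (leq_addr d _) _; apply: leq_pmull.
Qed.

Definition star_beta N (nu : r.-tuple (seq nat)) : seq nat :=
  flatten [seq [seq (j + r * b)%N | b <- beta_set (nbeads N (j : nat)) (tnth nu j)] | j : 'I_r].

Lemma star_atE N nu : star_at N nu tau = part_of_beta (sort geq (star_beta N nu)).
Proof. by []. Qed.

(** Every number lies on exactly one runner. Counting an arbitrary predicate turns this into a
    multiset identity through [seq.permP]. *)
Lemma sumn_runner (a : pred nat) X :
  \sum_(j < r) count a [seq (j + r * b)%N | b <- runner r j X] = count a X.
Proof.
elim: X => [|x X IH]; first by rewrite big1.
have lx : x %% r < r by rewrite ltn_mod.
rewrite /= -IH (bigD1 (Ordinal lx)) //= [in RHS](bigD1 (Ordinal lx)) //=.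
rewrite {1}/runner /= eqxx /= addnA; congr (_ + _ + _).
  by rewrite addnC mulnC -divn_eq.
apply: eq_bigr => j ne; rewrite /runner /= ifN //.
by apply: contraNneq ne => e; apply/eqP/val_inj.
Qed.

Lemma nbeads_sum N : \sum_(j < r) nbeads N j = N.
Proof.
rewrite -[RHS](size_beta_set N tau) -count_predT -(sumn_runner predT).
by apply: eq_bigr => j _; rewrite count_predT size_map.
Qed.

Lemma count_star_beta N nu (a : pred nat) : count a (star_beta N nu) =
  \sum_(j < r) count a [seq (j + r * b)%N | b <- beta_set (nbeads N (j : nat)) (tnth nu j)].
Proof.
rewrite /star_beta count_flatten sumnE big_map big_map -[index_enum _]/(Finite.enum _) -enumT.
by rewrite big_enum.
Qed.

Lemma size_star_beta N nu : size (star_beta N nu) = N.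
Proof.
rewrite -count_predT count_star_beta -[RHS](nbeads_sum N).
by apply: eq_bigr => j _; rewrite count_predT size_map size_beta_set.
Qed.

Lemma star_beta_uniq N (nu : r.-tuple (seq nat)) : (forall j, is_part (tnth nu j)) ->
  uniq (star_beta N nu).
Proof.
move=> nP; apply/allpairs_uniq_dep => /=.
- by rewrite enum_uniq.
- by move=> j _; exact/gtn_sorted_uniq/beta_set_sorted.
move=> [j b] [j' b'] _ _ /= e.
have jj : j = j'.
  apply: val_inj; have := congr1 (modn^~ r) e.
  by rewrite /= !(addnC (nat_of_ord _)) !(mulnC r) !modnMDl !modn_small.
subst j'; congr (existT _ _ _).
by apply/eqP; rewrite -(eqn_pmul2l r0) -(eqn_add2l j) e.
Qed.

Lemma sort_star_beta N (nu : r.-tuple (seq nat)) : (forall j, is_part (tnth nu j)) ->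
  sorted gtn (sort geq (star_beta N nu)).
Proof.
move=> nP; have u : uniq (sort geq (star_beta N nu)) by rewrite sort_uniq star_beta_uniq.
have : sorted geq (sort geq (star_beta N nu)).
  by apply: sort_sorted => x y; rewrite /geq /=; lia.
move: u; elim: (sort _ _) => //= x [|y s] IH //=; rewrite inE negb_or -andbA.
move=> /and3P[ne _ u] /andP[xy p].
have /= -> : sorted gtn (y :: s) by apply: IH.
by rewrite andbT; move: ne xy; rewrite /geq /=; lia.
Qed.

Lemma star_at_part N (nu : r.-tuple (seq nat)) : (forall j, is_part (tnth nu j)) ->
  is_part (star_at N nu tau) /\ size (star_at N nu tau) <= N.
Proof.
move=> nP; split; first by have [] := gtn_sorted_part (sort_star_beta N nP).
by apply: leq_trans (size_part_of_beta _) _; rewrite size_sort size_star_beta.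
Qed.

Lemma star_at_beta N (nu : r.-tuple (seq nat)) : (forall j, is_part (tnth nu j)) ->
  perm_eq (beta_set N (star_at N nu tau)) (star_beta N nu).
Proof.
move=> nP; have := part_of_betaK (sort_star_beta N nP).
by rewrite size_sort size_star_beta star_atE => ->; rewrite perm_sort.
Qed.

Lemma star_beta_shift N nu : size tau <= N ->
  (forall j : 'I_r, size (tnth nu j) <= nbeads N j) ->
  perm_eq (star_beta (N + r) nu) ([seq x + r | x <- star_beta N nu] ++ rev (iota 0 r)).
Proof.
move=> le ln; apply/seq.permP => a; rewrite count_cat count_map !count_star_beta.
rewrite count_rev -(count_map id) map_id.
have -> : count a (iota 0 r) = \sum_(j < r) a j.
  by rewrite -sumn_count sumnE big_map -(big_mkord xpredT (fun j => nat_of_bool (a j))) /index_iota subn0.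
rewrite -big_split /=; apply: eq_bigr => j _.
rewrite nbeads_shift // -addn1 beta_set_shift // map_cat count_cat /= addn0 muln0 addn0.
congr (_ + _); rewrite -map_comp !count_map; apply: eq_count => b /=.
by rewrite addn1 mulnS addnA (addnAC j).
Qed.

(** The number of beads used by [star] depends on [nu]; here it is replaced by a common [r * q], so
    that one alternant can serve all [nu]. *)
Lemma star_beta_perm q (nu : r.-tuple (seq nat)) : (forall j, is_part (tnth nu j)) ->
  size tau + \max_(j < r) size (tnth nu j) <= q ->
  [/\ is_part (star nu tau), size (star nu tau) <= r * q,
      forall j : 'I_r, size (tnth nu j) <= nbeads (r * q) j
    & perm_eq (beta_set (r * q) (star nu tau)) (star_beta (r * q) nu)].
Proof.
move=> nP le; rewrite -(subnKC le); set q0 := size tau + _.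
have tq d : size tau <= r * (q0 + d).
  by apply: leq_trans (leq_pmull _ r0); rewrite -addnA leq_addr.
elim: (q - q0) => [|d [sP sS nS sB]].
  rewrite addn0 /star -/q0; have [h1 h2] := star_at_part (r * q0) nP.
  split=> //; last exact: star_at_beta.
  by move=> j; apply: leq_trans (nbeads_lower _ (ltn_ord j)); apply: (leq_bigmax j).
rewrite addnS mulnS (addnC r); split=> //.
- exact: leq_trans (leq_addr _ _).
- by move=> j; rewrite nbeads_shift // leqW.
rewrite beta_set_shift //; apply: perm_trans (_ : perm_eq _ _) _; last first.
  by rewrite perm_sym; apply: star_beta_shift.
by rewrite perm_cat2r perm_map.
Qed.

Lemma star_quotient q : size tau <= q ->
  perm_eq (beta_set (r * q) tau) (star_beta (r * q) (quotient r tau)).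
Proof.
move=> le; apply/seq.permP => a; rewrite count_star_beta -sumn_runner.
by apply: eq_bigr => j _; rewrite (quotientE le) tnth_quotient_at beta_runner.
Qed.

End Abacus.

(** * Border strips *)

Arguments part : simpl never.

Lemma count_iota_itv a b m : b <= m -> count (fun c => a <= c < b) (iota 0 m) = b - a.
Proof.
move=> le; have -> : b - a = minn b m - a by rewrite (minn_idPl le).
elim: m {le} => [|m IH]; first by rewrite minn0 sub0n.
by rewrite -addn1 iotaD count_cat IH /= add0n addn0; lia.
Qed.

Lemma in_skew_row lam mu b : in_skew lam mu b -> b.1 < size lam.
Proof. by move=> /andP[_]; case: (ltnP b.1 (size lam)) => // /part_out ->. Qed.

Lemma adjacentC b b' : adjacent b b' = adjacent b' b.
Proof.
rewrite /adjacent (eq_sym b.1 b'.1) (eq_sym b.2 b'.2).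
by rewrite (orbC (b.2 == b'.2.+1)) (orbC (b.1 == b'.1.+1)).
Qed.

Section StripForm.

Variables (mu lam : seq nat).
Hypotheses (muP : is_part mu) (lamP : is_part lam).

Lemma mem_skew_boxes b : (b \in skew_boxes lam mu) = in_skew lam mu b.
Proof.
rewrite mem_filter andb_idr // => ib; apply/allpairsP; exists b.
rewrite !mem_iota !add0n /= (in_skew_row ib) -surjective_pairing; split=> //.
by case/andP: ib => _; rewrite -nth0 => lt; apply: leq_trans lt (part_anti lamP _).
Qed.

Lemma size_skew_boxes :
  size (skew_boxes lam mu) = \sum_(p < size lam) (part lam p - part mu p).
Proof.
rewrite size_filter count_flatten -map_comp sumnE big_map /=.
rewrite -(big_mkord xpredT (fun p => part lam p - part mu p)) /index_iota subn0.
rewrite !big_seq; apply: eq_bigr => p; rewrite mem_iota => /andP[_ lp].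
rewrite /= count_map -(count_iota_itv (part mu p) (m := head 0 lam)) //.
by rewrite -nth0; exact: part_anti.
Qed.

(* lam / mu is a border strip occupying the rows i, ..., i + h. *)
Definition strip_shape i h :=
  [/\ forall p, p < i -> part lam p = part mu p,
      part mu i < part lam i,
      forall p, i <= p < i + h -> part lam p.+1 = (part mu p).+1
    & forall p, i + h < p -> part lam p = part mu p].

Section Shape.

Variables (i h : nat).
Hypothesis S : strip_shape i h.

Lemma strip_shape_rows p : (part mu p < part lam p) = (i <= p < i + h.+1).
Proof.
case: S => S1 S2 S3 S4.
have [lt|ge] /= := ltnP p i; first by rewrite S1 // ltnn.
have [lt|ge'] := ltnP p (i + h.+1); last by rewrite S4 ?ltnn //; lia.
have [->//|ne] := eqVneq p i.
have := S3 p.-1; have := part_anti muP (leq_pred p); rewrite prednK; lia.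
Qed.

Lemma strip_shape_le p : part mu p <= part lam p.
Proof.
case: S => S1 S2 S3 S4; case: (ltnP (part mu p) (part lam p)) => [/ltnW//|].
rewrite leqNgt; have := strip_shape_rows p.
have [lt|ge] := ltnP p i; first by rewrite S1 // => _; rewrite ltnn.
have [lt|ge'] := ltnP p (i + h.+1); first by move=> /= ->.
by rewrite S4 ?ltnn //; lia.
Qed.

Lemma strip_shape_last : i + h < size lam.
Proof.
have : part mu (i + h) < part lam (i + h) by rewrite strip_shape_rows; lia.
by case: (ltnP (i + h) (size lam)) => // /part_out ->.
Qed.

(** Consecutive rows of the strip share exactly one column, so the row lengths telescope. *)
Lemma strip_shape_size : size (skew_boxes lam mu) + part mu (i + h) = part lam i + h.
Proof.
case: S => S1 S2 S3 S4; rewrite size_skew_boxes.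
pose g p := part lam p - part mu p.
have l := strip_shape_last.
rewrite (sum_ord_split g (_ : i + h.+1 <= _)); last by rewrite addnS.
rewrite [X in _ + X + _]big1_seq ?addn0; last first.
  by move=> p /andP[_]; rewrite mem_index_iota /g => /andP[ge _]; rewrite S4 ?subnn //; lia.
rewrite (sum_ord_split g (leq_addr _ _)) big1 => [|p _]; last by rewrite /g S1 ?subnn.
rewrite add0n; have : h <= h by [].
elim: {-2}h => [|k IH] lek.
  by rewrite addn0 addn1 big_nat1 /g; lia.
rewrite (addnS _ k.+1) big_nat_recr /=; last by lia.
have := IH (ltnW lek); have := S3 (i + k); have := strip_shape_le (i + k.+1).
by rewrite /g !addnS; lia.
Qed.

Lemma strip_shape_height : height mu lam = h.
Proof.
rewrite /height (eq_count (a2 := fun p => i <= p < i + h.+1)); last exact: strip_shape_rows.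
by rewrite count_iota_itv ?addKn // addnS strip_shape_last.
Qed.

Lemma strip_shape_no_square : no_square lam mu.
Proof.
case: S => S1 S2 S3 S4.
apply/allP => -[p c]; rewrite mem_skew_boxes => /andP[/= h1 h2].
apply/negP => /and3P[/andP[/= h3 h4] /andP[/= h5 h6] /andP[_ /= h7]].
have : part mu p.+1 < part lam p.+1 by lia.
have : part mu p < part lam p by lia.
rewrite !strip_shape_rows => r1 r2; have := S3 p; lia.
Qed.

(** Every box reaches the last box of row [i] by moving right to the end of its row and then up,
    since the last box of row [p.+1] lies under the first box of row [p]. *)
Lemma strip_shape_connected : skew_connected lam mu.
Proof.
case: S => S1 S2 S3 S4.
pose e (x y : seq_sub (skew_boxes lam mu)) := adjacent (val x) (val y).
have top : (i, (part lam i).-1) \in skew_boxes lam mu.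
  by rewrite mem_skew_boxes /in_skew /=; lia.
pose z := SeqSub top.
pose C b := forall x : seq_sub (skew_boxes lam mu), val x = b -> connect e x z.
have step b b' : adjacent b b' -> b' \in skew_boxes lam mu -> C b' -> C b.
  move=> ab hb' Cb x xb; apply: (connect_trans (y := SeqSub hb')); last exact: Cb.
  by apply: connect1; rewrite /e xb.
have row d p c : c + d = (part lam p).-1 -> part mu p <= c ->
    C (p, (part lam p).-1) -> C (p, c).
  elim: d c => [|d IH] c; first by rewrite addn0 => ->.
  move=> E lec Cp; apply: (step _ (p, c.+1)); last by apply: IH => //; lia.
    by rewrite /adjacent /= !eqxx orbT.
  by rewrite mem_skew_boxes /in_skew /=; lia.
have last_box k : k <= h -> C (i + k, (part lam (i + k)).-1).
  elim: k => [|k IH] lek.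
    move=> x; rewrite addn0 => xb; have -> : x = z by apply: val_inj.
    exact: connect0.
  have E := S3 (i + k); rewrite addnS E /=; last by lia.
  have inr : part mu (i + k) < part lam (i + k) by rewrite strip_shape_rows; lia.
  apply: (step _ (i + k, part mu (i + k))).
  - by rewrite /adjacent /= !eqxx !orbT.
  - by rewrite mem_skew_boxes /in_skew /= leqnn.
  - apply: (row ((part lam (i + k)).-1 - part mu (i + k))) => //; first lia.
    by apply: IH; lia.
have all_box (x : seq_sub (skew_boxes lam mu)) : connect e x z.
  case: x => -[p c] hx.
  have /andP[/= h1 h2] : in_skew lam mu (p, c) by rewrite -mem_skew_boxes.
  have : part mu p < part lam p by lia.
  rewrite strip_shape_rows => hp.
  have := last_box (p - i); rewrite subnKC; last by lia.
  move=> L; apply: (row ((part lam p).-1 - c) p c); [lia|lia| |by []].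
  by apply: L; lia.
apply/forallP => x; apply/forallP => y.
apply: connect_trans (all_box x) _; rewrite (sym_connect_sym (e := e)) //.
by move=> a b; rewrite /e adjacentC.
Qed.

End Shape.

Lemma strip_shape_border_strip r i h : strip_shape i h ->
  part lam i + h = part mu (i + h) + r -> border_strip r mu lam.
Proof.
move=> S E; apply/and5P; split=> //.
- by apply: part_includedI => p; apply: (strip_shape_le S).
- exact: (strip_shape_connected S).
- rewrite (strip_shape_no_square S) /=.
  by have := strip_shape_size S; rewrite E addnC => /addnI ->.
Qed.

(** If rows [p] and [p.+1] shared two columns there would be a square; if they shared none, the
    boxes in rows up to [p] would be closed under adjacency, against connectedness. [0 < r] provides
    a box to start from. *)
Lemma border_strip_shape r : 0 < r -> border_strip r mu lam ->
  exists i h, strip_shape i h /\ part lam i + h = part mu (i + h) + r.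
Proof.
move=> r0 /and5P[_ _ /part_includedP inc /forallP conn /andP[/allP nosq /eqP szr]].
have row_lt p : part mu p < part lam p -> p < size lam.
  by case: (ltnP p (size lam)) => // /part_out ->.
have exP : exists p, part mu p < part lam p.
  have : 0 < size (skew_boxes lam mu) by rewrite szr.
  case E : (skew_boxes lam mu) => [|b s] // _; exists b.1.
  have : b \in skew_boxes lam mu by rewrite E inE eqxx.
  by rewrite mem_skew_boxes => /andP[]; apply: leq_ltn_trans.
have ubP p : part mu p < part lam p -> p <= size lam by move/row_lt/ltnW.
case: (ex_minnP exP) => i Pi imin; case: (ex_maxnP exP ubP) => m Pm mmax.
have lim : i <= m by apply: imin.
have S1 p : p < i -> part lam p = part mu p.
  move=> lt; apply/eqP; rewrite eqn_leq inc andbT leqNgt; apply/negP => /imin.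
  by rewrite leqNgt lt.
have S4 p : m < p -> part lam p = part mu p.
  move=> lt; apply/eqP; rewrite eqn_leq inc andbT leqNgt; apply/negP => /mmax.
  by rewrite leqNgt lt.
have S3 p : i <= p < m -> part lam p.+1 = (part mu p).+1.
  move=> /andP[lip lpm]; apply/eqP; rewrite eqn_leq; apply/andP; split.
    rewrite leqNgt; apply/negP => lt.
    have := part_anti lamP (leqnSn p); have := part_anti muP (leqnSn p) => a1 a2.
    have bx : (p, part mu p) \in skew_boxes lam mu.
      by rewrite mem_skew_boxes; apply/andP; split=> /=; lia.
    have /= := nosq _ bx; rewrite /in_skew /=; lia.
  rewrite ltnNge; apply/negP => le.
  have bi : (i, part mu i) \in skew_boxes lam mu by rewrite mem_skew_boxes /in_skew /= leqnn.
  have bm : (m, part mu m) \in skew_boxes lam mu by rewrite mem_skew_boxes /in_skew /= leqnn.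
  pose a := [pred x : seq_sub (skew_boxes lam mu) | (val x).1 <= p].
  suff cl : closed (fun x y : seq_sub (skew_boxes lam mu) => adjacent (val x) (val y)) a.
    have := closed_connect cl (forallP (conn (SeqSub bi)) (SeqSub bm)).
    by rewrite !inE /= lip leqNgt lpm.
  move=> [[p1 c1] h1] [[p2 c2] h2]; rewrite !inE /adjacent /=.
  have : in_skew lam mu (p1, c1) by rewrite -mem_skew_boxes.
  have : in_skew lam mu (p2, c2) by rewrite -mem_skew_boxes.
  rewrite /in_skew /= => /andP[u1 u2] /andP[v1 v2].
  move=> /orP[/andP[/eqP-> _]//|/andP[/eqP e /orP[/eqP e1|/eqP e1]]]; subst.
    have [lt|gt|e] := ltngtP p2 p; try lia.
    by subst; lia.
  have [lt|gt|e] := ltngtP p1 p; try lia.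
  by subst; lia.
have S : strip_shape i (m - i) by split=> //; rewrite subnKC.
exists i, (m - i); split=> //.
by rewrite -(strip_shape_size S) szr addnC.
Qed.

End StripForm.

(** * Signs *)

Section Signs.

Variable N : nat.

Definition beta_vec (al : seq nat) : vec N := vadd (vdelta N) (vecof N (part al)).

Lemma beta_vecE al (k : 'I_N) : beta_vec al k = part al k + (N - k.+1).
Proof. by rewrite !ffunE addnC. Qed.

Lemma beta_vec_lt al (k k' : 'I_N) : is_part al -> k < k' -> beta_vec al k' < beta_vec al k.
Proof.
move=> aP lt; rewrite !beta_vecE; have := part_anti aP (ltnW lt).
by have := ltn_ord k'; lia.
Qed.

Lemma beta_vec_inj al : is_part al -> injective (beta_vec al).
Proof.
move=> aP k k' e; apply/ord_inj; case: (ltngtP k k') => // lt.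
  by have := beta_vec_lt aP lt; rewrite e ltnn.
by have := beta_vec_lt aP lt; rewrite e ltnn.
Qed.

(** The beads of each runner appear in decreasing order, with no condition between runners; for
    [r = 1] this is plain decreasing order. *)
Definition runner_sorted_vec r (v : vec N) :=
  forall k k' : 'I_N, k < k' -> v k = v k' %[mod r] -> v k' < v k.

Lemma beta_vec_sorted al : is_part al -> runner_sorted_vec 1 (beta_vec al).
Proof. by move=> aP k k' lt _; apply: beta_vec_lt. Qed.

Lemma vperm_enum (t : 'S_N) v :
  perm_eq [seq vperm t v k | k <- enum 'I_N] [seq v k | k <- enum 'I_N].
Proof.
rewrite (eq_map (g := v \o t)) => [|k]; last by rewrite ffunE.
rewrite map_comp; apply: perm_map; apply: uniq_perm; rewrite ?enum_uniq //.
  by rewrite map_inj_uniq ?enum_uniq //; apply: perm_inj.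
move=> k; rewrite mem_enum inE; apply/mapP; exists ((t^-1)%g k); rewrite ?mem_enum //.
by rewrite permKV.
Qed.

(** In each residue class both vectors list the same numbers at the same indices, in decreasing
    order. *)
Lemma runner_sorted_uniq r (t u : 'S_N) z :
  let v := vperm t z in let w := vperm u z in
  runner_sorted_vec r v -> runner_sorted_vec r w ->
  (forall k, v k = w k %[mod r]) -> v = w.
Proof.
move=> v w sv sw res; apply/ffunP => k0.
pose L := [seq k <- enum 'I_N | v k %% r == v k0 %% r].
have sE : sorted (fun a b : 'I_N => a < b) L.
  apply: sorted_filter; first by move=> a b c; apply: ltn_trans.
  have : sorted ltn (map val (enum 'I_N)) by rewrite val_enum_ord iota_ltn_sorted.
  by rewrite sorted_map.
have sL (x : vec N) : runner_sorted_vec r x -> (forall k, v k = x k %[mod r]) ->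
    sorted gtn [seq x k | k <- L].
  move=> sx rx; rewrite sorted_map; pose P := [pred k | v k %% r == v k0 %% r].
  apply: (sub_in_sorted (P := P) _ _ sE); last exact: filter_all.
  move=> a b /eqP Pa /eqP Pb lt /=; apply: sx => //.
  by rewrite -!rx Pa Pb.
have p : perm_eq [seq v k | k <- L] [seq w k | k <- L].
  have E (x : vec N) : (forall k, v k = x k %[mod r]) ->
     [seq x k | k <- L] = [seq y <- [seq x k | k <- enum 'I_N] | y %% r == v k0 %% r].
    move=> rx; rewrite filter_map; congr map; apply: eq_filter => k /=.
    by rewrite -rx.
  rewrite !E //; apply: perm_filter.
  by rewrite (perm_trans (vperm_enum t z)) // perm_sym vperm_enum.
have := gtn_sorted_eq (sL v sv (fun=> erefl)) (sL w sw res) p.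
move=> /eq_in_map; apply; by rewrite mem_filter eqxx mem_enum.
Qed.

(** A cycle of length [h.+1] is a product of [h] transpositions. It restores decreasing order after
    one bead has passed [h] others. *)
Lemma cycle_perm (i h : nat) : i + h < N ->
  exists s : 'S_N, odd_perm s = odd h /\
  forall k : 'I_N, s k = (if k == i + h :> nat then i else
    if i <= k < i + h then k.+1 else k) :> nat.
Proof.
elim: h => [|h IH] lt.
  exists 1%g; split=> [|k]; first exact: odd_perm1.
  by rewrite perm1 addn0; case: eqP => [->//|ne]; case: ifP => //; lia.
have lt' : i + h < N by lia.
have [s [os sE]] := IH lt'.
pose a := Ordinal lt'; pose b := Ordinal lt.
exists (tperm a b * s)%g; split.
  rewrite odd_permM os odd_tperm /=; case: (odd h); rewrite ?addbT ?addbF /=.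
    by apply/negbF/negP => /eqP /(congr1 val) /=; lia.
  by apply/negP => /eqP /(congr1 val) /=; lia.
move=> k; rewrite permM; case: tpermP => [->|->|/eqP na /eqP nb]; rewrite sE /=.
- by repeat case: ifP; lia.
- by repeat case: ifP; lia.
have {}na : val k != i + h by apply: contraNneq na => e; apply/eqP/val_inj.
have {}nb : val k != i + h.+1 by apply: contraNneq nb => e; apply/eqP/val_inj.
by move: na nb; rewrite /=; repeat case: ifP; lia.
Qed.

(** The moved bead has index [i + h] in [mu] and becomes bead [i] of [lam]. Each of the [h] beads it
    passes keeps its position while its index grows by one, which is the equation for
    [part lam p.+1] in [strip_shape]. *)
Lemma strip_shape_vec r mu lam i h : strip_shape mu lam i h ->
  part lam i + h = part mu (i + h) + r -> i + h < N ->
  exists (s : 'S_N) (q : 'I_N), odd_perm s = odd h /\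
  forall k, beta_vec mu k + (if k == q then r else 0) = beta_vec lam (s k).
Proof.
move=> [S1 _ S3 S4] E lt; have [s [os sE]] := cycle_perm lt.
exists s, (Ordinal lt); split=> // k.
rewrite !beta_vecE sE; have lk := ltn_ord k.
have -> : (k == Ordinal lt) = (k == i + h :> nat) by [].
case: eqP => [->|ne]; first lia.
case: ifP => [h1|h1]; first by rewrite S3 //; lia.
rewrite addn0; have [l|g] := ltnP k i; first by rewrite S1.
by rewrite S4 //; lia.
Qed.

(** The moved bead lands at the least index [i] whose bead lies below the new position. Sorting with
    the cycle on [i], ..., [q] must give the beads of [lam], and comparing entries yields
    [strip_shape] with height [q - i]. *)
Lemma bead_move_strip r mu lam (q : 'I_N) (s : 'S_N) : 0 < r ->
  is_part mu -> is_part lam -> size mu <= N -> size lam <= N ->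
  (forall k, beta_vec mu k + (if k == q then r else 0) = beta_vec lam (s k)) ->
  border_strip r mu lam.
Proof.
move=> r0 mP lP smu slam E.
have Xlt (k k' : 'I_N) := @beta_vec_lt mu k k' mP.
set X := beta_vec mu in E Xlt; set Y := beta_vec lam in E.
have XqP : X q < X q + r by rewrite -{1}[X q]addn0 ltn_add2l.
case: (@arg_minnP _ q (fun k => X k < X q + r) (fun k => k : nat) XqP) => i Xi imin.
have iq : i <= q by apply: imin.
have ge (k : 'I_N) : i <= k -> X k < X q + r.
  rewrite leq_eqVlt => /orP[/eqP e|lt]; first by have <- : i = k by apply: val_inj.
  exact: ltn_trans (Xlt _ _ lt) Xi.
(* Equality is excluded, since two beads of [lam] would coincide. *)
have lo (k : 'I_N) : k < i -> X q + r < X k.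
  move=> lt; rewrite ltn_neqAle leqNgt; apply/andP; split.
    apply/eqP => e; have := E q; rewrite eqxx e.
    have nkq : k == q = false by apply/eqP => ekq; move: lt; rewrite ekq; lia.
    have := E k; rewrite nkq addn0 => -> /(beta_vec_inj lP) /perm_inj ekq.
    by rewrite ekq eqxx in nkq.
  by apply/negP => /imin; rewrite leqNgt lt.
have ihN : i + (q - i) < N by rewrite subnKC.
have [u [_ uE]] := cycle_perm ihN; rewrite subnKC // in uE.
pose Z : vec N := [ffun k => X k + (if k == q then r else 0)].
have YE : Y = vperm (s^-1)%g Z.
  by apply/ffunP => k; rewrite [RHS]ffunE [RHS]ffunE E permKV.
have ordE (k : 'I_N) : (k == q) = (k == q :> nat) by [].
have ZE (k : 'I_N) : vperm (u^-1)%g Z (u k) = X k + (if k == q then r else 0).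
  by rewrite [LHS]ffunE permK [LHS]ffunE.
have sZ : runner_sorted_vec 1 (vperm (u^-1)%g Z).
  move=> k k'; rewrite -[k](permKV u) -[k'](permKV u).
  move: ((u^-1)%g k) ((u^-1)%g k') => {}k {}k'; rewrite !uE => lt _.
  rewrite !ZE; move: lt; rewrite !ordE.
  have [ekq|nkq] := eqVneq (k : nat) q.
    have [ekq'|nkq'] := eqVneq (k' : nat) q; first by rewrite ltnn.
    have -> : k = q by apply: val_inj.
    by case: ifP => c lt; rewrite addn0 ge; lia.
  have [ekq'|nkq'] := eqVneq (k' : nat) q.
    have -> : k' = q by apply: val_inj.
    by case: ifP => c lt; rewrite addn0 lo; lia.
  rewrite !addn0 => lt; apply: Xlt.
  by move: lt; repeat case: ifP; lia.
have sY : runner_sorted_vec 1 (vperm (s^-1)%g Z) by rewrite -YE; apply: beta_vec_sorted.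
have := runner_sorted_uniq sY sZ (fun k => etrans (modn1 _) (esym (modn1 _))).
rewrite -YE => YE'.
have YuE (k : 'I_N) : Y (u k) = X k + (if k == q then r else 0).
  by rewrite YE' ZE.
have val_eq (k k' : 'I_N) : u k = k' :> nat -> part lam k' + (N - k'.+1) =
    part mu k + (N - k.+1) + (if k == q then r else 0).
  by move=> /val_inj e; rewrite -!beta_vecE -/X -YuE e.
have out al p : size al <= N -> N <= p -> part al p = 0.
  by move=> l1 l2; apply/part_out/(leq_trans l1).
have qE : part lam i + (N - i.+1) = part mu q + (N - q.+1) + r.
  by have := val_eq q i; rewrite eqxx uE eqxx; apply.
apply: (@strip_shape_border_strip _ _ mP lP r i (q - i)); last first.
  by rewrite subnKC //; have := ltn_ord q; lia.
split.
- move=> p lt; have lpN : p < N by have := ltn_ord i; lia.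
  have := val_eq (Ordinal lpN) (Ordinal lpN); rewrite uE ordE /= ifN; last by lia.
  rewrite ifN; last by lia.
  by move=> /(_ erefl); rewrite ifN //; lia.
- by move: Xi; rewrite /X !beta_vecE; lia.
- rewrite subnKC // => p /andP[lip lpq].
  have lpN : p.+1 < N by have := ltn_ord q; lia.
  have := val_eq (Ordinal (ltnW lpN)) (Ordinal lpN); rewrite uE ordE /= ifN; last by lia.
  rewrite lip lpq => /(_ erefl); rewrite ifN //; lia.
- rewrite subnKC // => p lt; have [lpN|ge'] := ltnP p N; last by rewrite !out.
  have := val_eq (Ordinal lpN) (Ordinal lpN); rewrite uE ordE /= ifN; last by lia.
  rewrite ifN; last by lia.
  by move=> /(_ erefl); rewrite ifN //; lia.
Qed.

Lemma chain_sign_cons al be s :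
  chain_sign al (be :: s) = ((-1) ^+ height al be * chain_sign be s)%R.
Proof. by rewrite /chain_sign /= big_cons. Qed.

Lemma border_stripP r al be : border_strip r al be ->
  [/\ is_part al, is_part be & size al <= size be].
Proof.
move=> /and3P[aP bP /andP[/part_includedP inc _]]; split=> //.
exact: part_size_le.
Qed.

(** A listing of the beads is carried along the chain. Each strip multiplies the permutation by a
    cycle whose sign is given by the height, and preserves the residues and the order on each
    runner. *)
Lemma strip_chain_vec r mu s (t : 'S_N) : 0 < r -> is_part mu ->
  path (border_strip r) mu s -> size (last mu s) <= N ->
  runner_sorted_vec r (vperm t (beta_vec mu)) ->
  exists u : 'S_N, [/\ is_part (last mu s), chain_sign mu s = ((-1) ^+ t * (-1) ^+ u)%R,
    runner_sorted_vec r (vperm u (beta_vec (last mu s)))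
    & forall k, vperm u (beta_vec (last mu s)) k = vperm t (beta_vec mu) k %[mod r]].
Proof.
move=> r0; elim: s mu t => [|be s IH] mu t mP.
  move=> _ _ st; exists t; split=> //.
  by rewrite /chain_sign big_nil -signr_addb addbb.
move=> /= /andP[bs ps] sz st.
have [_ bP _] := border_stripP bs.
have szb : size be <= N.
  apply: leq_trans sz; elim: s be ps {IH bs bP} => //= al s IH be /andP[/border_stripP[_ _ le] /IH].
  exact: (leq_trans le).
have [i [h [S E]]] := border_strip_shape mP bP r0 bs.
have lt : i + h < N by apply: leq_trans (strip_shape_last mP bP S) szb.
have [c [q [oc cE]]] := strip_shape_vec S E lt.
have vE k : vperm (t * c)%g (beta_vec be) k =
    vperm t (beta_vec mu) k + (if t k == q then r else 0).
  by rewrite !(ffunE _ k) permM -cE.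
have st' : runner_sorted_vec r (vperm (t * c)%g (beta_vec be)).
  move=> k k' lk; rewrite !vE => e.
  have {}e : vperm t (beta_vec mu) k = vperm t (beta_vec mu) k' %[mod r].
    by move: e; do 2 case: ifP => _; rewrite ?addn0 ?modnDr.
  have := st _ _ lk e; case: ifP => [/eqP tk'|_]; last by case: ifP => _; lia.
  have -> : (t k == q) = false.
    by apply/eqP => tk; move: lk; rewrite (perm_inj (etrans tk (esym tk'))) ltnn.
  rewrite addn0 => lt'.
  (* Congruent beads differ by at least [r], and a difference of exactly [r] would make two beads of
     [be] coincide; so the moved bead stays below its predecessor on the runner. *)
  have : vperm t (beta_vec mu) k != vperm t (beta_vec mu) k' + r.
    apply/eqP => e'; have := vE k'; rewrite tk' eqxx -e'.
    have := vE k; rewrite ifN; last first.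
      by apply/eqP => tk; move: lk; rewrite (perm_inj (etrans tk (esym tk'))) ltnn.
    rewrite addn0 => <-; rewrite [LHS]ffunE [RHS]ffunE => /(beta_vec_inj bP) /perm_inj ekk.
    by move: lk; rewrite ekk ltnn.
  rewrite neq_ltn => /orP[lt2|//].
  move: e => /eqP; rewrite eqn_mod_dvd ?(ltnW lt') // => /dvdnP[m mE].
  by move: lt' lt2 mE; case: m => [|m]; nia.
have [u [uP us uv ur]] := IH be (t * c)%g bP ps sz st'.
exists u; split=> //.
  rewrite chain_sign_cons us odd_permM signr_addb oc signr_odd (strip_shape_height mP bP S).
  rewrite mulrA (mulrC ((-1) ^+ t)%R) !mulrA -signr_odd -signr_addb addbb.
  by rewrite mul1r.
move=> k; rewrite ur vE; case: ifP => _; rewrite ?addn0 //.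
by rewrite modnDr.
Qed.

(** The sign of any chain is the product of the signs of its first and last listings, and the beads
    of [lam] have only one runner-sorted listing with the given residues. So the choice made by
    [xget] does not matter. *)
Lemma sgn_stripE r mu lam (t u : 'S_N) : 0 < r -> is_part mu -> is_part lam -> size lam <= N ->
  runner_sorted_vec r (vperm t (beta_vec mu)) ->
  runner_sorted_vec r (vperm u (beta_vec lam)) ->
  (forall k, vperm u (beta_vec lam) k = vperm t (beta_vec mu) k %[mod r]) ->
  (exists s, strip_chain r mu lam s) ->
  sgn_strip r lam mu = ((-1) ^+ t * (-1) ^+ u)%R.
Proof.
move=> r0 mP lP sz st su res ex; rewrite /sgn_strip asboolT //.
have [p e] : strip_chain r mu lam (xget [::] [set s | strip_chain r mu lam s]%classic).
  by case: ex => s hs; exact: (@xgetPex _ [::] [set s | strip_chain r mu lam s]%classic (ex_intro _ s hs)).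
set s := xget _ _ in p e *.
have [|u' [_ -> su' res']] := strip_chain_vec r0 mP p _ st; first by rewrite e.
rewrite e in su' res'.
have := runner_sorted_uniq su' su (fun k => etrans (res' k) (esym (res k))).
move=> E; suff -> : u' = u by [].
apply/permP => k; apply: (beta_vec_inj lP).
by have := congr1 (fun v : vec N => v k) E; rewrite [LHS]ffunE [RHS]ffunE.
Qed.

Lemma perm_beta_vec (g : nat -> nat) al : perm_eq (mkseq g N) (beta_set N al) ->
  exists t : 'S_N, vecof N g = vperm t (beta_vec al).
Proof.
move=> p; have sz1 : size (mkseq g N) == N by rewrite size_mkseq.
have sz2 : size (beta_set N al) == N by rewrite size_beta_set.
have /tuple_permP[t tE] : perm_eq (Tuple sz1) (Tuple sz2) by [].
exists t; apply/ffunP => k; rewrite [RHS]ffunE beta_vecE -nth_beta_set //.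
have := congr1 (fun s => nth 0 s k) tE; rewrite /= nth_mkseq // => e.
by rewrite ffunE e nth_mktuple (tnth_nth 0).
Qed.

End Signs.

Lemma count_mkseq (a : pred nat) g n : count a (mkseq g n) = \sum_(k < n) a (g k).
Proof.
rewrite -sumn_count sumnE big_map /mkseq big_map -(big_mkord xpredT (fun k => nat_of_bool (a (g k)))).
by rewrite /index_iota subn0.
Qed.

(** * Abacus positions in the order of the listing, and chains of strips *)

Section Positions.

Variables (r q : nat) (tau : seq nat).
Hypotheses (r0 : 0 < r) (tauP : is_part tau).

Local Notation c := (nbeads r tau (r * q)).
Local Notation N := (size (beads r c)).
Local Notation bead := (bead r c).

Lemma size_beads : N = r * q.
Proof.
rewrite -[RHS](nbeads_sum tau r0) -[LHS]card_ord -sum1_card (big_beads r c (fun=> 1)).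
by apply: eq_bigr => j _; rewrite sum1_card card_ord.
Qed.

Lemma beta_set_beads al : beta_set N al = beta_set (r * q) al.
Proof. by rewrite size_beads. Qed.

Definition abacus_pos (shp : seq (seq nat)) k := (bead k).1 + r * bead_pos r c shp k.

Lemma abacus_pos_mod shp k : k < N -> abacus_pos shp k %% r = (bead k).1.
Proof.
move=> lk; have [lj _] := beadP lk.
by rewrite /abacus_pos addnC mulnC modnMDl modn_small.
Qed.

Lemma abacus_pos_perm (shp : r.-tuple (seq nat)) :
  perm_eq (mkseq (abacus_pos shp) N) (star_beta tau (r * q) shp).
Proof.
apply/seq.permP => a; rewrite count_mkseq count_star_beta.
pose F ji := nat_of_bool (a (ji.1 + r * (part (nth [::] shp ji.1) ji.2 + (c ji.1 - ji.2.+1)))).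
rewrite (big_beads r c F); apply: eq_bigr => j _.
rewrite /beta_set -map_comp -/(mkseq _ _) count_mkseq; apply: eq_bigr => i _.
by rewrite /F /= (tnth_nth [::]) addnBA.
Qed.

Lemma bead_lt k k' : k < k' -> k' < N -> (bead k).1 = (bead k').1 -> (bead k).2 < (bead k').2.
Proof.
move=> lt lk' e; have lk := ltn_trans lt lk'.
have [lj li] := beadP lk; have [_ li'] := beadP lk'.
have [o ho] := beads_block c lj; rewrite -e in li'.
have [l1 e1] := ho _ li; have [l2 e2] := ho _ li'.
have k1 : o + (bead k).2 = k.
  by rewrite -[RHS](index_bead lk) -(index_bead l1) e1 -surjective_pairing.
have k2 : o + (bead k').2 = k'.
  by rewrite -[RHS](index_bead lk') -(index_bead l2) e2 e -surjective_pairing.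
by rewrite -(ltn_add2l o) k1 k2.
Qed.

Lemma abacus_pos_sorted (shp : r.-tuple (seq nat)) : (forall j, is_part (tnth shp j)) ->
  runner_sorted_vec r (vecof N (abacus_pos shp)).
Proof.
move=> sP k k' lt; rewrite !ffunE !abacus_pos_mod // => e.
have l2 := bead_lt lt (ltn_ord k') e.
have [lj li] := beadP (ltn_ord k); have [_ li'] := beadP (ltn_ord k').
rewrite /abacus_pos /bead_pos /bead_part -e in li' *.
rewrite ltn_add2l ltn_pmul2l //.
have nP : is_part (nth [::] shp (bead k).1).
  by have := sP (Ordinal lj); rewrite (tnth_nth [::]).
have := part_anti nP (ltnW l2); lia.
Qed.

Lemma abacus_pos_res (shp shp' : seq (seq nat)) (k : 'I_N) :
  vecof N (abacus_pos shp) k = vecof N (abacus_pos shp') k %[mod r].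
Proof. by rewrite !ffunE !abacus_pos_mod. Qed.

(** Ensures that [star shp tau] can be computed on the abacus with [r * q] beads. *)
Definition fits (shp : r.-tuple (seq nat)) :=
  (forall j, is_part (tnth shp j)) /\ size tau + \max_(j < r) size (tnth shp j) <= q.

Lemma abacus_pos_vec (shp : r.-tuple (seq nat)) : fits shp ->
  exists t : 'S_N, vecof N (abacus_pos shp) = vperm t (beta_vec N (star shp tau)).
Proof.
move=> [sP le]; have [_ _ _ p] := star_beta_perm r0 tauP sP le.
apply: perm_beta_vec; rewrite beta_set_beads; apply: perm_trans (abacus_pos_perm shp) _.
by rewrite perm_sym.
Qed.

Lemma quotient_part (j : 'I_r) : size tau <= q ->
  is_part (tnth (quotient r tau) j) /\ size (tnth (quotient r tau) j) <= c j.
Proof.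
move=> le; rewrite (quotientE r0 tauP le) tnth_quotient_at.
have [h _] := gtn_sorted_part (runner_sorted j r0 (beta_set_sorted (r * q) tauP)).
by split=> //; apply: size_part_of_beta.
Qed.

Lemma star_quotient_eq : fits (quotient r tau) -> star (quotient r tau) tau = tau.
Proof.
move=> [sP le]; have leq_tau : size tau <= q by apply: leq_trans le; apply: leq_addr.
have [sP' s' _ p] := star_beta_perm r0 tauP sP le.
have stau : size tau <= r * q by apply: leq_trans leq_tau _; apply: leq_pmull.
apply: (beta_set_inj (N := r * q)) => //; apply: gtn_sorted_eq; try exact: beta_set_sorted.
by apply: perm_trans p _; rewrite perm_sym; apply: star_quotient.
Qed.

Lemma fits_sub (shp shp' : r.-tuple (seq nat)) : fits shp ->
  (forall j, is_part (tnth shp' j)) ->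
  (forall j i, part (tnth shp' j) i <= part (tnth shp j) i) -> fits shp'.
Proof.
move=> [sP le] sP' inc; split=> //; apply: leq_trans le; rewrite leq_add2l.
apply/bigmax_leqP => j _; apply: leq_trans (leq_bigmax j).
exact: part_size_le.
Qed.

(** One more box in row [p] of component [j] moves a single bead one place along runner [j], that is
    by [r] in the abacus. *)
Lemma star_strip (shp shp' : r.-tuple (seq nat)) (j : 'I_r) p : fits shp -> fits shp' ->
  p < c j ->
  (forall j' i, part (tnth shp j') i = part (tnth shp' j') i + ((j' == j) && (i == p))) ->
  border_strip r (star shp' tau) (star shp tau).
Proof.
move=> fs fs' pc E.
have [t tE] := abacus_pos_vec fs; have [t' tE'] := abacus_pos_vec fs'.
have [sP le] := fs; have [sP' le'] := fs'.
have [P1 S1 _ _] := star_beta_perm r0 tauP sP le.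
have [P2 S2 _ _] := star_beta_perm r0 tauP sP' le'.
have [lk0 bk0] := bead_index (ltn_ord j) pc.
pose k0 := Ordinal lk0.
apply: (@bead_move_strip N r _ _ (t' k0) (t'^-1 * t)%g) => //; rewrite ?size_beads //.
move=> k; rewrite -[k](permKV t'); move: ((t'^-1)%g k) => {}k.
have e1 := congr1 (fun v : vec N => v k) tE; have e2 := congr1 (fun v : vec N => v k) tE'.
rewrite /= [RHS]ffunE in e1; rewrite /= [RHS]ffunE in e2.
rewrite permM permK -e1 -e2 !ffunE (inj_eq perm_inj) /abacus_pos -addnA; congr (_ + _).
have [lj li] := beadP (ltn_ord k).
have := E (Ordinal lj) (bead k).2; rewrite !(tnth_nth [::]) /bead_pos /bead_part => /= ->.
have -> : (Ordinal lj == j) && ((bead k).2 == p) = (k == k0).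
  apply/andP/eqP => [[/eqP e /eqP e']|kk0].
    apply: val_inj; rewrite /= -[LHS](index_bead (ltn_ord k)); congr index.
    by rewrite [bead k]surjective_pairing e' -e.
  have bk : bead k = (j : nat, p) by rewrite kk0.
  by split; [apply/eqP/val_inj; rewrite /= bk | rewrite bk].
by case: (k == k0); lia.
Qed.

(** Boxes are removed one at a time until the quotient is reached; each removal takes one strip off
    the end of the chain. *)
Lemma star_chain (shp : r.-tuple (seq nat)) : fits shp ->
  (forall j i, part (tnth (quotient r tau) j) i <= part (tnth shp j) i) ->
  exists s, strip_chain r tau (star shp tau) s.
Proof.
move=> fs.
have [n] := ubnP (\sum_(j < r) \sum_(i < q) part (tnth shp j) i).
elim: n shp fs => // n IH shp fs; rewrite ltnS => ltn inc.
have [sP le] := fs.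
have leq_tau : size tau <= q by apply: leq_trans le; apply: leq_addr.
have qP j : is_part (tnth (quotient r tau) j) by have [] := quotient_part j leq_tau.
have fq := fits_sub fs qP inc.
have [e|] := pselect (shp = quotient r tau).
  by exists [::]; split=> //=; rewrite e star_quotient_eq.
move=> ne; have [j [p0 jp0]] : exists (j : 'I_r) p, part (tnth (quotient r tau) j) p < part (tnth shp j) p.
  apply: contrapT => H; apply: ne; apply: eq_from_tnth => j.
  apply: part_inj => // i; apply/eqP; rewrite eqn_leq inc andbT leqNgt.
  by apply/negP => lt; apply: H; exists j, i.
have exP : exists p, part (tnth (quotient r tau) j) p < part (tnth shp j) p by exists p0.
have szq j' : size (tnth shp j') <= q.
  apply: leq_trans le; apply: leq_trans (leq_addl _ _).
  exact: (leq_bigmax (F := fun j => size (tnth shp j))).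
have out j' i : q <= i -> part (tnth shp j') i = 0.
  by move=> ge; apply/part_out/(leq_trans (szq j')).
have ubP p : part (tnth (quotient r tau) j) p < part (tnth shp j) p -> p <= q.
  by case: (leqP p q) => // /ltnW /out ->.
(* In the last row exceeding the quotient, the final box is a removable corner, because the next row
   is no longer than that of the quotient. *)
case: (ex_maxnP exP ubP) => p Pp pmax.
have pq : p < q by case: (ltnP p q) => // /(out j) z; move: Pp; rewrite z.
have nxt : part (tnth shp j) p.+1 < part (tnth shp j) p.
  have : part (tnth shp j) p.+1 <= part (tnth (quotient r tau) j) p.+1.
    by rewrite leqNgt; apply/negP => /pmax; rewrite ltnn.
  have := part_anti (qP j) (leqnSn p); lia.
pose g i := part (tnth shp j) i - (i == p).
have [al [alP alE]] : exists al, is_part al /\ forall i, part al i = g i.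
  exists (part_of_fun g q); have [|pP pE] := @part_of_funP g q.
    move=> i _; rewrite /g; have := part_anti (sP j) (leqnSn i).
    have [->|ne1] := eqVneq i p; have [e2|ne2] := eqVneq i.+1 p; lia.
  split=> // i; rewrite pE; case: ltnP => // ge; by rewrite /g out.
pose shp' := [tuple (if j' == j then al else tnth shp j') | j' < r].
have E j' i : part (tnth shp j') i = part (tnth shp' j') i + ((j' == j) && (i == p)).
  rewrite tnth_mktuple; case: eqP => [->|_]; last by rewrite addn0.
  by rewrite alE /g /=; case: eqP => [->|_]; lia.
have inc' j' i : part (tnth shp' j') i <= part (tnth shp j') i by rewrite E leq_addr.
have sP' j' : is_part (tnth shp' j') by rewrite tnth_mktuple; case: eqP.
have fs' := fits_sub fs sP' inc'.
have pc : p < c j.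
  have [_ _ h _] := star_beta_perm r0 tauP sP le; apply: leq_trans (h j).
  by case: (ltnP p (size (tnth shp j))) => // /part_out z; move: Pp; rewrite z.
have [||s [ps es]] := IH shp' fs'.
- apply: leq_trans ltn; rewrite (bigD1 j) //= [X in _ < X](bigD1 j) //= -addSn.
  apply: leq_add; last by apply: leq_sum => j' _; apply: leq_sum.
  rewrite (bigD1 (Ordinal pq)) //= [X in _ < X](bigD1 (Ordinal pq)) //= -addSn.
  apply: leq_add; last by apply: leq_sum => i _.
  by rewrite (E j p) !eqxx addn1.
- move=> j' i; rewrite [tnth shp' j']tnth_mktuple; case: (j' =P j) => [->|_]; last exact: inc.
  by rewrite alE /g; have := inc j i; case: (i =P p) => [->|_] /=; lia.
exists (rcons s (star shp tau)); split; last by rewrite last_rcons.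
by rewrite rcons_path ps es; apply: (star_strip fs fs' pc E).
Qed.

Lemma sgn_star (nu : r.-tuple (seq nat)) (t u : 'S_N) : fits nu ->
  (forall j i, part (tnth (quotient r tau) j) i <= part (tnth nu j) i) ->
  vecof N (abacus_pos (quotient r tau)) = vperm t (beta_vec N tau) ->
  vecof N (abacus_pos nu) = vperm u (beta_vec N (star nu tau)) ->
  sgn_strip r (star nu tau) tau = ((-1) ^+ t * (-1) ^+ u)%R.
Proof.
move=> fn inc tE uE; have [sP le] := fn.
have leq_tau : size tau <= q by apply: leq_trans le; apply: leq_addr.
have qP j : is_part (tnth (quotient r tau) j) by have [] := quotient_part j leq_tau.
have [P1 S1 _ _] := star_beta_perm r0 tauP sP le.
apply: (@sgn_stripE N) => //.
- by rewrite size_beads.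
- by rewrite -tE; apply: abacus_pos_sorted.
- by rewrite -uE; apply: abacus_pos_sorted.
- by move=> k; rewrite -tE -uE; apply: abacus_pos_res.
- exact: star_chain.
Qed.

End Positions.

(** * Coefficients of power series *)

Section Monomials.

Variable N : nat.

Definition mon (v : vec N) : {cmonom nat} :=
  mkcmonom [fsfun k in [fset k in iota 0 N]%fset =>
    (if insub k is Some i then v i else 0) | 0].

Lemma monE (v : vec N) k : mon v k = if insub k is Some i then v i else 0.
Proof.
rewrite /mon cmE /= fsfun_fun; case: insubP => [i lk _|].
  by rewrite in_fsetE /= mem_iota /= lk.
by rewrite if_same.
Qed.

Lemma vecof_mon (v : vec N) : vecof N (mon v) = v.
Proof. by apply/ffunP => k; rewrite ffunE monE valK. Qed.

Lemma mon_out (v : vec N) k : N <= k -> mon v k = 0.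
Proof. by move=> ge; rewrite monE insubF // ltnNge ge. Qed.

Lemma mon_vecof (m : {cmonom nat}) : (forall k, N <= k -> m k = 0) -> mon (vecof N m) = m.
Proof.
move=> mN; apply/eqP/cmP => k; rewrite monE; case: insubP => [i lk <-|]; first by rewrite ffunE.
by rewrite -leqNgt => /mN.
Qed.

Local Open Scope classical_set_scope.
Local Open Scope ring_scope.

(** On monomials in the first [N] variables, [f] is the generating function of the contents
    [c x]. *)
Definition content_sum (f : powser) (I : finType) (P : pred I) (c : I -> vec N) :=
  forall m : {cmonom nat}, (forall k, (N <= k)%N -> m k = 0%N) ->
  f m = \sum_(x | P x) (c x == vecof N m)%:R.

(** For [r > 0] at most one monomial is sent to x^m, so the sum in [plethysm_p] has at most one
    term. *)
Lemma plethysm_content_sum r f (I : finType) (P : pred I) c : (0 < r)%N ->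
  content_sum f P c -> content_sum (plethysm_p r f) P (fun x => vscale r (c x)).
Proof.
move=> r0 fE m mN; rewrite /plethysm_p.
have [[a aE]|na] := pselect (exists a : {cmonom nat}, forall i, m i = (r * a i)%N).
  have -> : [set a : {cmonom nat} | forall i, m i = (r * a i)%N]%classic = [set a]%classic.
    apply/seteqP; split=> b /= => [bE|->//]; apply/eqP/cmP => i.
    by apply/eqP; rewrite -(eqn_pmul2l r0) -aE -bE.
  rewrite fsbig_set1 fE => [|k ge]; last first.
    by have /eqP := aE k; rewrite mN // eq_sym muln_eq0 gtn_eqF //= => /eqP.
  apply: eq_bigr => x _; congr (nat_of_bool _)%:R; apply/eqP/eqP => /ffunP h; apply/ffunP => k.
    by have := h k; rewrite !ffunE aE => ->.
  by apply/eqP; have /eqP := h k; rewrite !ffunE aE eqn_pmul2l.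
have -> : [set a : {cmonom nat} | forall i, m i = (r * a i)%N]%classic = set0.
  by apply/seteqP; split=> b //= bE; apply: na; exists b.
rewrite fsbig_set0 big1 // => x _; case: eqP => // /ffunP h; case: na.
exists (mon (c x)) => k; have [lk|ge] := ltnP k N; last by rewrite mN // mon_out ?muln0.
by have := h (Ordinal lk); rewrite !ffunE monE insubT.
Qed.

Lemma sum_eq_seq (I : choiceType) (l : seq I) z : uniq l ->
  \sum_(i <- l) (z == i)%:R = (z \in l)%:R :> int.
Proof.
elim: l => [|i l IH] /=; first by rewrite big_nil.
move=> /andP[il ul]; rewrite big_cons IH // in_cons.
by have [->|//] := eqVneq z i; [rewrite (negPf il) addr0 | rewrite add0r].
Qed.

Lemma powser_mul_content_sum f g (I J : finType) (P : pred I) (Q : pred J) c d :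
  content_sum f P c -> content_sum g Q d ->
  content_sum (powser_mul f g) (fun xy => P xy.1 && Q xy.2) (fun xy => vadd (c xy.1) (d xy.2)).
Proof.
move=> fE gE m mN; pose h (xy : I * J) := (mon (c xy.1), mon (d xy.2)).
pose T xy := [&& P xy.1, Q xy.2 & vadd (c xy.1) (d xy.2) == vecof N m].
(* All pairs with a nonzero term arise from contents, so [l] can replace the set of all
   factorisations of [m]. *)
pose l := undup [seq h xy | xy <- enum T].
have hI xy (ab : {cmonom nat} * {cmonom nat}) :
    (forall k, (N <= k)%N -> ab.1 k = 0%N) ->
    (forall k, (N <= k)%N -> ab.2 k = 0%N) ->
    (h xy == ab) = (c xy.1 == vecof N ab.1) && (d xy.2 == vecof N ab.2).
  case: ab => a b /= aN bN; rewrite /h xpair_eqE.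
  by rewrite -{1}(mon_vecof aN) -{1}(mon_vecof bN); congr (_ && _); apply/eqP/eqP => [e|->//];
    rewrite -(vecof_mon (vecof N _)) -e vecof_mon.
have mulE (ab : {cmonom nat} * {cmonom nat}) : mmul ab.1 ab.2 = m ->
    (forall k, (N <= k)%N -> ab.1 k = 0%N) /\
    (forall k, (N <= k)%N -> ab.2 k = 0%N).
  by move=> e; split=> k /mN; rewrite -e cmM; lia.
have termE (ab : {cmonom nat} * {cmonom nat}) : mmul ab.1 ab.2 = m ->
    f ab.1 * g ab.2 = \sum_(xy | P xy.1 && Q xy.2) (h xy == ab)%:R.
  move=> e; have [aN bN] := mulE _ e; rewrite fE // gE // big_distrlr /= pair_big /=.
  by apply: eq_bigr => xy _; rewrite hI // -natrM mulnb.
have inl xy : P xy.1 && Q xy.2 -> mmul (h xy).1 (h xy).2 = m -> h xy \in l.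
  move=> /andP[Px Qy] e; rewrite mem_undup; apply: map_f; rewrite mem_enum; apply/and3P; split=> //.
  by apply/eqP/ffunP => k; rewrite !ffunE -e cmM !monE !valK.
have hm xy : vadd (c xy.1) (d xy.2) = vecof N m -> mmul (h xy).1 (h xy).2 = m.
  move=> /ffunP e; apply/eqP/cmP => k; rewrite cmM !monE.
  case: insubP => [i _ <-|]; first by have := e i; rewrite !ffunE.
  by rewrite -leqNgt => /mN.
have lE (ab : {cmonom nat} * {cmonom nat}) : ab \in l -> mmul ab.1 ab.2 = m.
  by rewrite mem_undup => /mapP[xy]; rewrite mem_enum => /and3P[_ _ /eqP/hm e] ->.
have lA : [set` l]%classic `<=` [set ab | mmul ab.1 ab.2 = m]%classic by move=> ab /lE.
have f0 ab : [set ab | mmul ab.1 ab.2 = m]%classic ab -> ab \notin l -> f ab.1 * g ab.2 = 0.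
  move=> e abl; rewrite termE // big1 // => xy PQ; case: eqP => // eh.
  by case/negP: abl; rewrite -eh; apply: inl; rewrite // eh.
rewrite /powser_mul (fsbigE _ _ (undup_uniq _) lA f0).
rewrite big_seq_cond (eq_bigl (fun ab => ab \in l)); last first.
  by move=> ab /=; case abl : (ab \in l) => //=; apply: mem_set; exact: lE.
rewrite (eq_bigr _ (fun ab abl => termE ab (lE ab abl))) exchange_big /=.
apply: eq_bigr => xy PQ; rewrite -big_seq sum_eq_seq ?undup_uniq //.
congr (nat_of_bool _)%:R; apply/idP/eqP => [/lE e|/hm]; last exact: inl.
by apply/ffunP => k; rewrite !ffunE -e cmM !monE !valK.
Qed.

Lemma fsum_powser (I : choiceType) (A : set I) (l : seq I) (F : I -> powser) (z : I -> int) m :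
  uniq l -> (forall i, i \in l -> A i) -> (forall i, A i -> i \notin l -> z i = 0) ->
  (\sum_(i \in A) F i *~ z i) m = \sum_(i <- l) F i m * z i.
Proof.
move=> ul lA z0; have lA' : [set` l]%classic `<=` A by move=> i /lA.
have f0 i : A i -> i \notin l -> F i *~ z i = 0 by move=> Ai il; rewrite z0 // mulr0z.
rewrite (fsbigE _ _ ul lA' f0).
rewrite big_seq_cond (eq_bigl (fun i => i \in l)); last first.
  by move=> i /=; case il : (i \in l) => //=; apply: mem_set; exact: lA.
rewrite -big_seq fct_sumE; apply: eq_bigr => i _.
case: (z i) => k.
  by rewrite -[F i *~ _]/(F i *+ k) natmulfctE -mulr_natr natz.
rewrite -[F i *~ _]/(- (F i *+ k.+1)) natmulfctE NegzE mulrN -natz mulr_natr.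
by [].
Qed.

End Monomials.

Lemma part_le_head al p : is_part al -> part al p <= head 0 al.
Proof. by move=> aP; rewrite -nth0; apply: part_anti. Qed.

Lemma size_le_sumn al : is_part al -> size al <= sumn al.
Proof.
case/andP=> _; elim: al => //= x al IH; rewrite in_cons negb_or => /andP[x0 /IH].
by move: x0; rewrite eq_sym -lt0n; lia.
Qed.

Local Open Scope ring_scope.

Definition straight_tab N al := @tabmat (size al) N (head 0%N al) (fun=> 0%N) (part al).
Arguments straight_tab N al M : clear implicits.

(** * Multiplication of tableau sums by a_delta *)

Section Convolution.

Variable N : nat.
Local Notation tab0 := (straight_tab N).

Lemma conv_sum1 (I : Type) (l : seq I) (P : pred I) (g : I -> vec N -> int) m :
  conv (fun m => \sum_(i <- l | P i) g i m) m = \sum_(i <- l | P i) conv (g i) m.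
Proof.
have := conv_sum l P g (fun=> 1) m; under [RHS]eq_bigr do rewrite mulr1.
by move=> <-; congr conv; apply/funext => v; apply: eq_bigr => i _; rewrite mulr1.
Qed.

Lemma schur_alt al F : is_part al -> (size al <= N)%N ->
  \sum_(T | tab0 al T) \sum_(s : 'S_N) (-1) ^+ s * F (vadd (vperm s (vdelta N)) (colv T)) =
  alt F (beta_vec N al).
Proof.
move=> aP sz; apply: straight_alt => //.
- by move=> p; apply: part_le_head.
- by move=> p; apply: part_out.
- by move=> p; apply: part_anti.
Qed.

Lemma conv_schur al m : is_part al -> (size al <= N)%N ->
  conv (fun v => \sum_(T | tab0 al T) (colv T == v)%:R) m =
  alt (fun v => (v == m)%:R) (beta_vec N al).
Proof.
move=> aP sz; rewrite conv_sum1 -schur_alt //.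
by apply: eq_bigr => T _; rewrite conv_indic.
Qed.

Lemma vaddA (u v w : vec N) : vadd u (vadd v w) = vadd (vadd u v) w.
Proof. by apply/ffunP => k; rewrite !ffunE addnA. Qed.

Section Product.

Variables (R B : nat) (mu lam : nat -> nat).
Hypothesis lamB : forall p, (lam p <= B)%N.
Hypothesis lamR : forall p, (R <= p)%N -> lam p = 0%N.
Local Notation tab := (@tabmat R N B mu lam).

(** The straight tableaux absorb a_delta by [schur_alt], and the symmetry of the other tableau sum,
    in the form [tab_alt], assembles the terms into alternants. *)
Lemma conv_product r al m : is_part al -> (size al <= N)%N ->
  conv (fun v => \sum_(TU | tab0 al TU.1 && tab TU.2)
     (vadd (colv TU.1) (vscale r (colv TU.2)) == v)%:R) m =
  \sum_(U | tab U) alt (fun v => (v == m)%:R) (vadd (beta_vec N al) (vscale r (colv U))).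
Proof.
move=> aP sz; rewrite conv_sum1 -tab_alt //.
under eq_bigr do rewrite conv_indic.
rewrite -(pair_big (tab0 al) tab (fun T U => \sum_(s : 'S_N) (-1) ^+ s *
  (vadd (vperm s (vdelta N)) (vadd (colv T) (vscale r (colv U))) == m)%:R)) /=.
rewrite exchange_big /=; apply: eq_bigr => U _.
rewrite -/(alt (fun v => (vadd v (vscale r (colv U)) == m)%:R) (beta_vec N al)).
rewrite -schur_alt //; apply: eq_bigr => T _; apply: eq_bigr => s _.
by rewrite vaddA.
Qed.

(** The exponents may be listed in any order at the cost of a sign; this serves to pass from
    decreasing order to the order runner by runner. *)
Lemma tab_alt_perm F r b (t : 'S_N) :
  \sum_(U | tab U) alt F (vadd b (vscale r (colv U))) =
  (-1) ^+ t * \sum_(U | tab U) alt F (vadd (vperm t b) (vscale r (colv U))).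
Proof.
rewrite (tab_sym mu lamB lamR (fun u => alt F (vadd (vperm t b) (vscale r u))) t).
rewrite mulr_sumr; apply: eq_bigr => U _.
by rewrite -vperm_scale -vperm_add alt_perm mulrA -signr_addb addbb mul1r.
Qed.

End Product.

End Convolution.

(** * The theorem *)

Section Main.

Variables (r n q : nat) (tau lam mu : seq nat).
Hypotheses (r0 : (0 < r)%N) (tauP : is_part tau) (lamP : is_part lam) (muP : is_part mu).
Hypotheses (mu_lam : part_included mu lam) (sizen : (sumn lam - sumn mu)%N = n).

Local Notation quo := (quotient r tau).

(** A partition has at most as many rows as boxes, so each admissible nu(j) has at most |quo(j)| + n
    rows. Such a [q] therefore serves all [nu] at once. *)
Hypothesis q_big : (size tau + (\max_(j < r) sumn (tnth quo j) + n) <= q)%N.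

Local Notation c := (nbeads r tau (r * q)).
Local Notation N := (size (beads r c)).
Local Notation bead := (bead r c).
Local Notation B := (head 0%N lam).
Local Notation U_mat := (mat (size lam) N B).
Local Notation tab := (@tabmat (size lam) N B (part mu) (part lam)).

Let tau_q : (size tau <= q)%N.
Proof. by apply: leq_trans q_big; apply: leq_addr. Qed.

Let quoP j : is_part (tnth quo j).
Proof. by have [] := quotient_part r0 tauP j tau_q. Qed.

Let lamB p : (part lam p <= B)%N. Proof. exact: part_le_head. Qed.

Lemma multipartition_fits (nu : r.-tuple (seq nat)) : skew_multipartition n nu quo ->
  fits q tau nu.
Proof.
move=> [nP inc nE]; split=> [j|]; first by have [] := nP j.
apply: leq_trans q_big; rewrite leq_add2l; apply/bigmax_leqP => j _.
have [njP _] := nP j; apply: leq_trans (size_le_sumn njP) _.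
apply: leq_trans (_ : _ <= sumn (tnth quo j) + n)%N _; last first.
  by rewrite leq_add2r; apply: (leq_bigmax (F := fun j => sumn (tnth quo j))).
by rewrite -nE (bigD1 j) //=; lia.
Qed.

Lemma multipartition_size (nu : r.-tuple (seq nat)) (j : 'I_r) : fits q tau nu ->
  (size (tnth nu j) <= c j)%N.
Proof. by move=> [nP le]; have [_ _ ->] := star_beta_perm r0 tauP nP le. Qed.

Definition lattice_mat (U : U_mat) :=
  tab U && `[< lattice (same_runner r c) (bead_pos r c quo) (ent U) >].

Definition bead_end (U : U_mat) k := (bead_part r c quo k + \sum_(p < size lam) ent U p k)%N.

(** The multipartition represented by the runners after the beads have moved by the content of
    [U]. *)
Definition nu_of (U : U_mat) : r.-tuple (seq nat) :=
  [tuple part_of_fun (fun i => bead_end U (index (j : nat, i) (beads r c))) (c j) | j < r].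

Lemma nu_ofP (U : U_mat) (j : 'I_r) : lattice_mat U -> is_part (tnth (nu_of U) j) /\
  forall i, part (tnth (nu_of U) j) i =
    if (i < c j)%N then bead_end U (index (j : nat, i) (beads r c)) else 0%N.
Proof.
move=> /andP[_ /asboolP/same_latticeE L]; rewrite tnth_mktuple.
apply: part_of_funP => i li; rewrite index_beadS //.
have := L _ (size lam) (same_runner_index (ltn_ord j) li).
by rewrite /bead_end big_ord_recr /= [ent _ (size lam) _]ent_out ?leqnn // addn0.
Qed.

Lemma nu_of_inc (U : U_mat) (j : 'I_r) i : lattice_mat U ->
  (part (tnth quo j) i <= part (tnth (nu_of U) j) i)%N.
Proof.
move=> gU; have [_ ->] := nu_ofP j gU; case: ltnP => li.
  rewrite /bead_end /bead_part; have [_ ->] := bead_index (ltn_ord j) li.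
  by rewrite /= (tnth_nth [::]) leq_addr.
have [_ le] := quotient_part r0 tauP j tau_q.
by rewrite part_out // (leq_trans le).
Qed.

Lemma bead_part_nu_of (U : U_mat) k : lattice_mat U -> (k < N)%N ->
  bead_part r c (nu_of U) k = bead_end U k.
Proof.
move=> gU lk; have [lj li] := beadP lk; rewrite /bead_part.
have := (nu_ofP (Ordinal lj) gU).2 (bead k).2; rewrite (tnth_nth [::]) /= li => ->.
by rewrite -surjective_pairing index_bead.
Qed.

Lemma lr_mat_nu_of (U : U_mat) : lattice_mat U -> lr_mat (nu_of U) quo mu U.
Proof.
move=> gU; have /andP[h1 h2] := gU; apply/and3P; split=> //.
by apply/eqP/ffunP => k; rewrite !ffunE bead_part_nu_of.
Qed.

(** The column sums of [U] determine [nu], so the coefficients for the various [nu] count disjoint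
    classes of surviving matrices. *)
Lemma nu_of_uniq (U : U_mat) (nu : r.-tuple (seq nat)) : fits q tau nu ->
  lr_mat nu quo mu U = lattice_mat U && (nu_of U == nu).
Proof.
move=> fn; apply/idP/andP => [mU|[gU /eqP <-]]; last exact: lr_mat_nu_of.
have gU : lattice_mat U by case/and3P: mU => h1 h2 _; apply/andP.
split=> //; apply/eqP/eq_from_tnth => j; have [P1 E] := nu_ofP j gU.
apply: part_inj => // [|i]; first by case: fn.
rewrite E; case: ltnP => li; last by rewrite part_out // (leq_trans (multipartition_size j fn)).
have [lk e] := bead_index (ltn_ord j) li.
by rewrite /bead_end (lr_mat_col mU lk) /bead_part e /= (tnth_nth [::]).
Qed.

(** The entries of [U] are summed in two ways: by columns they count the boxes added to the
    quotient, by rows the boxes of [lam / mu]. *)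
Lemma nu_of_multipartition (U : U_mat) : lattice_mat U -> skew_multipartition n (nu_of U) quo.
Proof.
move=> gU; split=> [j|j|]; first by split; [case: (nu_ofP j gU) | exact: quoP].
  by apply: part_includedI => i; apply: nu_of_inc.
have sumE (al : seq nat) m : (size al <= m)%N -> sumn al = (\sum_(i < m) part al i)%N by apply: part_sum.
have szn (j : 'I_r) : (size (tnth (nu_of U) j) <= c j)%N.
  by rewrite tnth_mktuple size_filter (leq_trans (count_size _ _)) // size_mkseq.
have step (j : 'I_r) : (sumn (tnth (nu_of U) j) - sumn (tnth quo j) =
   \sum_(i < c j) \sum_(p < size lam) ent U p (index (j : nat, i : nat) (beads r c)))%N.
  have [_ le] := quotient_part r0 tauP j tau_q.
  rewrite (sumE _ _ (szn j)) (sumE _ _ le).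
  have -> : (\sum_(i < c j) part (tnth (nu_of U) j) i = \sum_(i < c j) (part (tnth quo j) i +
      \sum_(p < size lam) ent U p (index (j : nat, i : nat) (beads r c))))%N.
    apply: eq_bigr => i _; have [_ ->] := nu_ofP j gU; rewrite ltn_ord.
    rewrite /bead_end /bead_part; have [_ ->] := bead_index (ltn_ord j) (ltn_ord i).
    by rewrite /= (tnth_nth [::]).
  by rewrite big_split /= addKn.
rewrite (eq_bigr _ (fun j _ => step j)).
pose F ji := (\sum_(p < size lam) ent U p (index ji (beads r c)))%N.
rewrite -(big_beads r c F) /F exchange_big /= -sizen.
have /andP[/asboolP[_ rowE] _] := gU.
rewrite (sumE lam _ (leqnn _)) (sumE mu (size lam)); last first.
  by apply: part_size_le => //; apply: part_includedP.
have -> : (\sum_(i < size lam) part lam i = \sum_(i < size lam) part mu i +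
    \sum_(p < size lam) \sum_(k < N) ent U p k)%N.
  by rewrite -big_split; apply: eq_bigr => p _; rewrite -rowE.
rewrite addKn; apply: eq_bigr => p _; apply: eq_bigr => k _.
by rewrite index_bead.
Qed.

(** The multipartitions that occur for some surviving matrix; for all others the coefficient
    vanishes by [lr_coef_out]. *)
Definition nu_list : seq (r.-tuple (seq nat)) := undup [seq nu_of U | U <- enum lattice_mat].

Lemma nu_listP nu : nu \in nu_list -> skew_multipartition n nu quo.
Proof.
by rewrite mem_undup => /mapP[U]; rewrite mem_enum => gU ->; apply: nu_of_multipartition.
Qed.

Lemma mem_nu_list (U : U_mat) : lattice_mat U -> nu_of U \in nu_list.
Proof. by move=> gU; rewrite mem_undup map_f // mem_enum. Qed.

Lemma multipartition_inc (nu : r.-tuple (seq nat)) j i : skew_multipartition n nu quo ->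
  (part (tnth quo j) i <= part (tnth nu j) i)%N.
Proof. by move=> [_ inc _]; apply: part_includedP. Qed.

Lemma lr_coef_nu (nu : r.-tuple (seq nat)) : skew_multipartition n nu quo ->
  (lr_coef lam (rcons (zip nu quo) (mu, [::])))%:Z = \sum_(U | lattice_mat U) (nu_of U == nu)%:R.
Proof.
move=> sm; have fn := multipartition_fits sm.
rewrite (@lr_coefE r B c) //; first last.
- by move=> j; apply: multipartition_size.
- by case: sm.
- by case: fn.
rewrite -natr_sum -big_mkcondr sum1_card natz; congr Posz.
by apply: eq_card => U; rewrite [LHS]nu_of_uniq.
Qed.

Lemma lr_coef_out (nu : r.-tuple (seq nat)) : skew_multipartition n nu quo ->
  nu \notin nu_list -> lr_coef lam (rcons (zip nu quo) (mu, [::])) = 0%N.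
Proof.
move=> sm nl; apply/eqP; rewrite -eqz_nat lr_coef_nu // big1 // => U gU.
by case: eqP => // e; move: nl; rewrite -e mem_nu_list.
Qed.

(** Each surviving [U] contributes the alternant at its final bead positions, and the permutation
    [u] relating these to [beta_vec] depends only on [nu_of U]. Its sign and that of [t], which does
    the same for the initial positions, combine to [sgn_strip]. *)
Lemma product_alt F :
  \sum_(U | tab U) alt F (vadd (beta_vec N tau) (vscale r (colv U))) =
  \sum_(nu <- nu_list) alt F (beta_vec N (star nu tau)) *
    (sgn_strip r (star nu tau) tau * (lr_coef lam (rcons (zip nu quo) (mu, [::])))%:Z).
Proof.
have quo_size (j : 'I_r) : (size (tnth quo j) <= \max_(j < r) sumn (tnth quo j))%N.
  apply: leq_trans (size_le_sumn (quoP j)) _.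
  exact: (leq_bigmax (F := fun j => sumn (tnth quo j))).
have fq : fits q tau quo.
  split=> //; apply: leq_trans q_big; rewrite leq_add2l; apply: leq_trans (leq_addr _ _).
  by apply/bigmax_leqP => j _; apply: quo_size.
have [t tE] := abacus_pos_vec r0 tauP fq.
rewrite (star_quotient_eq r0 tauP fq) in tE.
rewrite (tab_alt_perm _ lamB (@part_out lam) _ _ _ t) -tE.
have sameN k : same_runner r c k -> (k.+1 < N)%N /\ (bead k.+1).1 = (bead k).1.
  by move=> /andP[lk /eqP ->].
have posS k : same_runner r c k -> (bead_pos r c quo k.+1 < bead_pos r c quo k)%N.
  move=> sk; have /andP[lk /eqP e] := sk; have [lj li] := beadP lk.
  rewrite /bead_pos /bead_part e /= in lj li *.
  have := part_anti (quoP (Ordinal lj)) (leqnSn (bead k).2).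
  by rewrite !(tnth_nth [::]) /=; lia.
rewrite (tab_lattice_cancel _ lamB (@part_out lam) _ _ sameN posS).
have posE (U : U_mat) : lattice_mat U ->
    vadd (vecof N (abacus_pos r q tau quo)) (vscale r (colv U)) =
    vecof N (abacus_pos r q tau (nu_of U)).
  move=> gU; apply/ffunP => k; rewrite !ffunE /abacus_pos /bead_pos bead_part_nu_of // /bead_end.
  by rewrite -!addnA; congr (_ + _)%N; rewrite -mulnDr; congr (_ * _)%N; rewrite [LHS]addnAC addnA.
rewrite (eq_bigr (fun U => alt F (vecof N (abacus_pos r q tau (nu_of U))))); last first.
  by move=> U gU; rewrite -posE.
have termE nu : nu \in nu_list -> alt F (beta_vec N (star nu tau)) *
    (sgn_strip r (star nu tau) tau * (lr_coef lam (rcons (zip nu quo) (mu, [::])))%:Z) =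
    (-1) ^+ t *
    \sum_(U | lattice_mat U) alt F (vecof N (abacus_pos r q tau (nu_of U))) * (nu_of U == nu)%:R.
  move=> /nu_listP sm; have fn := multipartition_fits sm.
  have [u uE] := abacus_pos_vec r0 tauP fn.
  rewrite (sgn_star r0 tauP fn (fun j i => multipartition_inc j i sm) tE uE) lr_coef_nu //.
  rewrite !mulr_sumr; apply: eq_bigr => U _; case: eqP => [->|_]; last by rewrite !mulr0.
  by rewrite !mulr1 uE alt_perm mulrC mulrA.
rewrite [RHS]big_seq; under [RHS]eq_bigr => nu nl do rewrite (termE nu nl).
rewrite -mulr_sumr; congr (_ * _).
rewrite [RHS]exchange_big; apply: eq_big => [//|U gU].
by rewrite -mulr_sumr -big_seq sum_eq_seq ?undup_uniq // mem_nu_list // mulr1.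
Qed.

Lemma theorem_coefficient (m : {cmonom nat}) : (forall k, (r * q <= k)%N -> m k = 0%N) ->
  powser_mul (schur tau) (plethysm_p r (skew_schur lam mu)) m =
  \sum_(nu <- nu_list) schur (star nu tau) m *
    (sgn_strip r (star nu tau) tau * (lr_coef lam (rcons (zip nu quo) (mu, [::])))%:Z).
Proof.
rewrite -(size_beads q tau r0) => mN.
have nil_part : part [::] = fun=> 0%N by apply/funext => i; rewrite part_nil.
have schurE al : is_part al ->
    content_sum (schur al) (straight_tab N al) (@colv (size al) N (head 0%N al)).
  move=> aP m' mN'; rewrite /schur (@skew_schurE al [::] N (head 0%N al)) //.
  - by rewrite nil_part.
  - exact: included_nil.
  - by move=> p; apply: part_le_head.
have skewE : content_sum (skew_schur lam mu) tab (@colv (size lam) N B).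
  by move=> m' mN'; apply: skew_schurE.
have starP nu : nu \in nu_list -> is_part (star nu tau) /\ (size (star nu tau) <= N)%N.
  move=> /nu_listP/multipartition_fits[nP le].
  by have [? ? _ _] := star_beta_perm r0 tauP nP le; rewrite size_beads.
have szt : (size tau <= N)%N by rewrite size_beads // (leq_trans tau_q) // leq_pmull.
rewrite (powser_mul_content_sum (schurE _ tauP) (plethysm_content_sum r0 skewE)) //.
rewrite big_seq; under [RHS]eq_bigr => nu nl do rewrite (schurE _ (starP _ nl).1) //.
(* Both sides depend on [m] only through its exponent vector. The vector is generalised because
   cancelling a_delta involves all coefficients. *)
rewrite -big_seq; move: (vecof N m) => {m mN}.
apply: conv_inj => m.
rewrite (conv_product _ lamB (@part_out lam)) // conv_sum product_alt.
rewrite !big_seq; apply: eq_bigr => nu nl.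
by have [? ?] := starP nu nl; rewrite conv_schur.
Qed.

End Main.

Local Open Scope classical_set_scope.

Theorem theorem1p1 (r n : nat) (tau lam mu : seq nat)
    (r_gt0 : (0 < r)%N) (tauP : is_part tau)
    (lamP : is_part lam) (muP : is_part mu) (mu_lam : part_included mu lam)
    (sizen : (sumn lam - sumn mu)%N = n) :
  powser_mul (schur tau) (plethysm_p r (skew_schur lam mu)) =
  \sum_(nu \in [set nu : r.-tuple (seq nat) |
                  skew_multipartition n nu (quotient r tau)])
     schur (star nu tau) *~
       (sgn_strip r (star nu tau) tau *
        (lr_coef lam (rcons (zip nu (quotient r tau)) (mu, [::])))%:Z).
Proof.
apply/funext => m.
(* [d] exceeds the index of every variable of [m]; adding it to [q] keeps [m] within the first
   [r * q] variables. *)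
pose d := \max_(k <- finsupp m) k.+1.
pose q := (size tau + (\max_(j < r) sumn (tnth (quotient r tau) j) + n) + d)%N.
have qb : (size tau + (\max_(j < r) sumn (tnth (quotient r tau) j) + n) <= q)%N.
  by apply: leq_addr.
have mN k : (r * q <= k)%N -> m k = 0%N.
  move=> le; apply/eqP; rewrite cmE_eq0; apply/negP => km.
  have : (k < d)%N by apply: (leq_bigmax_seq (F := fun k => k.+1)).
  have : (q <= r * q)%N by apply: leq_pmull.
  by rewrite /q; lia.
rewrite (theorem_coefficient r_gt0 tauP lamP muP mu_lam sizen qb mN).
rewrite (fsum_powser (l := nu_list r q tau lam mu)) ?undup_uniq //.
- by move=> nu; apply: nu_listP sizen qb _.
- by move=> nu sm nl; rewrite (lr_coef_out _ _ _ _ mu_lam sizen qb) ?mulr0.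
Qed.
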